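(* Let $\mathcal{C} \subset \mathbb{P}^d$ ($d \geq 2$) be a rational normal curve of degree $d$. Then: (1) The minimal irreducible decomposition of $\Phi_3(\mathcal{C})$ is $$\Phi_3(\mathcal{C}) = \bigcup_{1 \le \ell \le d/2} W_\ell(\mathcal{C}).$$ (2) For every $1 \le \ell \le d/2$, the projective variety $W_\ell(\mathcal{C})$ is non-degenerate in $\mathbb{P}(I(\mathcal{C})_2)$ (i.e. not contained in any hyperplane). Therefore, $I(\mathcal{C})$ can be generated by quadrics in $W_\ell(\mathcal{C})$. (3) $W_1(\mathcal{C})$ is projectively equivalent to the second Veronese variety $\nu_2(\mathbb{P}^{d-2})$. In particular, $W_1(\mathcal{C})$ is smooth.
   Context: $\mathbb{K}$ is an algebraically closed field of characteristic $0$. Choose coordinates so that $\mathcal{C} = \{[x^d : x^{d-1}y : \cdots : y^d] \mid [x:y]\in\mathbb{P}^1\}$, and let $S=\mathbb{K}[z_0,\ldots,z_d]$ be the homogeneous coordinate ring of $\mathbb{P}^d$, $I(\mathcal{C})\subset S$ the homogeneous ideal of $\mathcal{C}$, and $I(\mathcal{C})_2$ its degree $2$ part. The locus of rank $3$ quadratic equations is $$\Phi_3(\mathcal{C}) = \{[Q] \mid Q\in I(\mathcal{C})_2\setminus\{0\},\ \mathrm{rank}(Q)=3\}\subset \mathbb{P}(I(\mathcal{C})_2),$$ where rank is the rank of $Q$ as a quadratic form. Let $\varphi:\mathbb{K}[x,y]_d\to S_1$ be the $\mathbb{K}$-linear isomorphism with $\varphi(x^{d-i}y^i)=z_i$ for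 $0\le i\le d$. For each integer $1\le \ell\le d/2$ define $$Q_\ell:\mathbb{K}[x,y]_\ell\times\mathbb{K}[x,y]_\ell\times\mathbb{K}[x,y]_{d-2\ell}\to I(\mathcal{C})_2,\quad Q_\ell(f,g,h)=\varphi(f^2h)\varphi(g^2h)-\varphi(fgh)^2,$$ and $$W_\ell(\mathcal{C})=\{[Q_\ell(f,g,h)] \mid (f,g,h)\in \mathbb{K}[x,y]_\ell\times\mathbb{K}[x,y]_\ell\times\mathbb{K}[x,y]_{d-2\ell},\ Q_\ell(f,g,h)\neq 0\}\subset\mathbb{P}(I(\mathcal{C})_2).$$ Each $W_\ell(\mathcal{C})$ is an irreducible projective variety. An irreducible decomposition (a finite union of irreducible closed subsets) is minimal if no member is contained in another member. *)

(* Defs.v *)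
From HB Require Import structures.
From mathcomp Require Import all_boot all_order all_algebra.
From mathcomp Require Import boolp classical_sets functions cardinality.
From mathcomp Require Import mpoly ring.

Set Implicit Arguments.
Unset Strict Implicit.
Unset Printing Implicit Defensive.

Import GRing.Theory.

Local Open Scope ring_scope.
Local Open Scope classical_set_scope.

(* The subspace of V with underlying set P. It is the intended object only
   when P is closed under linear combinations (lemma vspace_of_setP), and is
   0 otherwise. *)
Definition vspace_of_set (K : fieldType) (V : vectType K) (P : set V) :
    {vspace V} :=
  xget 0%VS [set U : {vspace V} | forall v, v \in U <-> P v].

Lemma vspace_of_setP (K : fieldType) (V : vectType K) (P : set V) :
    P 0 -> (forall (a : K) u v, P u -> P v -> P (a *: u + v)) ->
  forall v, v \in vspace_of_set P <-> P v.
Proof.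
move=> P0 PL; rewrite /vspace_of_set; case: xgetP => [U _ UP|noU]; first exact: UP.
exfalso; pose good n := `[< exists2 U : {vspace V}, \dim U = n &
  forall v, v \in U -> P v >].
have exg : exists n, good n.
  exists 0%N; apply/asboolP; exists 0%VS; first exact: dimv0.
  by move=> v; rewrite memv0 => /eqP ->.
have bdg n : good n -> (n <= \dim {:V})%N.
  by move=> /asboolP [U <- _]; apply/dimvS/subvf.
case: (ex_maxnP exg bdg) => n /asboolP [U dU UP] nmax.
apply: (noU U) => v; split=> [|Pv]; first exact: UP.
apply: contrapT => /negP vU.
have /nmax : good (\dim (U + <[v]>)%VS).
  apply/asboolP; exists (U + <[v]>)%VS => // _ /memv_addP [u uU [_ /vlineP [a ->] ->]].
  by rewrite addrC; apply: PL => //; apply: UP.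
rewrite leqNgt -dU => /negP; apply; rewrite ltnNge; apply: contra vU => le.
have /eqP -> : (U == U + <[v]>)%VS by rewrite eqEdim addvSl.
exact: (subvP (addvSr _ _)) (memv_line v).
Qed.

Section ProjectiveSpace.
Variables (K : fieldType) (V : vectType K).

(* P(V): the lines through 0 in V. *)
Definition proj := {L : {vspace V} | \dim L == 1%N}.

(* p = [v]; the dimension condition on p forces v != 0. *)
Definition represents (v : V) (p : proj) := val p = <[v]>%VS.

(* The affine cone over X, without its vertex. *)
Definition cone (X : set proj) : set V :=
  [set v | exists2 p, X p & represents v p].

(* Homogeneous polynomials on P(V) are polynomials in the coordinates on a
   fixed basis of V; the notions below do not depend on its choice. *)
Definition coords (v : V) : 'rV[K]_(\dim {:V}) :=
  \row_i coord (vbasis {:V}) i v.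

Definition proj_zeros (F : set {mpoly K[\dim {:V}]}) : set proj :=
  [set p | forall f v, F f -> represents v p -> f.@[coords v 0] = 0].

Definition proj_closed (X : set proj) :=
  exists2 F : set {mpoly K[\dim {:V}]},
    (forall f, F f -> exists n, f \is n.-homog) & X = proj_zeros F.

Definition irreducible_closed (X : set proj) :=
  [/\ proj_closed X, X !=set0 &
      forall A B, proj_closed A -> proj_closed B ->
        X `<=` A `|` B -> X `<=` A \/ X `<=` B].

Definition non_degenerate (X : set proj) :=
  forall H : {vspace V}, (\dim H).+1 = \dim {:V} ->
    ~ (forall p, X p -> (val p <= H)%VS).

End ProjectiveSpace.

(* The ideal generated by the homogeneous f vanishing on Z, where Z is a set of
   representatives of points of a projective set: f belongs to it if and only
   if all its homogeneous components vanish on Z. *)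
Definition homogeneous_ideal (K : fieldType) (n : nat) (Z : set 'rV[K]_n) :
    set {mpoly K[n]} :=
  [set f | forall k z, Z z -> (pihomog mdeg k f).@[z 0] = 0].

Definition ideal_generated_by (K : fieldType) (n : nat)
    (A : set {mpoly K[n]}) : set {mpoly K[n]} :=
  [set f | exists2 s : seq ({mpoly K[n]} * {mpoly K[n]}),
     (forall t, t \in s -> A t.2) & f = \sum_(t <- s) t.1 * t.2].

Definition minimal_irreducible_decomposition (K : fieldType) (V : vectType K)
    (X : set (proj V)) (J : set nat) (W : nat -> set (proj V)) :=
  [/\ finite_set J,
      forall j, J j -> irreducible_closed (W j),
      X = \bigcup_(j in J) W j &
      forall i j, J i -> J j -> i <> j -> ~ W i `<=` W j].

Section Smoothness.
Variables (K : fieldType) (V : vectType K).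
Implicit Type X : set (proj V).

Definition has_chain X (r : nat) :=
  exists c : nat -> set (proj V),
    (forall i, (i <= r)%N -> irreducible_closed (c i) /\ c i `<=` X) /\
    (forall i, (i < r)%N -> c i `<` c i.+1).

(* Krull dimension of the topological space X. *)
Definition has_dim X (r : nat) :=
  has_chain X r /\ forall s, has_chain X s -> (s <= r)%N.

(* The tangent space at v of the affine cone over X; the projective tangent
   space of X at [v] is its projectivisation. *)
Definition tangent_cone_space X (v : V) : set V :=
  [set w | forall f, homogeneous_ideal (@coords K V @` cone X) f ->
     \sum_(i < \dim {:V}) (f^`M(i)).@[coords v 0] * coords w 0 i = 0].

Lemma tangent_cone_space0 X v : tangent_cone_space X v 0.
Proof. by move=> f _; rewrite big1 // => i _; rewrite mxE linear0 mulr0. Qed.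

Lemma tangent_cone_spaceL X v (a : K) w1 w2 :
  tangent_cone_space X v w1 -> tangent_cone_space X v w2 ->
  tangent_cone_space X v (a *: w1 + w2).
Proof.
move=> h1 h2 f If; transitivity (a * 0 + 0 : K); last by rewrite mulr0 addr0.
rewrite -[X in a * X](h1 f If) -[X in _ = _ + X](h2 f If) mulr_sumr -big_split.
apply: eq_bigr => i _ /=.
by rewrite !mxE linearP mulrDr mulrCA.
Qed.

Definition smooth_variety X :=
  irreducible_closed X /\
  exists2 r, has_dim X r &
    forall v, cone X v -> \dim (vspace_of_set (tangent_cone_space X v)) = r.+1.

End Smoothness.

Definition proj_equivalent (K : fieldType) (V W : vectType K)
    (X : set (proj V)) (Y : set (proj W)) :=
  exists2 g : 'Hom(V, W), bijective g &
    Y = [set q | exists2 p, X p & val q = (g @: val p)%VS].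

(* Homogeneous coordinates of the target are indexed by pairs i <= j. *)
Definition veronese2_idx (n : nat) := {ij : 'I_n.+1 * 'I_n.+1 | (ij.1 <= ij.2)%N}.

Definition veronese2_space (K : fieldType) (n : nat) : vectType K :=
  {ffun veronese2_idx n -> K^o}.

Definition veronese2_vec (K : fieldType) (n : nat) (x : 'rV[K]_n.+1) :
    veronese2_space K n :=
  [ffun ij => x 0 (val ij).1 * x 0 (val ij).2].

Definition veronese2 (K : fieldType) (n : nat) : set (proj (veronese2_space K n)) :=
  [set q | exists2 x : 'rV[K]_n.+1, x != 0 & represents (veronese2_vec x) q].

Section RationalNormalCurve.
Variables (K : fieldType) (d : nat).

Definition rnc_vec (a b : K) : 'rV[K]_d.+1 := \row_i (a ^+ (d - i) * b ^+ i).

Definition rnc : set (proj 'rV[K]_d.+1) :=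
  [set p | exists a b : K, (a, b) != (0, 0) /\ represents (rnc_vec a b) p].

Definition rnc_ideal : set {mpoly K[d.+1]} := homogeneous_ideal (cone rnc).

Lemma rnc_ideal0 : rnc_ideal 0.
Proof. by move=> k z _; rewrite linear0 meval0. Qed.

Lemma rnc_idealL (a : K) f g :
  rnc_ideal f -> rnc_ideal g -> rnc_ideal (a *: f + g).
Proof.
by move=> hf hg k z Cz; rewrite linearP mevalD mevalZ hf // hg // mulr0 addr0.
Qed.

Definition rnc_quadrics_space : {vspace dhomog d.+1 K 2} :=
  vspace_of_set [set q : dhomog d.+1 K 2 | rnc_ideal q].

Lemma rnc_quadrics_spaceP (q : dhomog d.+1 K 2) :
  q \in rnc_quadrics_space <-> rnc_ideal q.
Proof.
apply: (vspace_of_setP (P := [set q : dhomog d.+1 K 2 | rnc_ideal q])).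
  exact: rnc_ideal0.
by move=> a u v; exact: rnc_idealL.
Qed.

(* I(C)_2 as a vector space. *)
Definition rnc_quadrics : vectType K := subvs_of rnc_quadrics_space.

Definition quadric_poly (q : rnc_quadrics) : {mpoly K[d.+1]} :=
  mpoly_of_dhomog (vsval q).

(* The rank of a quadratic form is that of its symmetric matrix; it is used
   in characteristic different from 2 only. *)
Definition gram_mx (q : {mpoly K[d.+1]}) : 'M[K]_d.+1 :=
  \matrix_(i, j) if i == j then q@_(U_(i) *+ 2) else q@_(U_(i) + U_(j)) / 2.

Definition Phi3 : set (proj rnc_quadrics) :=
  [set p | exists Q : rnc_quadrics,
     [/\ Q != 0, \rank (gram_mx (quadric_poly Q)) = 3 & represents Q p]].

(* x ^ (d - i) * y ^ i, with 'X_0 for x and 'X_1 for y. *)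
Definition binary_monom (i : nat) : 'X_{1..2} :=
  (U_(ord0) *+ (d - i) + U_(ord_max) *+ i)%MM.

(* Only used on K[x,y]_d, where it is a linear isomorphism onto S_1. *)
Definition phi (p : {mpoly K[2]}) : {mpoly K[d.+1]} :=
  \sum_(i < d.+1) p@_(binary_monom i) *: 'X_i.

Definition Qpoly (f g h : {mpoly K[2]}) : {mpoly K[d.+1]} :=
  phi (f ^+ 2 * h) * phi (g ^+ 2 * h) - phi (f * g * h) ^+ 2.

Lemma phi_homog p : phi p \is 1.-homog.
Proof.
by apply: rpred_sum => i _; apply: rpredZ; rewrite dhomogX; apply/eqP/mdeg1.
Qed.

Lemma phi_linear : linear phi.
Proof.
move=> c p q; rewrite /phi scaler_sumr -big_split; apply: eq_bigr => i _ /=.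
by rewrite mcoeffD mcoeffZ scalerDl scalerA.
Qed.

HB.instance Definition _ :=
  GRing.isLinear.Build K {mpoly K[2]} {mpoly K[d.+1]} *:%R phi phi_linear.

Lemma mdeg_binary_monom i : (i <= d)%N -> mdeg (binary_monom i) = d.
Proof. by move=> le; rewrite mdegD !mdegMn !mdeg1 !mul1n subnK. Qed.

Lemma binary_monom_max i : binary_monom i ord_max = i.
Proof. by rewrite mnmDE !mulmnE !mnm1E /= mul0n mul1n. Qed.

Lemma binary_monomP (m : 'X_{1..2}) :
  mdeg m = d -> m = binary_monom (m ord_max).
Proof.
rewrite mdegE !big_ord_recl big_ord0 addn0 => dm; apply/mnmP => i.
have lm : lift ord0 ord0 = ord_max :> 'I_2 by apply: val_inj.
rewrite lm in dm; rewrite mnmDE !mulmnE !mnm1E -dm addnK.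
case: (unliftP ord0 i) => [j|] ->; last by rewrite /= mul1n mul0n addn0.
by rewrite (ord1 j) lm /= mul0n mul1n.
Qed.

Lemma phiX m : phi 'X_[m] =
  if mdeg m == d then 'X_(inord (m ord_max)) else 0.
Proof.
case: ifP => [/eqP dm|nd].
  have le : (m ord_max < d.+1)%N.
    by rewrite ltnS -dm mdegE !big_ord_recr /= leq_addl.
  rewrite /phi (bigD1 (inord (m ord_max))) //= inordK // mcoeffX.
  rewrite -binary_monomP // eqxx scale1r big1 ?addr0 // => i ni.
  rewrite mcoeffX (_ : _ == _ = false) ?scale0r //.
  apply: contraNF ni => /eqP e; apply/eqP/val_inj.
  by rewrite /= inordK // e binary_monom_max.
rewrite /phi big1 // => i _; rewrite mcoeffX (_ : _ == _ = false) ?scale0r //.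
apply: contraFF nd => /eqP ->; rewrite mdeg_binary_monom //.
by rewrite -ltnS.
Qed.

Definition pt2 (a b : K) (i : 'I_2) : K := if i == ord0 then a else b.

Lemma meval_phi k p (a b : K) : p \is k.-homog ->
  (phi p).@[rnc_vec a b 0] = if k == d then p.@[pt2 a b] else 0.
Proof.
move=> hp; have hm m : m \in msupp p -> mdeg m = k by exact: (dhomog_mf hp).
rewrite [in LHS](mpolyE p) (linear_sum phi) (raddf_sum (meval _)) /=.
case: ifP => kd; last first.
  rewrite big_seq big1 // => m /hm km.
  by rewrite linearZ /= phiX km kd scaler0 meval0.
rewrite [in RHS](mpolyE p) raddf_sum big_seq [RHS]big_seq.
apply: eq_bigr => m /hm km; rewrite linearZ /= !mevalZ phiX km kd; congr (_ * _).
have dm : mdeg m = d by rewrite km (eqP kd).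
have le : (m ord_max < d.+1)%N.
  by rewrite ltnS -dm mdegE !big_ord_recr /= leq_addl.
rewrite mevalXU mxE inordK // mevalX !big_ord_recl big_ord0 mulr1.
have lm : lift ord0 ord0 = ord_max :> 'I_2 by apply: val_inj.
rewrite lm -dm mdegE !big_ord_recl big_ord0 lm addn0 addnK.
by [].
Qed.

Lemma Qpoly_homog f g h : Qpoly f g h \is 2.-homog.
Proof.
by apply: rpredB; rewrite ?expr2; apply: (dhomogM (d := 1) (e := 1));
  apply: phi_homog.
Qed.

Lemma Qpoly_ideal l (f g : dhomog 2 K l) (h : dhomog 2 K (d - 2 * l)) :
  rnc_ideal (Qpoly f g h).
Proof.
move=> k z [p [a [b [_ pab]]] pz].
have [->|k2] := eqVneq k 2; last first.
  by rewrite (pihomog_ne0 _ (Qpoly_homog f g h)) ?meval0 // eq_sym.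
rewrite pihomog_dE ?Qpoly_homog //.
have /vlineP [c ->] : z \in <[rnc_vec a b]>%VS by rewrite -pab pz memv_line.
have scale q : (phi q).@[(c *: rnc_vec a b) 0] = c * (phi q).@[rnc_vec a b 0].
  rewrite /phi !raddf_sum mulr_sumr; apply: eq_bigr => i _ /=.
  by rewrite !mevalZ !mevalXU mxE mulrCA.
have homp (u v : dhomog 2 K l) : ((u : {mpoly K[2]}) * v * h) \is (l + l + (d - 2 * l)).-homog.
  by apply: dhomogM; [apply: dhomogM|]; apply: dhomog_is_dhomog.
rewrite mevalB expr2 !mevalM !scale !expr2 !(meval_phi _ _ (homp _ _)).
case: ifP => _; last by rewrite !mulr0 subrr.
by rewrite !mevalM; ring.
Qed.

Definition Qform l (f g : dhomog 2 K l) (h : dhomog 2 K (d - 2 * l)) :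
    dhomog d.+1 K 2 := DHomog (Qpoly_homog f g h).

Lemma Qform_mem l (f g : dhomog 2 K l) (h : dhomog 2 K (d - 2 * l)) :
  Qform f g h \in rnc_quadrics_space.
Proof. exact/rnc_quadrics_spaceP/Qpoly_ideal. Qed.

(* Only used for 2 * l <= d: otherwise d - 2 * l is truncated and Qmap is 0. *)
Definition Qmap l (f g : dhomog 2 K l) (h : dhomog 2 K (d - 2 * l)) :
    rnc_quadrics := Subvs (Qform_mem f g h).

Definition Wvar (l : nat) : set (proj rnc_quadrics) :=
  [set p | exists (f g : dhomog 2 K l) (h : dhomog 2 K (d - 2 * l)),
     Qmap f g h != 0 /\ represents (Qmap f g h) p].

Definition quadrics_in (X : set (proj rnc_quadrics)) : set {mpoly K[d.+1]} :=
  [set q | exists2 Q : rnc_quadrics, cone X Q & q = quadric_poly Q].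

End RationalNormalCurve.

(* Main.v *)
Require Import Defs.
From HB Require Import structures.
From mathcomp Require Import all_boot all_order all_algebra fingroup perm.
From mathcomp Require Import boolp classical_sets functions cardinality.
From mathcomp Require Import mpoly ring zify.

(** A linear form on projective d-space is written as a polynomial of degree at
    most d in one variable: its restriction to the curve, read on the chart
    x = 1. A quadric becomes a symmetric matrix, hence a symmetric form B(p, x)
    of bidegree (d, d) in two points of the line; for Q_l(f, g, h) it is half of
      h(p) h(x) (f(p) g(x) - g(p) f(x))^2      [biform_rank3],
    and the study of the strata W_l reduces to factoring such expressions.

    The strata cover Phi_3. A symmetric matrix of rank at most r is a sum of r
    squares [sym_sum_squares]. In rank 2 this makes the quadric a product of two
    linear forms, which cannot contain the curve [quadric_rank_ge3]; in rank 3 it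
    gives ab - c^2 with ab = c^2 as polynomials, so that a, b, c are f^2 h,
    g^2 h, fgh with f and g coprime [conic_param, rank3_parametrized].

    Strata are closed. If f and g are coprime and of degree l' as a pencil, then
    Q_l'(f, g, h) lies in W_l if and only if l' <= l and h = u^2 k with
    deg u = l - l'. This is expressed by two closed conditions on B: any two
    B(p, .) have a common factor of degree d - 2 l, which bounds the rank of a
    Sylvester matrix and forces l' <= l [common_factor_degree]; and every B(p, .)
    is divisible by the square of a form of degree l, a symmetric condition on
    its roots and so a polynomial condition on its coefficients
    [square_divisor_closed], which yields u [square_factor_divisor]. Together
    they cut out W_l inside Phi_3 [cone_Wvar_conditions]. A member with l' = l
    and h square-free then lies on no other stratum. Irreducibility holds because
    any two points of W_l are joined by a rational curve inside it
    [irreducible_of_curves].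

    Strata span. Polarising Q_l in f, g and h gives enough relations to replace,
    modulo the span of W_l, each z_i z_j by the most balanced product of the same
    weight i + j [span_center]. So all products of equal weight are congruent,
    and as a form vanishing on the curve has coefficients of sum zero in every
    weight, W_l spans the quadrics through the curve [quadrics_span]. The same
    argument in degree k, after reducing monomials to z_0^a z_r z_d^b
    [std_monomial], shows that the quadrics generate the ideal.

    The first stratum. Up to a scalar absorbed in h, a point of W_1 is
    Q_1(x, y, h), and B is half of (x - p)^2 h(p) h(x). Division by (x - p)^2
    identifies the quadrics through the curve with the symmetric forms of
    bidegree (d - 2, d - 2), and W_1 with the squares h(p) h(x): this is the
    second Veronese embedding [biform_veronese_quadric, cone_W1]. Its tangent
    spaces are computed from curves on one side and from 2 x 2 minors on the
    other [tangent_spaceP], and its dimension from coordinate subspaces below and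
    from the growth of Hilbert functions above [chain_length]. *)

Set Implicit Arguments.
Unset Strict Implicit.
Unset Printing Implicit Defensive.

Import GRing.Theory.

Local Open Scope ring_scope.

(** * Closed fields of characteristic 0 *)

Section ClosedField.
Variables (K : closedFieldType) (charK : [pchar K] =i pred0).

Lemma natr_eq0 n : (n%:R == 0 :> K) = (n == 0%N).
Proof. exact: (pcharf0P K).1. Qed.

Lemma two_neq0 : 2 != 0 :> K.
Proof. by rewrite natr_eq0. Qed.

Lemma natr_inj : injective (fun n : nat => n%:R : K).
Proof.
move=> m n; wlog le : m n / (m <= n)%N => [H e|/eqP].
  by case: (leqP m n) => [|/ltnW] le; [|apply/esym]; apply: H.
rewrite eq_sym -subr_eq0 -natrB // natr_eq0 subn_eq0 => le'.
by apply/eqP; rewrite eqn_leq le.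
Qed.

(** The integers are infinitely many in characteristic 0, so they cannot all be
    roots. *)
Lemma poly_neq0_ex (p : {poly K}) : p != 0 -> exists x, p.[x] != 0.
Proof.
move=> p0; apply: contrapT => no.
have : (size [seq i%:R : K | i <- iota 0 (size p)] < size p)%N.
  apply: max_poly_roots => //.
    apply/allP => _ /mapP [i _ ->]; apply/negPn/negP => ni.
    by apply: no; exists i%:R.
  by rewrite map_inj_uniq ?iota_uniq //; exact: natr_inj.
by rewrite size_map size_iota ltnn.
Qed.

Lemma poly_eq_horner (p q : {poly K}) : (forall x, p.[x] = q.[x]) -> p = q.
Proof.
move=> e; apply/eqP; rewrite -subr_eq0; apply: contrapT => /negP /poly_neq0_ex [x].
by rewrite hornerD hornerN e subrr eqxx.
Qed.

Lemma sqrt_ex (x : K) : exists y, y ^+ 2 = x.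
Proof.
have /closed_rootP [y] : size ('X^2 - x%:P : {poly K}) != 1%N by rewrite size_XnsubC.
by rewrite /root !hornerE subr_eq0 => /eqP; exists y.
Qed.

(** Completing squares: subtracting the square of the normalised linear form v G,
    for v not isotropic, adds v to the kernel of G and so lowers the rank. *)
Lemma sym_sum_squares r n (G : 'M[K]_n) : G^T = G -> (\rank G <= r)%N ->
  exists a : 'M[K]_(r, n), G = a^T *m a.
Proof.
elim: r G => [|r IH] G sG rG.
  exists 0; rewrite mulmx0; apply/eqP.
  by rewrite -mxrank_eq0 -leqn0.
have [->|G0] := eqVneq G 0; first by exists 0; rewrite mulmx0.
(* A nonzero symmetric form has a non-isotropic vector, by polarisation. *)
have [v vG] : exists v : 'rV_n, (v *m G *m v^T) 0 0 != 0.
  apply: contrapT => no; case/eqP: G0; apply/matrixP => i j; rewrite mxE.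
  pose B (u w : 'rV_n) := (u *m G *m w^T) 0 0.
  have B0 u : B u u = 0.
    by apply/eqP/negPn/negP => nu; apply: no; exists u.
  have BC u w : B u w = B w u.
    rewrite /B -[in RHS](trmxK (w *m G *m u^T)) [RHS]mxE !trmx_mul trmxK sG.
    by rewrite mulmxA.
  have BE : B (delta_mx 0 i) (delta_mx 0 j) = G i j.
    by rewrite /B -rowE trmx_delta -colE !mxE.
  have BD u u' w : B (u + u') w = B u w + B u' w by rewrite /B !mulmxDl mxE.
  have : B (delta_mx 0 i + delta_mx 0 j) (delta_mx 0 i + delta_mx 0 j) = 2 * G i j.
    by rewrite -BE BD !(BC _ (_ + _)) !BD !B0 (BC (delta_mx 0 j)); ring.
  by rewrite B0 => /esym/eqP; rewrite mulf_eq0 (negPf two_neq0) => /eqP.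
set c := _ 0 0 in vG; have [s sc] := sqrt_ex c.
have s0 : s != 0 by apply: contraNneq vG => s0; rewrite -sc s0 expr0n.
pose w := s^-1 *: (v *m G).
have wE : w = s^-1 *: (v *m G) by [].
have wT : w^T = s^-1 *: (G *m v^T) by rewrite /w linearZ /= trmx_mul sG.
have vw : v *m w^T = s%:M.
  rewrite wT -scalemxAr mulmxA [_ *m _]mx11_scalar -/c -sc.
  by rewrite scale_scalar_mx expr2 mulKf.
clearbody w; have [] := IH (G - w^T *m w).
- by rewrite linearB /= trmx_mul trmxK sG.
- rewrite -ltnS; apply: leq_trans rG.
  have lt : (kermx G < kermx (G - w^T *m w))%MS.
    rewrite ltmxE; apply/andP; split.
      apply/sub_kermxP; rewrite mulmxBr mulmx_ker.
      rewrite mulmxA wT -scalemxAr (mulmxA (kermx G) G) mulmx_ker.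
      by rewrite !mul0mx scaler0 mul0mx subr0.
    apply/negP => le.
    have : (v <= kermx G)%MS.
      apply: submx_trans le; apply/sub_kermxP; rewrite mulmxBr mulmxA vw mul_scalar_mx.
      by rewrite wE scalerA mulfV // scale1r subrr.
    by move/sub_kermxP => e; rewrite /c e mul0mx mxE eqxx in vG.
  have := rank_ltmx lt; rewrite !mxrank_ker.
  by have := rank_leq_row G; have := rank_leq_row (G - w^T *m w); lia.
- move=> a' e; exists (col_mx w a').
  by rewrite (tr_col_mx w a') (mul_row_col w^T _ w) -e addrC subrK.
Qed.

End ClosedField.

(** * Plane conics, square divisors and reversal *)

Section Univariate.
Variables (K : closedFieldType) (charK : [pchar K] =i pred0).
Implicit Types (D a b c f g h p q s u : {poly K}).

Lemma sqr_poly_eq p q : p ^+ 2 = q ^+ 2 -> p = q \/ p = - q.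
Proof.
by move/eqP; rewrite eqf_sqr => /orP [] /eqP; [left | right].
Qed.

(** With e = gcd(a, c), write a = e s and c = e t; then s b = e t^2 and coprimality
    gives that s and e divide each other, so a is a scalar times e^2. *)
Lemma coprime_mul_sqr a b c : a != 0 -> coprimep a b -> a * b = c ^+ 2 ->
  exists f, a = f ^+ 2.
Proof.
move=> a0 cab ab; pose e := gcdp a c.
have e0 : e != 0 by rewrite gcdp_eq0 (negPf a0).
have ea := divpK (dvdp_gcdl a c); have ec := divpK (dvdp_gcdr a c).
rewrite -/e in ea ec; set s := a %/ e in ea; set t := c %/ e in ec.
have st : coprimep s t by apply: coprimep_div_gcd; rewrite a0.
have sb : s * b = e * t ^+ 2.
  apply: (mulfI e0); rewrite mulrA (mulrC e s) ea ab -ec; ring.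
have se : s %| e.
  rewrite -(@Gauss_dvdpl _ e (t ^+ 2)) ?coprimep_pexpr //.
  by rewrite -sb dvdp_mulr.
have es : e %| s.
  rewrite -(@Gauss_dvdpl _ s b); first by rewrite sb dvdp_mulr.
  exact: coprimep_dvdr (dvdp_gcdl a c) cab.
have /eqpP [[k1 k2] /= /andP [k10 k20] k12] : s %= e by rewrite /eqp se.
have [y y2] := sqrt_ex (k2 / k1).
have sE : s = (k2 / k1) *: e by rewrite mulrC -scalerA -k12 scalerA mulVf ?scale1r.
by exists (y *: e); rewrite -ea [in LHS]sE -scalerAl exprZn y2 expr2.
Qed.

(** Divide by h = gcd(a, b): the quotients are coprime with square product, hence
    squares themselves. *)
Lemma conic_param a b c : a != 0 -> a * b = c ^+ 2 ->
  exists f g h, [/\ a = f ^+ 2 * h, b = g ^+ 2 * h, c = f * g * h,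
    coprimep f g & h != 0].
Proof.
move=> a0 ab; pose h := gcdp a b.
have h0 : h != 0 by rewrite gcdp_eq0 (negPf a0).
have ea := divpK (dvdp_gcdl a b); have eb := divpK (dvdp_gcdr a b).
rewrite -/h in ea eb; set a' := a %/ h in ea; set b' := b %/ h in eb.
have cab : coprimep a' b' by apply: coprimep_div_gcd; rewrite a0.
have /divpK : h %| c.
  rewrite -(@dvdp_pexp2r _ _ _ 2) // -ab -ea -eb.
  by apply/dvdpP; exists (a' * b'); ring.
set c' := c %/ h => ec.
have ab' : a' * b' = c' ^+ 2.
  apply: (mulfI (mulf_neq0 h0 h0)); transitivity (a * b).
    by rewrite -ea -eb; ring.
  by rewrite ab -ec; ring.
have a'0 : a' != 0 by apply: contraNneq a0 => e; rewrite -ea e mul0r.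
have [f fa] := coprime_mul_sqr a'0 cab ab'.
have [g gb] : exists g, b' = g ^+ 2.
  have [b0|b0] := eqVneq b' 0; first by exists 0; rewrite b0 expr0n.
  by apply: (coprime_mul_sqr b0 (b := a') (c := c')); rewrite 1?coprimep_sym // mulrC.
have cfg : coprimep f g.
  by move: cab; rewrite fa gb coprimep_pexpl // coprimep_pexpr.
have : (f * g) ^+ 2 = c' ^+ 2 by rewrite -ab' fa gb exprMn.
case/sqr_poly_eq => e.
  by exists f, g, h; split=> //; rewrite -?fa -?gb ?e // ?ea ?eb ?ec.
exists f, (- g), h; rewrite sqrrN mulrN e opprK.
split=> //; last by rewrite -scaleN1r coprimepZr // oppr_eq0 oner_eq0.
all: by rewrite -?fa -?gb ?ea ?eb -?ec // -e; ring.
Qed.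

Lemma divisor_of_size n p : (n < size p)%N ->
  exists2 q : {poly K}, size q = n.+1 & q %| p.
Proof.
move=> np; have p0 : p != 0 by rewrite -size_poly_gt0 (leq_ltn_trans _ np).
have [r pr] := closed_field_poly_normal p.
exists (\prod_(z <- take n r) ('X - z%:P)).
  rewrite size_prod_XsubC size_takel //.
  move: np; rewrite pr size_scale ?lead_coef_eq0 // size_prod_XsubC; lia.
rewrite pr dvdpZr ?lead_coef_eq0 // -[in X in _ %| X](cat_take_drop n r).
by rewrite big_cat dvdp_mulr.
Qed.

(** The part s / gcd(s, D) of s is coprime to D / gcd(s, D), so its square must
    divide h. *)
Lemma sqr_dvd_mul_sqr s h D m l : size s = l.+1 -> (size D <= m.+1)%N ->
  D != 0 -> (m <= l)%N -> s ^+ 2 %| h * D ^+ 2 ->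
  exists2 u : {poly K}, size u = (l - m).+1 & u ^+ 2 %| h.
Proof.
move=> ss sD D0 ml sh; pose e := gcdp s D.
have s0 : s != 0 by rewrite -size_poly_gt0 ss.
have e0 : e != 0 by rewrite gcdp_eq0 (negPf s0).
have es := divpK (dvdp_gcdl s D); have eD := divpK (dvdp_gcdr s D).
rewrite -/e in es eD; set s2 := s %/ e in es; set D' := D %/ e in eD.
have cop : coprimep s2 D' by apply: coprimep_div_gcd; rewrite s0.
have s2h : s2 ^+ 2 %| h.
  rewrite -(@Gauss_dvdpl _ h (D' ^+ 2)); last first.
    by rewrite coprimep_pexpr // coprimep_pexpl.
  rewrite -(@dvdp_mul2r _ (e ^+ 2)) ?expf_neq0 //.
  by rewrite -exprMn es -mulrA -exprMn eD.
have se : (size e <= m.+1)%N.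
  by apply: leq_trans sD; apply: dvdp_leq (dvdp_gcdr s D).
have s20 : s2 != 0 by apply: contraNneq s0 => z; rewrite -es z mul0r.
have szs2 : (l - m < size s2)%N.
  move: ss; rewrite -es size_mul //.
  move: se; rewrite -(size_poly_gt0 s2) in s20.
  by move: (size e) (size s2) s20 ml; lia.
have [u su us] := divisor_of_size szs2.
by exists u => //; apply: dvdp_trans s2h; rewrite dvdp_pexp2r.
Qed.

(** The exchange of x and y on binary forms of degree n, dehomogenised; n is the
    degree of the form, which the polynomial alone does not determine. *)
Definition rev_poly n p : {poly K} := \poly_(i < n.+1) p`_(n - i).

Lemma size_rev_poly n p : (size (rev_poly n p) <= n.+1)%N.
Proof. exact: size_poly. Qed.

Lemma coef_rev_poly n p i : (rev_poly n p)`_i = if (i <= n)%N then p`_(n - i) else 0.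
Proof. by rewrite coef_poly ltnS. Qed.

Lemma rev_polyK n p : (size p <= n.+1)%N -> rev_poly n (rev_poly n p) = p.
Proof.
move=> sp; apply/polyP => i; rewrite !coef_rev_poly.
case: leqP => ni; last by rewrite nth_default // (leq_trans sp).
by rewrite leq_subr subKn.
Qed.

Lemma size_rev_poly_eq n p : p.[0] != 0 -> size (rev_poly n p) = n.+1.
Proof.
move=> p0; apply/eqP; rewrite eqn_leq size_rev_poly /= ltnNge.
apply/negP => le; move: p0; rewrite horner_coef0.
have <- : (rev_poly n p)`_n = p`_0 by rewrite coef_rev_poly leqnn subnn.
by rewrite nth_default ?eqxx.
Qed.

Lemma horner_rev_poly n p x : (size p <= n.+1)%N -> x != 0 ->
  (rev_poly n p).[x] = x ^+ n * p.[x^-1].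
Proof.
move=> sp x0; rewrite horner_poly (horner_coef_wide _ sp) mulr_sumr.
rewrite (reindex_inj rev_ord_inj) /=; apply: eq_bigr => i _.
rewrite subSS subKn -1?ltnS // mulrCA exprVn -expfB_cond; first by [].
by rewrite (negPf x0) -ltnS add0n.
Qed.

(** Both sides agree at every nonzero x, where reversal is x^n p(1/x). *)
Lemma rev_polyM n m p q : (size p <= n.+1)%N -> (size q <= m.+1)%N ->
  rev_poly (n + m) (p * q) = rev_poly n p * rev_poly m q.
Proof.
move=> sp sq; apply: (mulfI (negbT (polyX_eq0 K))).
apply: (poly_eq_horner charK) => x; rewrite !hornerM hornerX.
have [->|x0] := eqVneq x 0; first by rewrite !mul0r.
congr (_ * _); rewrite !horner_rev_poly //; last first.
  by apply: leq_trans (size_polyMleq _ _) _; lia.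
by rewrite hornerM exprD; ring.
Qed.

End Univariate.

(** * Polynomials divisible by the square of a polynomial of given degree *)

Section SquareDivisors.
Variables (K : closedFieldType) (charK : [pchar K] =i pred0).

Lemma nth_flatten_pairs (z : K) (rs rk : seq K) j : (j < size rs)%N ->
  nth z (flatten [seq [:: x; x] | x <- rs] ++ rk) j.*2 = nth z rs j /\
  nth z (flatten [seq [:: x; x] | x <- rs] ++ rk) j.*2.+1 = nth z rs j.
Proof.
elim: rs j => [//|x rs IH] [|j] //= /IH [e1 e2].
by [].
Qed.

Lemma prod_XsubC_pairs (rs : seq K) :
  \prod_(x <- flatten [seq [:: x; x] | x <- rs]) ('X - x%:P) =
  (\prod_(x <- rs) ('X - x%:P)) ^+ 2.
Proof.
elim: rs => [|x rs IH]; first by rewrite !big_nil expr1n.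
by rewrite /= !big_cons IH; ring.
Qed.

Lemma sqr_dvd_of_pairs l (w : seq K) : (2 * l <= size w)%N ->
  (forall j, (j < l)%N -> nth 0 w j.*2 = nth 0 w j.*2.+1) ->
  exists2 s : {poly K}, size s = l.+1 & s ^+ 2 %| \prod_(x <- w) ('X - x%:P).
Proof.
elim: l w => [|l IH] w; first by exists 1; rewrite ?size_poly1 ?expr1n ?dvd1p.
case: w => [|x [|y w]] //=; rewrite ?mulnS // => sw h.
have [||s ss sP] := IH w; first by lia.
  by move=> j jl; exact: (h j.+1).
have <- : x = y by exact: (h 0%N).
exists (('X - x%:P) * s).
  by rewrite size_monicM ?monicXsubC -?size_poly_gt0 ?ss // size_XsubC.
by rewrite !big_cons mulrA exprMn -expr2 dvdp_mul2l ?expf_neq0 ?polyXsubC_eq0.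
Qed.

Variables (d l : nat).
Hypothesis l_d : (2 * l <= d)%N.

Lemma pair_fst_proof (j : 'I_l) : (j.*2 < d)%N.
Proof. by have := ltn_ord j; move: l_d; move: (nat_of_ord j) => i; lia. Qed.

Lemma pair_snd_proof (j : 'I_l) : (j.*2.+1 < d)%N.
Proof. by have := ltn_ord j; move: l_d; move: (nat_of_ord j) => i; lia. Qed.

Definition pair_fst j : 'I_d := Ordinal (pair_fst_proof j).
Definition pair_snd j : 'I_d := Ordinal (pair_snd_proof j).

(** Evaluated at roots r_i, a factor vanishes for all t if and only if the
    permutation s pairs off 2 l of the roots into l equal couples; the powers of t
    bundle these l equations into one, and the product over all s makes the
    condition symmetric in the roots. *)
Definition pairing_norm (t : K) : {mpoly K[d]} :=
  \prod_(s : 'S_d) \sum_(j < l) t ^+ j *: ('X_(s (pair_fst j)) - 'X_(s (pair_snd j))).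

Lemma msymXU (s : 'S_d) i : msym s ('X_i : {mpoly K[d]}) = 'X_(s i).
Proof.
rewrite msymX; congr 'X_[_]; apply/mnmP => j.
rewrite mnmE !mnm1E; congr (nat_of_bool _).
by apply/eqP/eqP => [->|<-]; rewrite ?permKV ?permK.
Qed.

Lemma pairing_norm_sym t : pairing_norm t \is symmetric.
Proof.
apply/issymP => s; rewrite /pairing_norm rmorph_prod /=.
rewrite [RHS](reindex_inj (mulIg s)); apply: eq_bigr => p _.
rewrite raddf_sum; apply: eq_bigr => j _ /=.
by rewrite msymZ msymB !msymXU !permM.
Qed.

(** For fixed r the product is a polynomial in t, and polynomials form a domain. *)
Lemma pairing_norm_eq0 (r : d.-tuple K) :
  (forall t, (pairing_norm t).@[tnth r] = 0) <->
  exists s : 'S_d, forall j : 'I_l,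
    tnth r (s (pair_fst j)) = tnth r (s (pair_snd j)).
Proof.
have ev t : (pairing_norm t).@[tnth r] = \prod_(s : 'S_d) \sum_(j < l)
    t ^+ j * (tnth r (s (pair_fst j)) - tnth r (s (pair_snd j))).
  rewrite /pairing_norm rmorph_prod; apply: eq_bigr => s _ /=.
  rewrite raddf_sum; apply: eq_bigr => j _ /=.
  by rewrite mevalZ mevalB !mevalXU.
split=> [z | [s sP] t]; last first.
  rewrite ev (bigD1 s) //= big1 ?mul0r // => j _.
  by rewrite sP subrr mulr0.
pose P (s : 'S_d) : {poly K} := \poly_(j < l)
  (oapp (fun j => tnth r (s (pair_fst j)) - tnth r (s (pair_snd j))) 0 (insub j)).
have PE s t : (P s).[t] = \sum_(j < l)
    t ^+ j * (tnth r (s (pair_fst j)) - tnth r (s (pair_snd j))).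
  by rewrite horner_poly; apply: eq_bigr => j _; rewrite valK mulrC.
have : \prod_s P s == 0.
  apply/eqP; apply: (poly_eq_horner charK) => t; rewrite horner0 horner_prod -(z t) ev.
  by apply: eq_bigr => s _; rewrite PE.
case/prodf_eq0 => s _ /eqP Ps; exists s => j.
have := congr1 (fun p : {poly K} => p`_j) Ps.
rewrite coef0 coef_poly ltn_ord valK /= => /eqP.
by rewrite subr_eq0 => /eqP.
Qed.

Lemma sqr_dvd_pairing (r : d.-tuple K) :
  (exists2 s : {poly K}, size s = l.+1 & s ^+ 2 %| \prod_(x <- r) ('X - x%:P)) <->
  exists s : 'S_d, forall j : 'I_l,
    tnth r (s (pair_fst j)) = tnth r (s (pair_snd j)).
Proof.
split=> [[s ss /dvdpP [k kE]] | [s sP]].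
  have [rs rsE] := closed_field_poly_normal s.
  have [rk rkE] := closed_field_poly_normal k.
  have s0 : s != 0 by rewrite -size_poly_gt0 ss.
  have k0 : k != 0.
    by apply: contra_eq_neq kE => ->; rewrite mul0r -size_poly_gt0 size_prod_XsubC.
  have srs : size rs = l.
    by apply/eq_add_S; rewrite -ss rsE size_scale ?lead_coef_eq0 // size_prod_XsubC.
  have lk : lead_coef k * lead_coef s ^+ 2 = 1.
    by rewrite -lead_coef_exp -lead_coefM -kE lead_coef_prod_XsubC.
  pose w := flatten [seq [:: x; x] | x <- rs] ++ rk.
  have /prod_XsubC_eq rw : \prod_(x <- r) ('X - x%:P) = \prod_(x <- w) ('X - x%:P).
    rewrite big_cat /= prod_XsubC_pairs kE {1}rsE {1}rkE exprZn -scalerAl -scalerAr.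
    by rewrite scalerA lk scale1r mulrC.
  have sw : size w == d by rewrite -(perm_size rw) size_tuple.
  rewrite perm_sym in rw; have /tuple_permP [p pE] : perm_eq (Tuple sw) r by [].
  exists p => j; have jl : (j < size rs)%N by rewrite srs.
  have [z _] : exists z : K, true by exists 0.
  have [e1 e2] := nth_flatten_pairs z rk jl; rewrite -/w in e1 e2.
  have tn i : tnth r (p i) = nth z w i.
    have -> : w = [tuple tnth r (p i) | i < d] by rewrite -pE.
    by rewrite -tnth_nth tnth_mktuple.
  by rewrite !tn /= e1 e2.
pose w := [tuple tnth r (s i) | i < d].
have rw : perm_eq w r by apply/tuple_permP; exists s.
rewrite -(perm_big _ rw).
apply: sqr_dvd_of_pairs => [|j jl]; first by rewrite (size_tuple w).
have [z _] : exists z : K, true by exists 0.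
have tn i : nth 0 w (val i) = tnth r (s i) by rewrite -tnth_nth tnth_mktuple.
by rewrite (tn (pair_fst (Ordinal jl))) (tn (pair_snd (Ordinal jl))) sP.
Qed.

(** Among polynomials of degree exactly d, divisibility by the square of a
    polynomial of degree l is closed: [pairing_norm] is a polynomial in the
    elementary symmetric functions of the roots, that is, in the quotients of the
    coefficients by the leading one. Multiplying by a large power of the leading
    coefficient clears denominators and makes the condition hold trivially where
    the degree drops. *)
Lemma square_divisor_closed : exists P : K -> {mpoly K[d.+1]},
  forall F : {poly K}, (size F <= d.+1)%N ->
  (forall t, (P t).@[fun i => F`_i] = 0) <->
  F`_d = 0 \/ exists2 s : {poly K}, size s = l.+1 & s ^+ 2 %| F.
Proof.
pose T t := sval (sym_fundamental (pairing_norm_sym t)).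
have TE t : T t \mPo [tuple mesym d K i.+1 | i < d] = pairing_norm t.
  by rewrite /T; case: sym_fundamental => ? [].
pose e (i : 'I_d) : {mpoly K[d.+1]} := (-1) ^+ i.+1 *: 'X_(inord (d - i.+1)).
pose top : {mpoly K[d.+1]} := 'X_ord_max.
exists (fun t => top * \sum_(m <- msupp (T t)) (T t)@_m *:
  (top ^+ (msize (T t) - mdeg m) * \prod_i e i ^+ m i)) => F sF.
set v := fun i : 'I_d.+1 => F`_i.
have vtop : top.@[v] = F`_d by rewrite mevalXU.
have [F0|F0] := eqVneq F`_d 0.
  by split=> _; [left | move=> t; rewrite mevalM vtop F0 mul0r].
have szF : size F = d.+1.
  apply/eqP; rewrite eqn_leq sF ltnNge; apply/negP => le.
  by move: F0; rewrite nth_default ?eqxx.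
have lF : lead_coef F = F`_d by rewrite lead_coefE szF.
have [r rE] := closed_field_poly_normal F; rewrite lF in rE.
have sr : size r == d.
  have := congr1 (fun p : {poly K} => size p) rE.
  by rewrite szF size_scale // size_prod_XsubC => /eq_add_S ->.
pose rt := Tuple sr.
have ev i : (e i).@[v] = F`_d * (mesym d K i.+1).@[tnth rt].
  rewrite mevalZ mevalXU /v inordK; last by lia.
  have := mroots_coeff rt (lift ord0 i).
  rewrite lift0 {1}rE coefZ /= => ->.
  by rewrite mulrCA [X in _ * X]mulrA -exprMn mulrNN mulr1 expr1n mul1r.
have evP t : (top * \sum_(m <- msupp (T t)) (T t)@_m *:
  (top ^+ (msize (T t) - mdeg m) * \prod_i e i ^+ m i)).@[v] =
  F`_d ^+ (msize (T t)).+1 * (pairing_norm t).@[tnth rt].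
  rewrite mevalM vtop exprS -mulrA; congr (_ * _).
  rewrite -TE comp_mpoly_meval [in RHS]mevalE raddf_sum mulr_sumr big_seq [RHS]big_seq /=.
  apply: eq_bigr => m /msize_mdeg_lt/ltnW ms.
  rewrite mevalZ mevalM rmorphXn /= vtop [RHS]mulrCA; congr (_ * _).
  rewrite rmorph_prod -{2}(subnK ms) exprD -mulrA; congr (_ * _).
  rewrite mdegE -prodrXr -big_split; apply: eq_bigr => i _ /=.
  by rewrite rmorphXn /= ev exprMn tnth_mktuple.
have -> : (exists2 s : {poly K}, size s = l.+1 & s ^+ 2 %| F) <->
   (exists2 s : {poly K}, size s = l.+1 & s ^+ 2 %| \prod_(x <- rt) ('X - x%:P)).
  by rewrite rE; split=> [[s ss]|[s ss]] sF'; exists s => //; move: sF';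
    rewrite dvdpZr.
rewrite sqr_dvd_pairing -pairing_norm_eq0; split=> [z|[/eqP|z]].
- right=> t; have /eqP := z t; rewrite evP mulf_eq0 expf_eq0 /= (negPf F0).
  by move/eqP.
- by rewrite (negPf F0).
- by move=> t; rewrite evP z mulr0.
Qed.

End SquareDivisors.

(** * Closed and irreducible subsets of projective space *)

Local Open Scope classical_set_scope.

Section PolynomialFunctions.
Variables (K : closedFieldType) (charK : [pchar K] =i pred0).

Lemma meval_homog_scale n k (f : {mpoly K[n]}) (c : K) (v w : 'I_n -> K) :
  f \is k.-homog -> (forall i, w i = c * v i) -> f.@[w] = c ^+ k * f.@[v].
Proof.
move=> hf wE; rewrite !mevalE mulr_sumr big_seq [RHS]big_seq.
apply: eq_bigr => m /(dhomog_mf hf) dm; rewrite mulrCA; congr (_ * _).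
rewrite -(dm : mdeg m = k) mdegE -prodrXr -big_split; apply: eq_bigr => i _ /=.
by rewrite wE exprMn.
Qed.

Lemma meval_pihomog_sum n (f : {mpoly K[n]}) v :
  f.@[v] = \sum_(k < msize f) (pihomog mdeg k f).@[v].
Proof. by rewrite -raddf_sum -pihomog_partitionE. Qed.

Lemma pihomog_geq n (f : {mpoly K[n]}) k : (msize f <= k)%N -> pihomog mdeg k f = 0.
Proof.
move=> le; rewrite pihomogE big_seq_cond big1 // => m /andP [/msize_mdeg_lt].
by move=> lt /eqP km; move: lt; rewrite km ltnNge le.
Qed.

(** On the line through v, f restricts to a polynomial in the scalar c whose
    coefficients are the values at v of the homogeneous components of f. *)
Lemma pihomog_vanish n (f : {mpoly K[n]}) (v : 'I_n -> K) :
  (forall c, c != 0 -> f.@[fun i => c * v i] = 0) ->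
  forall k, (pihomog mdeg k f).@[v] = 0.
Proof.
move=> h; pose P : {poly K} := \poly_(k < msize f) (pihomog mdeg k f).@[v].
have P0 : P = 0.
  apply: (mulfI (negbT (polyX_eq0 K))); rewrite mulr0.
  apply: (poly_eq_horner charK) => c; rewrite hornerM hornerX horner0.
  have [->|c0] := eqVneq c 0; first by rewrite mul0r.
  apply/eqP; rewrite mulf_eq0 (negPf c0) /=; apply/eqP.
  rewrite horner_poly -[RHS](h c c0) meval_pihomog_sum; apply: eq_bigr => k _.
  by rewrite mulrC; apply/esym; apply: meval_homog_scale => //; exact: pihomogP.
move=> k; have [lt|le] := ltnP k (msize f); last by rewrite pihomog_geq // meval0.
by have := congr1 (fun p : {poly K} => p`_k) P0; rewrite coef_poly lt coef0.
Qed.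

Definition polyfun1 (F : K -> K) := exists P : {poly K}, forall t, F t = P.[t].

Lemma polyfun1_affine a b : polyfun1 (fun t => a + t * b).
Proof. by exists (a%:P + b *: 'X) => t; rewrite !hornerE mulrC. Qed.

Lemma polyfun1_const a : polyfun1 (fun=> a).
Proof. by exists a%:P => t; rewrite hornerC. Qed.

Lemma polyfun1D F G : polyfun1 F -> polyfun1 G -> polyfun1 (fun t => F t + G t).
Proof. by move=> [P PE] [Q QE]; exists (P + Q) => t; rewrite hornerD PE QE. Qed.

Lemma polyfun1M F G : polyfun1 F -> polyfun1 G -> polyfun1 (fun t => F t * G t).
Proof. by move=> [P PE] [Q QE]; exists (P * Q) => t; rewrite hornerM PE QE. Qed.

Lemma polyfun1_sum (I : Type) (r : seq I) (P : pred I) (F : I -> K -> K) :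
  (forall i, polyfun1 (F i)) -> polyfun1 (fun t => \sum_(i <- r | P i) F i t).
Proof.
move=> /choice [Q QE]; exists (\sum_(i <- r | P i) Q i) => t.
by rewrite horner_sum; apply: eq_bigr => i _.
Qed.

Section Vector.
Variable V : vectType K.
Implicit Types (X : set (proj V)) (v w : V).

(** Polynomial functions on V; the coordinates are those in which projective closed
    sets are defined. *)
Definition polyfun (F : V -> K) :=
  exists f : {mpoly K[\dim {:V}]}, forall v, F v = f.@[coords v 0].

Lemma polyfun_const a : polyfun (fun=> a).
Proof. by exists a%:MP => v; rewrite mevalC. Qed.

Lemma polyfun_linear (F : {linear V -> K^o}) : polyfun F.
Proof.
exists (\sum_(i < \dim {:V}) F (vbasis {:V})`_i *: 'X_i) => v.
rewrite raddf_sum {1}(coord_vbasis (memvf v)) linear_sum; apply: eq_bigr => i _ /=.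
by rewrite mevalZ mevalXU mxE linearZ /= mulrC.
Qed.

Lemma polyfunM F G : polyfun F -> polyfun G -> polyfun (fun v => F v * G v).
Proof. by move=> [f fE] [g gE]; exists (f * g) => v; rewrite mevalM fE gE. Qed.

Lemma polyfun_sum (I : Type) (r : seq I) (P : pred I) (F : I -> V -> K) :
  (forall i, polyfun (F i)) -> polyfun (fun v => \sum_(i <- r | P i) F i v).
Proof.
move=> /choice [f fE]; exists (\sum_(i <- r | P i) f i) => v.
by rewrite raddf_sum; apply: eq_bigr => i _.
Qed.

Lemma polyfun_prod (I : Type) (r : seq I) (P : pred I) (F : I -> V -> K) :
  (forall i, polyfun (F i)) -> polyfun (fun v => \prod_(i <- r | P i) F i v).
Proof.
move=> /choice [f fE]; exists (\prod_(i <- r | P i) f i) => v.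
by rewrite rmorph_prod; apply: eq_bigr => i _ /=.
Qed.

Lemma polyfun_det n (A : V -> 'M[K]_n) :
  (forall i j, polyfun (fun v => A v i j)) -> polyfun (fun v => \det (A v)).
Proof.
move=> hA; apply: polyfun_sum => s; apply: polyfunM; first exact: polyfun_const.
by apply: polyfun_prod => i.
Qed.

Lemma polyfun_mulmx m n p (A : V -> 'M[K]_(m, n)) (B : V -> 'M[K]_(n, p)) :
  (forall i j, polyfun (fun v => A v i j)) ->
  (forall i j, polyfun (fun v => B v i j)) ->
  forall i j, polyfun (fun v => (A v *m B v) i j).
Proof.
move=> hA hB i j; have [f fE] : polyfun (fun v => \sum_k A v i k * B v k j).
  by apply: polyfun_sum => k; apply: polyfunM.
by exists f => v; rewrite mxE.
Qed.

Lemma polyfun_meval n (P : {mpoly K[n]}) (F : 'I_n -> V -> K) :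
  (forall i, polyfun (F i)) -> polyfun (fun v => P.@[fun i => F i v]).
Proof.
move=> /choice [f fE]; exists (P \mPo [tuple f i | i < n]) => v.
by rewrite comp_mpoly_meval; apply: meval_eq => i; rewrite tnth_mktuple.
Qed.

Lemma coordsZ c v i : coords (c *: v) 0 i = c * coords v 0 i.
Proof. by rewrite !mxE linearZ. Qed.

Lemma represents_neq0 v p : represents v p -> v != 0.
Proof.
move=> vp; apply: contraTneq (valP p) => v0.
by rewrite (vp : val p = _) v0 (_ : <[0]>%VS = 0%VS) ?dimv0 //; apply: span_seq1.
Qed.

Lemma represents_ex v : v != 0 -> exists p, represents v p.
Proof.
move=> v0; have dv : \dim <[v]> == 1%N by rewrite dim_vline v0.
by exists (exist (fun L : {vspace V} => is_true (\dim L == 1%N)) <[v]>%VS dv).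
Qed.

Lemma represents_inj v p q : represents v p -> represents v q -> p = q.
Proof. by move=> vp vq; apply: val_inj; rewrite (vp : val p = _) (vq : val q = _). Qed.

Lemma proj_rep p : exists v, represents v p.
Proof.
exists (vpick (val p)); apply/eqP; rewrite eq_sym eqEdim.
have p0 : vpick (val p) != 0.
  by rewrite vpick0; apply: contraTneq (valP p) => ->; rewrite dimv0.
by rewrite dim_vline p0 (eqP (valP p)) andbT -memvE memv_pick.
Qed.

Lemma representsZ c v p : c != 0 -> represents v p -> represents (c *: v) p.
Proof.
move=> c0 vp; rewrite /represents (vp : val p = _); apply/eqP; rewrite eqEdim.
have v0 := represents_neq0 vp.
rewrite !dim_vline scaler_eq0 negb_or c0 v0 leqnn andbT -memvE.
by apply/vlineP; exists c^-1; rewrite scalerA mulVf // scale1r.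
Qed.

Lemma represents_line v w p : represents v p -> represents w p ->
  exists2 c, c != 0 & w = c *: v.
Proof.
move=> vp wp; have : w \in <[v]>%VS by rewrite -(vp : val p = _) (wp : val p = _) memv_line.
move=> /vlineP [c wE]; exists c => //.
by apply: contraNneq (represents_neq0 wp) => c0; rewrite wE c0 scale0r.
Qed.

Lemma cone_neq0 X v : cone X v -> v != 0.
Proof. by move=> [p _ /represents_neq0]. Qed.

Lemma coneP X v p : represents v p -> cone X v <-> X p.
Proof.
by move=> vp; split=> [[q Xq vq]|Xp]; [rewrite (represents_inj vp vq) | exists p].
Qed.

Lemma coneZ X c v : c != 0 -> cone X v -> cone X (c *: v).
Proof. by move=> c0 [p Xp vp]; exists p => //; apply: representsZ. Qed.

Lemma cone_sub X Y : (forall v, cone X v -> cone Y v) <-> X `<=` Y.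
Proof.
split=> [h p Xp | h v [p /h Yp vp]]; last by exists p.
by have [v vp] := proj_rep p; apply/(coneP _ vp)/h; exists p.
Qed.

Lemma cone_eq X Y : (forall v, cone X v <-> cone Y v) -> X = Y.
Proof.
move=> h; rewrite eqEsubset; split; apply/cone_sub => v; first by move/h.
by move/h.
Qed.

(** The equations need not be homogeneous: all scalar multiples of a vector are
    representatives of the same point, so the homogeneous components vanish too. *)
Lemma proj_closed_of_cone X (S : set (V -> K)) :
  (forall F, S F -> polyfun F) ->
  (forall v, v != 0 -> (cone X v <-> forall F, S F -> F v = 0)) ->
  proj_closed X.
Proof.
move=> Spoly XS.
exists [set f | exists g k, f = pihomog mdeg k g /\ S (fun v => g.@[coords v 0])].
  by move=> _ [g [k [-> _]]]; exists k; exact: pihomogP.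
apply/seteqP; split=> p.
  move=> Xp _ v [g [k [-> Sg]]] vp; apply: pihomog_vanish => c c0.
  have cXv : cone X (c *: v) by exists p => //; apply: representsZ.
  have /XS := cone_neq0 cXv; case=> /(_ cXv) /(_ _ Sg) <- _.
  by apply: meval_eq => i; rewrite coordsZ.
move=> h; have [v vp] := proj_rep p.
apply/(coneP _ vp)/XS; first exact: represents_neq0 vp.
move=> F SF; have [f fE] := Spoly _ SF; rewrite fE meval_pihomog_sum.
rewrite big1 // => k _; apply: h vp; exists f, k; split=> //.
by rewrite (_ : (fun v => _) = F) //; apply/funext => w; rewrite fE.
Qed.

Lemma proj_closed_sep X p : proj_closed X -> ~ X p ->
  exists f k, [/\ f \is k.-homog, forall v, cone X v -> f.@[coords v 0] = 0 &
     forall v, represents v p -> f.@[coords v 0] != 0].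
Proof.
move=> [F Fh ->] /existsNP [f /existsNP [v /not_implyP [Ff /not_implyP [vp /eqP fv]]]].
have [k hf] := Fh f Ff; exists f, k; split=> // [w [q qF wq]|w wp].
  exact: qF Ff wq.
have [c c0 ->] := represents_line vp wp.
rewrite (meval_homog_scale hf (coordsZ c v)) mulf_neq0 ?expf_neq0 //.
Qed.

(** Testing a curve against all functionals makes the notion independent of a
    basis and of an ambient space, see [polycurve_inj]. *)
Definition polycurve (W : vectType K) (g : K -> W) :=
  forall L : {linear W -> K^o}, polyfun1 (fun t => L (g t)).

Lemma polycurve_inj (W : vectType K) (f : 'Hom(V, W)) (g : K -> V) :
  lker f == 0%VS -> polycurve (fun t => f (g t)) -> polycurve g.
Proof.
move=> kf h L; have [P PE] := h (L \o (f^-1)%VF : {linear W -> K^o}).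
by exists P => t; rewrite -PE /= lker0_lfunK.
Qed.

(** If X is covered by closed A and B but contained in neither, join a point off A
    to a point off B by a rational curve: all but finitely many of its parameters
    give a point of X off both. *)
Lemma irreducible_of_curves X : proj_closed X -> X !=set0 ->
  (forall v w, cone X v -> cone X w -> exists g : K -> V,
     [/\ polycurve g, g 0 = v, g 1 = w & forall t, g t != 0 -> cone X (g t)]) ->
  irreducible_closed X.
Proof.
move=> cX X0 joinX; split=> // A B cA cB XAB.
apply: contrapT => /not_orP [nA nB].
have /existsNP [p /not_implyP [Xp nAp]] := nA.
have /existsNP [q /not_implyP [Xq nBq]] := nB.
have [f [k [_ fA fp]]] := proj_closed_sep cA nAp.
have [f' [k' [_ fB fq]]] := proj_closed_sep cB nBq.
have [v vp] := proj_rep p; have [w wq] := proj_rep q.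
have [g [gpol g0 g1 gX]] : exists g : K -> V,
     [/\ polycurve g, g 0 = v, g 1 = w & forall t, g t != 0 -> cone X (g t)].
  by apply: joinX; [exists p | exists q].
have /choice [c cE] : forall i : 'I_(\dim {:V}), exists c : {poly K},
    forall t, coords (g t) 0 i = c.[t].
  move=> i.
  have [P PE] := gpol (coord (vbasis {:V}) i).
  by exists P => t; rewrite mxE PE.
have comp (a : {mpoly K[\dim {:V}]}) :
    exists P : {poly K}, forall t, a.@[coords (g t) 0] = P.[t].
  exists (mmap polyC c a) => t; rewrite /mmap mevalE horner_sum; apply: eq_bigr => m _.
  rewrite hornerCM /mmap1 horner_prod; congr (_ * _); apply: eq_bigr => i _.
  by rewrite horner_exp -cE.
have [P PE] := comp f; have [Q QE] := comp f'.
have [i vi] : exists i, coords v 0 i != 0.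
  apply: contrapT => no; have := represents_neq0 vp.
  rewrite (coord_vbasis (memvf v)) big1 ?eqxx // => i _.
  suff -> : coord (vbasis {:V}) i v = 0 by rewrite scale0r.
  by apply/eqP/negPn/negP => ni; apply: no; exists i; rewrite mxE.
(* The coordinate c i keeps the curve away from the origin. *)
have [t] : exists t, (P * Q * c i).[t] != 0.
  apply: (poly_neq0_ex charK); rewrite !mulf_neq0 //.
  - by apply: contraNneq (fp _ vp) => z; rewrite -g0 PE z horner0.
  - by apply: contraNneq (fq _ wq) => z; rewrite -g1 QE z horner0.
  - by apply: contraNneq vi => z; rewrite -g0 cE z horner0.
rewrite !hornerM !mulf_eq0 !negb_or -PE -QE -cE => /andP [/andP [nP nQ] ni].
have gt0 : g t != 0 by apply: contraNneq ni => ->; rewrite mxE linear0.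
have [r Xr gr] := gX t gt0.
by case: (XAB r Xr) => Hr; [case/eqP: nP; apply: fA | case/eqP: nQ; apply: fB];
  exists r.
Qed.

End Vector.
End PolynomialFunctions.

(** * Binary forms and symmetric matrices *)

Section Forms.
Variables (K : closedFieldType) (charK : [pchar K] =i pred0).

(** On forms of a fixed degree l, setting x = 1 loses nothing. *)
Definition dehom (f : {mpoly K[2]}) : {poly K} :=
  mmap polyC (fun i => if i == ord0 then 1 else 'X) f.

Definition homogenize l (a : {poly K}) : {mpoly K[2]} :=
  \sum_(i < l.+1) a`_i *: 'X_[binary_monom l i].

Lemma dehomX m : dehom 'X_[m] = 'X^(m ord_max).
Proof.
rewrite /dehom mmapX /mmap1 !big_ord_recl big_ord0 expr1n mul1r mulr1.
by rewrite (_ : lift ord0 ord0 = ord_max) //; apply: val_inj.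
Qed.

Lemma dehomZ c f : dehom (c *: f) = c *: dehom f.
Proof. by rewrite /dehom mmapZ mul_polyC. Qed.

Lemma dehomM f g : dehom (f * g) = dehom f * dehom g.
Proof. exact: rmorphM. Qed.

Lemma dehom_sum (I : Type) (r : seq I) (P : pred I) (F : I -> {mpoly K[2]}) :
  dehom (\sum_(i <- r | P i) F i) = \sum_(i <- r | P i) dehom (F i).
Proof. exact: raddf_sum. Qed.

Lemma coef_dehom l (f : {mpoly K[2]}) i : f \is l.-homog ->
  (dehom f)`_i = if (i <= l)%N then f@_(binary_monom l i) else 0.
Proof.
move=> hf; rewrite {1}(mpolyE f) dehom_sum coef_sum big_seq.
rewrite (eq_bigr (fun m => f@_m * (i == m ord_max)%:R)); last first.
  by move=> m _; rewrite dehomZ dehomX coefZ coefXn.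
case: ifP => il; last first.
  rewrite big1 // => m /(dhomog_mf hf) /= dm; case: eqP => [im|_]; last by rewrite mulr0.
  by move: il; rewrite -dm im mdegE big_ord_recr /= leq_addl.
have [ms|ms] := boolP (binary_monom l i \in msupp f); last first.
  rewrite (memN_msupp_eq0 ms) big1 // => m mf; case: eqP => [im|_]; last by rewrite mulr0.
  have dm := dhomog_mf hf mf.
  by move: ms; rewrite im -(binary_monomP dm) mf.
rewrite -big_seq (bigD1_seq _ ms) ?msupp_uniq //= binary_monom_max eqxx mulr1.
rewrite big_seq_cond big1 ?addr0 // => m /andP [mf nm].
case: eqP => [im|_]; last by rewrite mulr0.
have dm := dhomog_mf hf mf.
by move: nm; rewrite im -(binary_monomP dm) eqxx.
Qed.

Lemma size_dehom l (f : {mpoly K[2]}) : f \is l.-homog -> (size (dehom f) <= l.+1)%N.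
Proof.
by move=> hf; apply/leq_sizeP => j lj; rewrite (coef_dehom _ hf) leqNgt lj.
Qed.

Lemma homogenize_homog l (a : {poly K}) : homogenize l a \is l.-homog.
Proof.
apply: rpred_sum => i _; apply: rpredZ; rewrite dhomogX.
by apply/eqP/mdeg_binary_monom; rewrite -ltnS.
Qed.

Lemma dehom_homogenize l (a : {poly K}) : (size a <= l.+1)%N -> dehom (homogenize l a) = a.
Proof.
move=> sa; rewrite dehom_sum; apply/polyP => j; rewrite coef_sum.
have [jl|lj] := ltnP j l.+1; last first.
  rewrite (leq_sizeP _ _ sa) // big1 // => i _; rewrite dehomZ dehomX binary_monom_max.
  by rewrite coefZ coefXn gtn_eqF ?mulr0 // (leq_trans (ltn_ord i)).
rewrite (bigD1 (Ordinal jl)) //= big1 => [|i ij].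
  by rewrite dehomZ dehomX binary_monom_max coefZ coefXn eqxx mulr1 addr0.
rewrite dehomZ dehomX binary_monom_max coefZ coefXn.
by case: eqP => [e|_]; rewrite ?mulr0 //; case/eqP: ij; apply: val_inj.
Qed.

End Forms.

Section Quadrics.
Variables (K : closedFieldType) (charK : [pchar K] =i pred0) (d : nat).
Local Notation n := d.+1.
Implicit Types (u w : 'rV[K]_n) (F G H a b c : {poly K}).

Definition linform u : {mpoly K[n]} := \sum_i u 0 i *: 'X_i.

Lemma linform_is_linear : linear linform.
Proof.
move=> c u w; rewrite /linform scaler_sumr -big_split; apply: eq_bigr => i _.
by rewrite !mxE scalerDl scalerA.
Qed.

HB.instance Definition _ :=
  GRing.isLinear.Build K 'rV[K]_n {mpoly K[n]} *:%R linform linform_is_linear.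

Lemma linform_homog u : linform u \is 1.-homog.
Proof. by apply: rpred_sum => i _; apply: rpredZ; rewrite dhomogX /= mdeg1. Qed.

Lemma eq_mnm2 (i j a b : 'I_n) : ((U_(a) + U_(b))%MM == (U_(i) + U_(j))%MM) =
  (a == i) && (b == j) || (a == j) && (b == i).
Proof.
apply/idP/orP => [/eqP e|[] /andP [/eqP -> /eqP ->] //]; last by rewrite addmC.
have [ai|ai] := eqVneq a i; [left | right].
  by move/eqP: e; rewrite ai eqm_add2l eq_mnm1.
have aj : a = j.
  move/mnmP/(_ a): e; rewrite !mnmDE !mnm1E eqxx (eq_sym i) (negPf ai).
  by case: (eqVneq j a) => // _; case: (b == a).
by move/eqP: e; rewrite aj eqxx (addmC U_(i)%MM) eqm_add2l eq_mnm1.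
Qed.

(** On the diagonal the two cross terms coincide and only one is present. *)
Lemma coef_linform_mul u w i j : (linform u * linform w)@_(U_(i) + U_(j)) =
  if i == j then u 0 i * w 0 i else u 0 i * w 0 j + u 0 j * w 0 i.
Proof.
have -> : linform u * linform w =
    \sum_p (u 0 p.1 * w 0 p.2) *: 'X_[U_(p.1) + U_(p.2)].
  rewrite /linform big_distrlr pair_bigA; apply: eq_bigr => p _ /=.
  by rewrite mpolyXD -scalerAl -scalerAr scalerA.
rewrite raddf_sum /= (eq_bigr (fun p : 'I_n * 'I_n => u 0 p.1 * w 0 p.2 *
  ((p == (i, j)) || (p == (j, i)))%:R)); last first.
  by move=> [a b] _; rewrite /= mcoeffZ mcoeffX eq_mnm2 !xpair_eqE.
have [<-|ij] := eqVneq i j.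
  rewrite (bigD1 (i, i)) //= eqxx mulr1 big1 ?addr0 // => p /negPf ->.
  by rewrite mulr0.
have ji : (j, i) != (i, j) by rewrite xpair_eqE negb_and eq_sym ij.
rewrite (bigD1 (i, j)) //= (bigD1 (j, i)) //= !eqxx orbT !mulr1.
rewrite big1 ?addr0 // => p /andP [/negPf -> /negPf ->].
by rewrite mulr0.
Qed.

Lemma gram_is_linear : linear (@gram_mx K d).
Proof.
move=> c p q; apply/matrixP => i j; rewrite !mxE.
by case: ifP => _; rewrite mcoeffD mcoeffZ // mulrDl mulrA.
Qed.

HB.instance Definition _ :=
  GRing.isLinear.Build K {mpoly K[n]} 'M[K]_n *:%R (@gram_mx K d) gram_is_linear.

Lemma gram_sym (q : {mpoly K[n]}) : (gram_mx q)^T = gram_mx q.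
Proof.
apply/matrixP => i j; rewrite !mxE eq_sym; case: eqP => [->|_] //.
by rewrite addmC.
Qed.

Lemma gram_linform_mul u w :
  gram_mx (linform u * linform w) = 2^-1 *: (u^T *m w + w^T *m u).
Proof.
have t0 := two_neq0 charK.
apply/matrixP => i j; rewrite !mxE !big_ord1 !mxE; case: eqP => [<-|/eqP ij].
  rewrite mulmS mulm1n coef_linform_mul eqxx (mulrC (w 0 i)).
  by field.
by rewrite coef_linform_mul (negPf ij) mulrC (mulrC (w 0 i)).
Qed.

Lemma mdeg2P (m : 'X_{1..n}) : mdeg m = 2 -> exists i j, m = (U_(i) + U_(j))%MM.
Proof.
move=> dm; have [i mi] : exists i, m i != 0%N.
  apply: contrapT => no; move: dm; rewrite mdegE big1 // => i _.
  by apply/eqP/negPn/negP => mi; apply: no; exists i.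
have im : (U_(i) <= m)%MM by rewrite lep1mP.
have /eqP/mdeg1P [j /eqP mj] : mdeg (m - U_(i)) = 1%N.
  by move: dm; rewrite -{1}(submK im) mdegD mdeg1 addn1 => -[].
by exists j, i; rewrite -mj submK.
Qed.

(** Both sides are linear in q, and quadratic monomials are products of two linear
    forms, for which the symmetric matrix is known. *)
Lemma gramK (q : {mpoly K[n]}) : q \is 2.-homog ->
  q = \sum_i \sum_j gram_mx q i j *: ('X_i * 'X_j).
Proof.
move=> hq; pose E (M : 'M[K]_n) : {mpoly K[n]} := \sum_i \sum_j M i j *: ('X_i * 'X_j).
rewrite -/(E _).
have ED (a : K) (M N : 'M[K]_n) : E (a *: M + N) = a *: E M + E N.
  rewrite /E scaler_sumr -big_split; apply: eq_bigr => i _.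
  rewrite scaler_sumr -big_split; apply: eq_bigr => j _ /=.
  by rewrite !mxE scalerDl scalerA.
have E0 : E 0 = 0 by rewrite -(scale0r 0) -[0 *: 0]addr0 ED scale0r add0r /E
  big1 // => i _; rewrite big1 // => j _; rewrite mxE scale0r.
suff base i j : E (gram_mx ('X_i * 'X_j)) = 'X_i * 'X_j.
  rewrite [in RHS](mpolyE q) {1}(mpolyE q) linear_sum /=.
  have hm m : m \in msupp q -> mdeg m = 2 by exact: (dhomog_mf hq).
  elim: (msupp q) hm => [|m s IH] hm; first by rewrite !big_nil E0.
  rewrite !big_cons linearZ /= ED -IH => [|m' m's]; last first.
    by apply: hm; rewrite inE m's orbT.
  congr (_ *: _ + _); have [|i [j ->]] := mdeg2P (m := m).
    by apply: hm; rewrite mem_head.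
  by rewrite mpolyXD base.
have XE k : 'X_k = linform (delta_mx 0 k).
  rewrite /linform (bigD1 k) //= mxE !eqxx scale1r big1 ?addr0 // => k' kk.
  by rewrite mxE (negPf kk) andbF scale0r.
have E2 u w : E (u^T *m w) = linform u * linform w.
  rewrite /E /linform big_distrl; apply: eq_bigr => k _ /=.
  rewrite big_distrr; apply: eq_bigr => k' _ /=.
  by rewrite mxE big_ord1 mxE -scalerAl -scalerAr scalerA.
rewrite !XE gram_linform_mul -[_ *: _]addr0 ED E0 addr0 -[u in u + _]scale1r ED scale1r !E2.
rewrite (mulrC (linform (delta_mx 0 j))) -mulr2n -scaler_nat scalerA.
by rewrite mulVf ?two_neq0 // scale1r.
Qed.

Lemma gram_inj (p q : {mpoly K[n]}) : p \is 2.-homog -> q \is 2.-homog ->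
  gram_mx p = gram_mx q -> p = q.
Proof. by move=> /gramK {2}-> /gramK {2}-> ->. Qed.



End Quadrics.

(** * Quadrics of rank 3 through the rational normal curve *)

Section Quadrics.
Variables (K : closedFieldType) (charK : [pchar K] =i pred0) (d : nat).
Local Notation n := d.+1.
Local Notation V := (rnc_quadrics K d).
Local Notation linform := (@linform K d).
Implicit Types (u w : 'rV[K]_n) (F G H a b c : {poly K}) (v : V).

Definition lin a : {mpoly K[n]} := linform (poly_rV a).

Lemma linE a : lin a = \sum_(i < n) a`_i *: 'X_i.
Proof. by apply: eq_bigr => i _; rewrite mxE. Qed.

Lemma linZ (k : K) a : lin (k *: a) = k *: lin a.
Proof. by rewrite /lin !linearZ. Qed.

Lemma linD a b : lin (a + b) = lin a + lin b.
Proof. by rewrite /lin !linearD. Qed.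

(** Q_l(f, g, h) after setting x = 1; l only enters through bounds on the degrees. *)
Definition rank3_form F G H := lin (F ^+ 2 * H) * lin (G ^+ 2 * H) - lin (F * G * H) ^+ 2.

Lemma phi_dehom (f : {mpoly K[2]}) : f \is d.-homog -> phi d f = lin (dehom f).
Proof.
move=> hf; apply: eq_bigr => i _; rewrite mxE (coef_dehom _ hf).
by rewrite -ltnS ltn_ord.
Qed.

Lemma Qpoly_dehom l (f g h : {mpoly K[2]}) : (2 * l <= d)%N ->
  f \is l.-homog -> g \is l.-homog -> h \is (d - 2 * l).-homog ->
  Qpoly d f g h = rank3_form (dehom f) (dehom g) (dehom h).
Proof.
move=> ld hf hg hh; have ll : (l + l + (d - 2 * l))%N = d by lia.
have homp (a b : {mpoly K[2]}) : a \is l.-homog -> b \is l.-homog -> a * b * h \is d.-homog.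
  by move=> ha hb; rewrite -ll; apply: dhomogM => //; apply: dhomogM.
by rewrite /Qpoly !expr2 !phi_dehom ?homp // !dehomM.
Qed.

Lemma quadric_poly_is_linear : linear (@quadric_poly K d).
Proof. by []. Qed.

HB.instance Definition _ :=
  GRing.isLinear.Build K V {mpoly K[n]} *:%R (@quadric_poly K d) quadric_poly_is_linear.

Lemma quadric_poly_homog v : quadric_poly v \is 2.-homog.
Proof. exact: dhomog_is_dhomog. Qed.

Lemma quadric_poly_inj : injective (@quadric_poly K d).
Proof. by move=> v w e; apply/val_inj/val_inj. Qed.

Lemma quadric_poly_ideal v : rnc_ideal (quadric_poly v).
Proof. by apply/rnc_quadrics_spaceP; apply: subvsP. Qed.

Lemma quadric_poly_ex (q : {mpoly K[n]}) : q \is 2.-homog -> rnc_ideal q ->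
  exists v, quadric_poly v = q.
Proof.
move=> hq Iq; have qV : DHomog hq \in rnc_quadrics_space K d by apply/rnc_quadrics_spaceP.
by exists (Subvs qV).
Qed.

Lemma Qmap_dehom l (f g : dhomog 2 K l) (h : dhomog 2 K (d - 2 * l)) :
  (2 * l <= d)%N -> quadric_poly (Qmap f g h) = rank3_form (dehom f) (dehom g) (dehom h).
Proof. by move=> ld; apply: (Qpoly_dehom ld); [case: f | case: g | case: h]. Qed.

(** Over a closed field a scalar is a square, so it can be moved into h and the
    affine cone over a stratum has the same parametrisation as the stratum. *)
Lemma rank3_formZ s F G H : rank3_form F G (s *: H) = s ^+ 2 *: rank3_form F G H.
Proof.
rewrite /rank3_form -!scalerAr !linZ exprZn -scalerAl -scalerAr scalerA -expr2.
by rewrite scalerBr.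
Qed.

Definition degree_bounds l F G H :=
  [/\ (size F <= l.+1)%N, (size G <= l.+1)%N & (size H <= (d - 2 * l).+1)%N].

Lemma rank3_form_ex l F G H : (2 * l <= d)%N -> degree_bounds l F G H ->
  exists v, quadric_poly v = rank3_form F G H /\
    exists f g h, v = @Qmap K d l f g h.
Proof.
move=> ld [sF sG sH].
exists (Qmap (DHomog (homogenize_homog l F)) (DHomog (homogenize_homog l G))
  (DHomog (homogenize_homog (d - 2 * l) H))); split; last by do 3!eexists.
by rewrite Qmap_dehom //= !dehom_homogenize.
Qed.

Lemma cone_WvarP l v : (2 * l <= d)%N -> cone (@Wvar K d l) v <->
  v != 0 /\ exists F G H, degree_bounds l F G H /\ quadric_poly v = rank3_form F G H.
Proof.
move=> ld; split=> [[p [f [g [h [q0 qp]]]] vp]|[v0 [F [G [H [b3 vE]]]]]].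
  split; first exact: represents_neq0 vp.
  have [c c0 ->] := represents_line qp vp; have [s s2] := sqrt_ex c.
  exists (dehom f), (dehom g), (s *: dehom h); split.
    split; try by apply: size_dehom; apply: dhomog_is_dhomog.
    by apply: leq_trans (size_scale_leq _ _) _; apply: size_dehom; apply: dhomog_is_dhomog.
  by rewrite rank3_formZ s2 linearZ /= Qmap_dehom.
have [p vp] := represents_ex v0.
have [w [wE [f [g [h wQ]]]]] := rank3_form_ex ld b3.
have vw : v = w by apply: quadric_poly_inj; rewrite vE.
by exists p => //; exists f, g, h; rewrite -wQ -vw.
Qed.

(** The symmetric matrix M read as a form of bidegree (d, d) in two points of the
    line, with its first argument specialised to p. *)
Definition biform (M : 'M[K]_n) (p : K) : {poly K} := rVpoly (rnc_vec d 1 p *m M).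

Lemma biformD M N p : biform (M + N) p = biform M p + biform N p.
Proof. by rewrite /biform mulmxDr linearD. Qed.

Lemma biformN M p : biform (- M) p = - biform M p.
Proof. by rewrite /biform mulmxN linearN. Qed.

Lemma biformZ (k : K) M p : biform (k *: M) p = k *: biform M p.
Proof. by rewrite /biform -scalemxAr linearZ. Qed.

Lemma size_biform M p : (size (biform M p) <= n)%N.
Proof. exact: size_poly. Qed.

(** Entries of M are coefficients of polynomials in p that vanish identically. *)
Lemma biform_inj M : (forall p, biform M p = 0) -> M = 0.
Proof.
move=> M0; apply/matrixP => i j; rewrite mxE.
pose P : {poly K} := \poly_(i < n) M (inord i) j.
have : P = 0.
  apply: (poly_eq_horner charK) => p; rewrite horner0 horner_poly.
  have := congr1 (fun a : {poly K} => a`_j) (M0 p).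
  rewrite coef0 coef_rVpoly_ord mxE => e; rewrite -[RHS]e; apply: eq_bigr => k _.
  by rewrite mxE expr1n mul1r inord_val mulrC.
by move/(congr1 (fun a : {poly K} => a`_i)); rewrite coef_poly ltn_ord inord_val coef0.
Qed.

Lemma horner_linform u x y : (linform u).@[rnc_vec d x y 0] =
  \sum_i u 0 i * (x ^+ (d - i) * y ^+ i).
Proof.
rewrite raddf_sum; apply: eq_bigr => i _ /=.
by rewrite mevalZ mevalXU mxE.
Qed.

Lemma horner_rVpoly_sum u p : (rVpoly u).[p] = \sum_i u 0 i * p ^+ i.
Proof.
rewrite (horner_coef_wide _ (size_poly _ _)); apply: eq_bigr => i _.
by rewrite coef_rVpoly_ord.
Qed.

Lemma rnc_vec_mul u p : rnc_vec d 1 p *m u^T = ((rVpoly u).[p])%:M.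
Proof.
rewrite [LHS]mx11_scalar mxE horner_rVpoly_sum; congr (_%:M).
by apply: eq_bigr => i _; rewrite !mxE expr1n mul1r mulrC.
Qed.

Lemma linform_curve u p : (linform u).@[rnc_vec d 1 p 0] = (rVpoly u).[p].
Proof.
by rewrite horner_linform horner_rVpoly_sum; apply: eq_bigr => i _; rewrite expr1n mul1r.
Qed.

Lemma biform_gram_mul u w p : biform (gram_mx (linform u * linform w)) p =
  2^-1 *: ((rVpoly u).[p] *: rVpoly w + (rVpoly w).[p] *: rVpoly u).
Proof.
rewrite gram_linform_mul // biformZ biformD /biform !mulmxA !rnc_vec_mul.
by rewrite !mul_scalar_mx !linearZ.
Qed.

Lemma biform_rank3 F G H p :
  (size (F ^+ 2 * H)%R <= n)%N -> (size (G ^+ 2 * H)%R <= n)%N ->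
  (size (F * G * H)%R <= n)%N ->
  biform (gram_mx (rank3_form F G H)) p =
    (2^-1 * H.[p]) *: (H * (F.[p] *: G - G.[p] *: F) ^+ 2).
Proof.
move=> s1 s2 s3; rewrite /rank3_form raddfB biformD biformN (expr2 (lin _)) /=.
rewrite !biform_gram_mul !poly_rV_K //.
rewrite !hornerM -!mul_polyC.
by rewrite !polyCM; ring.
Qed.

Lemma size_degree_bounds l F G H : (2 * l <= d)%N -> degree_bounds l F G H ->
  [/\ (size (F ^+ 2 * H)%R <= n)%N, (size (G ^+ 2 * H)%R <= n)%N &
   (size (F * G * H)%R <= n)%N].
Proof.
move=> ld [sF sG sH].
have h (a b : {poly K}) : (size a <= l.+1)%N -> (size b <= l.+1)%N ->
    (size (a * b * H)%R <= n)%N.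
  move=> sa sb; apply: leq_trans (size_polyMleq _ _) _.
  have := size_polyMleq a b.
  move: (size a) (size b) (size H) (size (a * b)) sa sb sH; lia.
by rewrite !expr2; split; apply: h.
Qed.

Lemma biform_rank3_bounded l F G H p : (2 * l <= d)%N -> degree_bounds l F G H ->
  biform (gram_mx (rank3_form F G H)) p =
    (2^-1 * H.[p]) *: (H * (F.[p] *: G - G.[p] *: F) ^+ 2).
Proof. by move=> ld /(size_degree_bounds ld) []; exact: biform_rank3. Qed.

Lemma mxrank_col_row (u w : 'rV[K]_n) : (\rank (u^T *m w) <= 1)%N.
Proof. exact: leq_trans (mxrankM_maxr _ _) (rank_leq_row _). Qed.

Lemma rank_gram_rank3 F G H : (\rank (gram_mx (rank3_form F G H)) <= 3)%N.
Proof.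
rewrite /rank3_form raddfB /= (expr2 (lin _)) !gram_linform_mul //.
set u := poly_rV _; set w := poly_rV _; set t := poly_rV _.
have -> : 2^-1 *: (t^T *m t + t^T *m t) = t^T *m t.
  by rewrite -mulr2n -scaler_nat scalerA mulVf ?two_neq0 // scale1r.
apply: leq_trans (mxrank_add _ _) _; rewrite mxrank_opp.
apply: (@leq_add _ _ 2 1); last exact: mxrank_col_row.
apply: leq_trans (mxrank_scale _ _) _.
by apply: leq_trans (mxrank_add _ _) (@leq_add _ _ 1 1 _ _); exact: mxrank_col_row.
Qed.

Lemma rnc_vec_cone p : cone (@rnc K d) (rnc_vec d 1 p).
Proof.
have r0 : rnc_vec d 1 p != 0.
  apply/eqP => /matrixP /(_ 0 ord0); rewrite !mxE expr1n expr0 mulr1 => /eqP.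
  by rewrite oner_eq0.
have [q rq] := represents_ex r0; exists q => //; exists 1, p; split=> //.
by rewrite xpair_eqE oner_eq0.
Qed.

Lemma quadric_curve v p : (quadric_poly v).@[rnc_vec d 1 p 0] = 0.
Proof.
have := quadric_poly_ideal v; move=> /(_ 2 (rnc_vec d 1 p)).
rewrite pihomog_dE ?quadric_poly_homog //; apply.
exact: rnc_vec_cone.
Qed.

Lemma quadric_sum_squares r v : (\rank (gram_mx (quadric_poly v)) <= r)%N ->
  exists a : 'M[K]_(r, n), quadric_poly v = \sum_k linform (row k a) ^+ 2.
Proof.
move=> rk; have [a aE] := sym_sum_squares charK (gram_sym (quadric_poly v)) rk.
exists a; apply: (gram_inj charK (quadric_poly_homog v)).
  by apply: rpred_sum => k _; rewrite expr2; apply: (dhomogM (d := 1) (e := 1));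
    apply: linform_homog.
rewrite aE raddf_sum /=; apply/matrixP => i j; rewrite mxE summxE; apply: eq_bigr => k _.
rewrite expr2 gram_linform_mul // -mulr2n -scaler_nat scalerA mulVf ?two_neq0 //.
by rewrite scale1r !mxE big_ord1 !mxE.
Qed.

Lemma imaginary_ex : exists i : K, i ^+ 2 = -1.
Proof. exact: sqrt_ex. Qed.

(** A quadric of rank at most 2 is a product of two linear forms. The curve is
    irreducible, so one factor vanishes on it, and the curve spans the space. *)
Lemma quadric_rank_ge3 v : v != 0 -> (2 < \rank (gram_mx (quadric_poly v)))%N.
Proof.
move=> v0; rewrite ltnNge; apply/negP => /quadric_sum_squares [a vE].
have [i i2] := imaginary_ex.
rewrite !big_ord_recl big_ord0 addr0 in vE.
set u := row _ _ in vE; set w := row _ _ in vE.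
have vE' : quadric_poly v = linform (u + i *: w) * linform (u - i *: w).
  rewrite vE linearB !linearD linearZ /= mulrC -subr_sqr exprZn i2 scaleN1r.
  by rewrite opprK.
have : rVpoly (u + i *: w) * rVpoly (u - i *: w) = 0.
  apply: (poly_eq_horner charK) => x; rewrite horner0 hornerM -!linform_curve -mevalM.
  by rewrite -vE' quadric_curve.
move/eqP; rewrite mulf_eq0 => /orP [] /eqP /(congr1 (@poly_rV K n));
  rewrite rVpolyK linear0 => z;
  case/eqP: v0; apply: quadric_poly_inj; rewrite vE' z !linear0 ?mul0r ?mulr0 //.
Qed.

Lemma cone_Phi3P v : cone (@Phi3 K d) v <->
  v != 0 /\ (\rank (gram_mx (quadric_poly v)) <= 3)%N.
Proof.
split=> [[p [q [q0 rq qp]] vp]|[v0 rk]].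
  split; first exact: represents_neq0 vp.
  have [c c0 ->] := represents_line qp vp.
  by rewrite !linearZ /= (leq_trans (mxrank_scale _ _)) // rq.
have [p vp] := represents_ex v0; exists p => //; exists v; split=> //.
by apply/eqP; rewrite eqn_leq rk quadric_rank_ge3.
Qed.

(** A sum of three squares is ab - c^2, and it contains the curve when ab = c^2 as
    polynomials. The index l is the degree of the pencil f, g; it is not 0, as
    then a, b and c would be proportional. *)
Lemma rank3_parametrized v : v != 0 -> (\rank (gram_mx (quadric_poly v)) <= 3)%N ->
  exists l F G H, [/\ (1 <= l)%N /\ (2 * l <= d)%N, degree_bounds l F G H,
    maxn (size F) (size G) = l.+1, coprimep F G /\ H != 0 &
    quadric_poly v = rank3_form F G H].
Proof.
move=> v0 /quadric_sum_squares [m vE].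
have [i i2] := imaginary_ex.
rewrite !big_ord_recl big_ord0 addr0 in vE.
set u := row _ _ in vE; set w := row _ _ in vE; set t := row _ _ in vE.
pose a := rVpoly (u + i *: w); pose b := rVpoly (u - i *: w); pose c := rVpoly (i *: t).
have vE' : quadric_poly v = lin a * lin b - lin c ^+ 2.
  rewrite /lin !rVpolyK vE linearB !linearD !linearZ /=.
  by rewrite scalerN [X in _ = X - _]mulrC -subr_sqr !exprZn i2 !scaleN1r !opprK addrA.
have ab : a * b = c ^+ 2.
  apply: (poly_eq_horner charK) => x; apply/eqP; rewrite -subr_eq0; apply/eqP.
  rewrite -[RHS](quadric_curve v x) vE' mevalB rmorphXn /= mevalM !linform_curve.
  rewrite !poly_rV_K ?size_poly //.
  by rewrite hornerM horner_exp.
have a0 : a != 0.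
  apply: contraNneq v0 => z; apply/eqP/quadric_poly_inj; rewrite linear0 vE'.
  have /eqP : c ^+ 2 = 0 by rewrite -ab z mul0r.
  by rewrite expf_eq0 => /eqP ->; rewrite z /lin !linear0 mul0r expr0n subr0.
have [F [G [H [aE bE cE cop H0]]]] := conic_param a0 ab.
have vQ : quadric_poly v = rank3_form F G H by rewrite vE' aE bE cE.
have F0 : F != 0 by apply: contraNneq a0 => z; rewrite aE z expr0n mul0r.
have sF : (size (F ^+ 2 * H)%R <= n)%N by rewrite -aE size_poly.
have sG : (size (G ^+ 2 * H)%R <= n)%N by rewrite -bE size_poly.
have s2 (P : {poly K}) : P != 0 -> size (P ^+ 2 * H) = ((size P).*2 + size H - 2)%N.
  move=> P0; rewrite size_mul ?expf_neq0 // expr2 size_mul //.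
  have := P0; rewrite -size_poly_gt0; move: (size P) (size H) H0 => x y _.
  rewrite -addnn; lia.
have H1 : (0 < size H)%N by rewrite size_poly_gt0.
have F1 : (0 < size F)%N by rewrite size_poly_gt0.
pose l := (maxn (size F) (size G)).-1.
have lE : maxn (size F) (size G) = l.+1 by rewrite prednK // leq_max F1.
have l1 : (1 <= l)%N.
  rewrite lt0n; apply: contraNneq v0 => l0; rewrite l0 in lE.
  have sF1 : (size F <= 1)%N by rewrite -lE leq_maxl.
  have sG1 : (size G <= 1)%N by rewrite -lE leq_maxr.
  apply/eqP/quadric_poly_inj; rewrite linear0 vQ (size1_polyC sF1) (size1_polyC sG1).
  rewrite /rank3_form -!polyC_exp -!polyCM !mul_polyC !linZ exprZn -scalerAl -scalerAr scalerA.
  by rewrite exprMn -expr2 subrr.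
have ldH : (2 * l + size H <= n)%N.
  have [GF|FG] := leqP (size G) (size F).
    move: sF; rewrite s2 //; move: lE; rewrite (maxn_idPl GF) => ->.
    move: (size H) H1; rewrite -addnn; lia.
  have G0 : G != 0 by rewrite -size_poly_gt0 (leq_trans _ FG).
  move: sG; rewrite s2 //; move: lE; rewrite (maxn_idPr (ltnW FG)) => ->.
  move: (size H) H1; rewrite -addnn; lia.
exists l, F, G, H; split=> //.
  by split=> //; move: (size H) H1 ldH; lia.
split; rewrite -?lE ?leq_maxl ?leq_maxr //.
move: (size H) H1 ldH; lia.
Qed.

End Quadrics.

(** * The invariants separating the strata *)

Section LinearAlgebra.
Variable K : fieldType.

(** A matrix of rank greater than r has an invertible compression of size r + 1, so
    testing all B and C replaces the choice of minors. *)
Lemma rank_le_det m n r (M : 'M[K]_(m, n)) : (\rank M <= r)%N <->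
  forall (B : 'M_(r.+1, m)) (C : 'M_(n, r.+1)), \det (B *m M *m C) = 0.
Proof.
split=> [rM B C|h].
  apply/eqP; apply: contraTT (rM) => dn; rewrite -ltnNge.
  have : \rank (B *m M *m C) = r.+1 by apply: mxrank_unit; rewrite unitmxE unitfE.
  move=> <-; apply: leq_trans (mxrankM_maxl _ _) (mxrankM_maxr _ _).
rewrite leqNgt; apply/negP => rM.
have := h (pid_mx r.+1 *m invmx (col_ebase M)) (invmx (row_ebase M) *m pid_mx r.+1).
rewrite -{2}(mulmx_ebase M) !mulmxA mulmxKV ?col_ebase_unit //.
rewrite mulmxK ?row_ebase_unit // !mul_pid_mx.
have rm := rank_leq_row M; have rn := rank_leq_col M.
rewrite (_ : minn _ _ = r.+1); last by lia.
by rewrite pid_mx_1 det1 => /eqP; rewrite oner_eq0.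
Qed.

(** A matrix with trivial left kernel has a right inverse. *)
Lemma ker_det m n (M : 'M[K]_(m, n)) :
  (exists2 u : 'rV_m, u != 0 & u *m M = 0) <-> forall C : 'M_(n, m), \det (M *m C) = 0.
Proof.
split=> [[u u0 uM] C|h].
  by apply/eqP/det0P; exists u => //; rewrite mulmxA uM mul0mx.
have : ~~ row_free M.
  by apply/negP => /row_freeP [C MC]; move: (h C); rewrite MC det1 => /eqP; rewrite oner_eq0.
rewrite -kermx_eq0 => /rowV0Pn [u uk u0]; exists u => //.
exact/sub_kermxP.
Qed.

End LinearAlgebra.

Section Strata.
Variables (K : closedFieldType) (charK : [pchar K] =i pred0) (d : nat).
Local Notation n := d.+1.
Local Notation V := (rnc_quadrics K d).
Implicit Types (F G H D : {poly K}) (v : V) (M : 'M[K]_n).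

(** A relation u A + w B = 0 with u and w of degree at most 2 l encodes a common
    factor of A and B of degree at least d - 2 l as forms of degree d, zeros at
    infinity included; it is a kernel condition, hence closed. *)
Definition common_factor l M := forall p1 p2, exists u w : {poly K},
  [/\ (size u <= (2 * l).+1)%N, (size w <= (2 * l).+1)%N, (u != 0) || (w != 0) &
      u * biform M p1 + w * biform M p2 = 0].

(** The change of coordinates moving the point r of the line to infinity, so that
    nonvanishing at r becomes having full degree d. *)
Definition shift_rev (r : K) (F : {poly K}) : {poly K} := rev_poly d (F \Po ('X + r%:P)).

(** The first alternative covers the points r where the degree drops; when M is
    not 0, the second holds for general p and r. *)
Definition square_factor l M := forall p r : K, (biform M p).[r] = 0 \/
  exists2 s : {poly K}, size s = l.+1 & s ^+ 2 %| shift_rev r (biform M p).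

Lemma size_shift (r : K) F : size (F \Po ('X + r%:P)) = size F.
Proof. by rewrite size_comp_poly2 // size_XaddC. Qed.

Lemma horner_shift0 (r : K) F : (F \Po ('X + r%:P)).[0] = F.[r].
Proof. by rewrite horner_comp hornerD hornerX hornerC add0r. Qed.

Lemma shiftK (r : K) F : (F \Po ('X + r%:P)) \Po ('X - r%:P) = F.
Proof.
by rewrite -comp_polyA comp_polyD comp_polyX comp_polyC subrK comp_polyXr.
Qed.

Lemma rev_poly_mul_sqr m l H D : (size H <= m.+1)%N -> (size D <= l.+1)%N ->
  rev_poly (m + 2 * l) (H * D ^+ 2) = rev_poly m H * rev_poly l D ^+ 2.
Proof.
move=> sH sD; rewrite !expr2 !mulrA mul2n -addnn addnA.
rewrite !(rev_polyM charK) //.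
by apply: leq_trans (size_polyMleq _ _) _; move: (size H) (size D) sH sD; lia.
Qed.

(** The member of the pencil spanned by F and G that vanishes at p. *)
Definition pencil_at F G (p : K) : {poly K} := F.[p] *: G - G.[p] *: F.

Lemma size_pencil_at l F G p : (size F <= l.+1)%N -> (size G <= l.+1)%N ->
  (size (pencil_at F G p) <= l.+1)%N.
Proof.
move=> sF sG; apply: leq_trans (size_polyD _ _) _; rewrite size_polyN geq_max.
by rewrite !(leq_trans (size_scale_leq _ _)).
Qed.

Lemma biform_pencil_at l F G H p : (2 * l <= d)%N -> degree_bounds d l F G H ->
  biform (gram_mx (rank3_form d F G H)) p = ((2^-1 * H.[p]) *: H) * pencil_at F G p ^+ 2.
Proof. by move=> ld b3; rewrite (biform_rank3_bounded charK p ld b3) scalerAl. Qed.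

(** Two members of the net are h s_1^2 and h s_2^2 up to scalars, with s_i of degree
    at most l; the relation is given by s_2^2 and s_1^2. *)
Lemma rank3_form_common_factor l F G H : (2 * l <= d)%N -> degree_bounds d l F G H ->
  common_factor l (gram_mx (rank3_form d F G H)).
Proof.
move=> ld b3 p1 p2; have [sF sG sH] := b3.
rewrite !(biform_pencil_at _ ld b3).
have s2 (P : {poly K}) : (size P <= l.+1)%N -> (size (P ^+ 2)%R <= (2 * l).+1)%N.
  move=> sP; rewrite expr2; apply: leq_trans (size_polyMleq _ _) _.
  by move: (size P) sP; lia.
have st p := size_pencil_at p sF sG.
have [z|nz] := eqVneq ((2^-1 * H.[p1]) *: H * pencil_at F G p1 ^+ 2) 0.
  exists 1, 0; split; rewrite ?size_poly1 ?size_poly0 ?oner_eq0 //.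
  by rewrite z mulr0 mul0r addr0.
exists (H.[p2] *: pencil_at F G p2 ^+ 2), (- (H.[p1] *: pencil_at F G p1 ^+ 2)).
split; rewrite ?size_polyN.
- by apply: leq_trans (size_scale_leq _ _) (s2 _ (st _)).
- by apply: leq_trans (size_scale_leq _ _) (s2 _ (st _)).
- rewrite oppr_eq0; apply/orP; right; apply: contraNneq nz => /eqP.
  rewrite scaler_eq0 => /orP [/eqP ->|/eqP ->]; last by rewrite mulr0.
  by rewrite mulr0 scale0r mul0r.
rewrite -!mul_polyC !polyCM; ring.
Qed.

Lemma rank3_form_square_factor l F G H : (2 * l <= d)%N -> degree_bounds d l F G H ->
  square_factor l (gram_mx (rank3_form d F G H)).
Proof.
move=> ld b3 p r; have [sF sG sH] := b3.
rewrite !(biform_pencil_at _ ld b3) /shift_rev comp_polyM rmorphXn /=.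
set H' := _ *: H.
have sH' : (size H' <= (d - 2 * l).+1)%N by apply: leq_trans (size_scale_leq _ _) sH.
rewrite -{1}(subnK ld) rev_poly_mul_sqr ?size_shift ?size_pencil_at //.
have [z|nz] := eqVneq (pencil_at F G p).[r] 0.
  by left; rewrite hornerM horner_exp z expr0n mulr0.
right; exists (rev_poly l (pencil_at F G p \Po ('X + r%:P))); last by rewrite dvdp_mull.
by apply: size_rev_poly_eq; rewrite horner_shift0.
Qed.

(** Otherwise F and G are proportional, and being coprime they are constant. *)
Lemma pencil_at_neq0 F G p : coprimep F G -> (1 < maxn (size F) (size G))%N ->
  pencil_at F G p != 0.
Proof.
move=> cop mx; apply/eqP => /eqP; rewrite subr_eq0 => /eqP e.
have [Fp|Fp] := eqVneq F.[p] 0.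
  have Gp : G.[p] != 0 by apply: (coprimep_root cop); rewrite /root Fp.
  move/esym/eqP: e; rewrite Fp scale0r scaler_eq0 (negPf Gp) /= => /eqP F0.
  move: mx cop; rewrite F0 coprime0p size_poly0 max0n => sG /eqp_size.
  by rewrite size_poly1 => sG'; rewrite sG' in sG.
have GF : G = (G.[p] / F.[p]) *: F.
  by rewrite mulrC -scalerA -e scalerA mulVf // scale1r.
have FG : F %| G by rewrite GF -mul_polyC dvdp_mull.
have sF : size F = 1%N.
  by apply/eqP; move: cop; rewrite coprimep_def (eqp_size (dvdp_gcd_idl FG)).
have : (size G <= 1)%N by rewrite GF -sF size_scale_leq.
by move: mx; rewrite sF; move: (size G) => m; lia.
Qed.

Lemma size_sqr_dvd l (P Q : {poly K}) : P != 0 -> Q != 0 ->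
  (size Q <= (2 * l).+1)%N -> P ^+ 2 %| Q -> (size P <= l.+1)%N.
Proof.
move=> P0 Q0 sQ /(dvdp_leq Q0) /leq_trans /(_ sQ).
by rewrite expr2 size_mul //; move: (size P); clear; lia.
Qed.

(** For general p1 and p2 the members of the pencil at p1 and p2 are coprime, since
    they span the same space as F and G. Then the relation forces u and w to be
    multiples of their squares, so these have degree at most 2 l. *)
Lemma common_factor_degree l l' F G H : (2 * l' <= d)%N -> degree_bounds d l' F G H ->
  coprimep F G -> H != 0 -> maxn (size F) (size G) = l'.+1 ->
  common_factor l (gram_mx (rank3_form d F G H)) -> (l' <= l)%N.
Proof.
move=> ld b3 cop H0 mx cf.
have [->//|l'0] := posnP l'.
have tn p : pencil_at F G p != 0 by apply: pencil_at_neq0 => //; rewrite mx.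
have [p1 Hp1] := poly_neq0_ex charK H0.
have [p2] : exists t, (H * pencil_at F G p1).[t] != 0.
  by apply: (poly_neq0_ex charK); rewrite mulf_neq0.
rewrite hornerM mulf_eq0 negb_or => /andP [Hp2 Dp].
have [u [w [su sw uw0]]] := cf p1 p2.
rewrite !(biform_pencil_at _ ld b3).
set D1 := pencil_at F G p1 in Dp *; set D2 := pencil_at F G p2.
(* The determinant of the change of basis from F, G to D1, D2. *)
set e := D1.[p2] in Dp.
have eE : e = F.[p1] * G.[p2] - G.[p1] * F.[p2] by rewrite /e /D1 !hornerE.
have FE : e *: F = F.[p2] *: D1 - F.[p1] *: D2.
  by rewrite eE /D1 /D2 /pencil_at -!mul_polyC !polyCD !polyCN !polyCM; ring.
have GE : e *: G = G.[p2] *: D1 - G.[p1] *: D2.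
  by rewrite eE /D1 /D2 /pencil_at -!mul_polyC !polyCD !polyCN !polyCM; ring.
have D10 : D1 != 0 by apply: tn.
have D20 : D2 != 0 by apply: tn.
have copD : coprimep D1 D2.
  apply/coprimepP => c c1 c2; move/coprimepP: cop; apply.
    by rewrite -(dvdpZr _ _ Dp) FE dvdp_sub -?mul_polyC ?dvdp_mull.
  by rewrite -(dvdpZr _ _ Dp) GE dvdp_sub -?mul_polyC ?dvdp_mull.
set k1 := 2^-1 * _; set k2 := 2^-1 * _ => uw.
have k10 : k1 != 0 by rewrite mulf_neq0 ?invr_eq0 ?two_neq0.
have k20 : k2 != 0 by rewrite mulf_neq0 ?invr_eq0 ?two_neq0.
have uw' : (k1 *: u) * D1 ^+ 2 = - (k2 *: w) * D2 ^+ 2.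
  apply: (mulfI H0); apply/eqP; rewrite -subr_eq0; apply/eqP.
  by rewrite -[RHS]uw -!mul_polyC; ring.
have Du : D2 ^+ 2 %| u.
  rewrite -(dvdpZr _ _ k10) -(@Gauss_dvdpl _ _ (D1 ^+ 2)).
    by rewrite uw' dvdp_mull.
  by rewrite coprimep_pexpl // coprimep_pexpr // coprimep_sym.
have Dw : D1 ^+ 2 %| w.
  rewrite -(dvdpZr _ _ k20) -dvdpNr -(@Gauss_dvdpl _ _ (D2 ^+ 2)).
    by rewrite -uw' dvdp_mull.
  by rewrite coprimep_pexpl // coprimep_pexpr.
have [u0 w0] : u != 0 /\ w != 0.
  split.
    apply: contraTneq uw0 => u0; move/eqP: uw'; rewrite u0 scaler0 mul0r eq_sym.
    rewrite mulf_eq0 oppr_eq0 scaler_eq0 (negPf k20) expf_eq0 (negPf D20) /= orbF.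
    by move=> /eqP ->; rewrite eqxx.
  apply: contraTneq uw0 => w0; move/eqP: uw'; rewrite w0 scaler0 oppr0 mul0r.
  rewrite mulf_eq0 scaler_eq0 (negPf k10) expf_eq0 (negPf D10) /= orbF.
  by move=> /eqP ->; rewrite eqxx.
have s1 := size_sqr_dvd D10 w0 sw Dw; have s2 := size_sqr_dvd D20 u0 su Du.
have comb (a b : K) : (size (a *: D1 - b *: D2)%R <= l.+1)%N.
  apply: leq_trans (size_polyD _ _) _; rewrite size_polyN geq_max.
  by rewrite !(leq_trans (size_scale_leq _ _)).
rewrite -ltnS -mx geq_max -(size_scale _ Dp) FE comb -(size_scale G Dp) GE comb.
done.
Qed.

(** At a general p the form B(p, .) is H D^2, with D in the pencil, of degree l'.
    A square divisor of degree 2 l can take at most D^2 from D^2, which leaves a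
    square of degree 2 (l - l') dividing H. Moving a general point r to infinity
    beforehand makes all degrees exact, so that zeros of H at infinity count. *)
Lemma square_factor_divisor l l' F G H : (2 * l' <= d)%N -> (2 * l <= d)%N ->
  degree_bounds d l' F G H ->
  coprimep F G -> H != 0 -> maxn (size F) (size G) = l'.+1 -> (0 < l')%N ->
  (l' <= l)%N -> square_factor l (gram_mx (rank3_form d F G H)) ->
  exists u k : {poly K}, [/\ (size u <= (l - l').+1)%N, (size k <= (d - 2 * l).+1)%N &
     H = u ^+ 2 * k].
Proof.
move=> ld' ld b3 cop H0 mx l'0 l'l sqf; have [sF sG sH] := b3.
have [p Hp] := poly_neq0_ex charK H0.
have D0 : pencil_at F G p != 0 by rewrite pencil_at_neq0 ?mx.
have [r] : exists t, (H * pencil_at F G p).[t] != 0.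
  by apply: (poly_neq0_ex charK); rewrite mulf_neq0.
rewrite hornerM mulf_eq0 negb_or => /andP [Hr Dr].
set D := pencil_at F G p in D0 Dr.
have sD : (size D <= l'.+1)%N by apply: size_pencil_at.
set c := 2^-1 * H.[p]; have c0 : c != 0 by rewrite mulf_neq0 ?invr_eq0 ?two_neq0.
have bE : biform (gram_mx (rank3_form d F G H)) p = (c *: H) * D ^+ 2.
  by rewrite (biform_pencil_at _ ld' b3).
case: (sqf p r) => [/eqP|[s ss]]; rewrite bE.
  rewrite hornerM hornerZ horner_exp mulf_eq0 expf_eq0 /= (negPf Dr) orbF.
  by rewrite mulf_eq0 (negPf c0) (negPf Hr).
set H' := (c *: H) \Po ('X + r%:P); set D' := D \Po ('X + r%:P).
have sH' : (size H' <= (d - 2 * l').+1)%N by rewrite size_shift size_scale.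
have sD' : (size D' <= l'.+1)%N by rewrite size_shift.
have D'0 : D'.[0] != 0 by rewrite horner_shift0.
have H'0 : H'.[0] != 0 by rewrite horner_shift0 hornerZ mulf_neq0.
rewrite /shift_rev comp_polyM rmorphXn /= -/H' -/D' -{1}(subnK ld') rev_poly_mul_sqr //.
move=> sdv; have sRD := size_rev_poly_eq l' D'0.
have sRH := size_rev_poly_eq (d - 2 * l') H'0.
have RD0 : rev_poly l' D' != 0 by rewrite -size_poly_gt0 sRD.
have [U sU /dvdpP [k kE]] := sqr_dvd_mul_sqr ss (size_rev_poly _ _) RD0 l'l sdv.
have sk : size k = (d - 2 * l).+1.
  have U0 : U != 0 by rewrite -size_poly_gt0 sU.
  have k0 : k != 0.
    by apply: contra_eq_neq kE => ->; rewrite mul0r -size_poly_gt0 sRH.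
  move: sRH; rewrite kE expr2 size_mul ?mulf_neq0 // size_mul // sU.
  have := k0; rewrite -size_poly_gt0; move: (size k) => m; clear -ld ld' l'l; lia.
pose u := rev_poly (l - l') U \Po ('X - r%:P).
pose kk := rev_poly (d - 2 * l) k \Po ('X - r%:P).
have sh m (P : {poly K}) : (size (rev_poly m P \Po ('X - r%:P)) <= m.+1)%N.
  by rewrite size_comp_poly2 ?size_XsubC // size_rev_poly.
exists u, (c^-1 *: kk); split; first exact: sh.
  by apply: leq_trans (size_scale_leq _ _) (sh _ _).
have : H' = rev_poly (d - 2 * l) k * rev_poly (l - l') U ^+ 2.
  rewrite -(rev_polyK sH') kE -rev_poly_mul_sqr ?sk ?sU //.
  by congr rev_poly; move: ld ld' l'l; clear; lia.
move/(congr1 (fun P : {poly K} => P \Po ('X - r%:P))).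
rewrite shiftK comp_polyM rmorphXn /= -/u -/kk => cH.
by rewrite -scalerAr mulrC -cH scalerA mulVf // scale1r.
Qed.

Lemma rank3_form_absorb F G u k :
  rank3_form d F G (u ^+ 2 * k) = rank3_form d (F * u) (G * u) k.
Proof. by rewrite /rank3_form; congr (lin _ _ * lin _ _ - lin _ _ ^+ 2); ring. Qed.

(** Write the quadric as Q_l'(F, G, H) with F and G coprime; the conditions provide
    H = u^2 k, and then u can be moved into F and G. *)
Lemma cone_Wvar_conditions l v : (1 <= l)%N -> (2 * l <= d)%N -> v != 0 ->
  let M := gram_mx (quadric_poly v) in
  cone (@Wvar K d l) v <->
  [/\ (\rank M <= 3)%N, common_factor l M & square_factor l M].
Proof.
move=> l1 ld v0 M; rewrite (cone_WvarP v ld); split.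
  move=> [_ [F [G [H [b3 vE]]]]]; rewrite /M vE; split.
  - exact: rank_gram_rank3.
  - exact: rank3_form_common_factor.
  - exact: rank3_form_square_factor.
move=> [rM cf sqf]; split=> //.
have [l' [F [G [H [[l'1 l'd] b3 mx [cop H0] vE]]]]] := rank3_parametrized charK v0 rM.
rewrite /M vE in cf sqf.
have l'l := common_factor_degree l'd b3 cop H0 mx cf.
have [u [k [su sk HE]]] := square_factor_divisor l'd ld b3 cop H0 mx l'1 l'l sqf.
exists (F * u), (G * u), k; split; last by rewrite vE HE rank3_form_absorb.
have [sF sG _] := b3.
split=> //; apply: leq_trans (size_polyMleq _ _) _;
  move: (size F) (size G) (size u) sF sG su; lia.
Qed.



End Strata.

(** * The decomposition into strata *)

Lemma polyfun_scalar (K : closedFieldType) (V : vectType K) (F : V -> K) :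
  (forall a v w, F (a *: v + w) = a * F v + F w) -> polyfun F.
Proof.
move=> lF; pose L := GRing.isLinear.Build K V K^o *:%R (F : V -> K^o) lF.
pose LF : {linear V -> K^o} := HB.pack (F : V -> K^o) L.
exact: (polyfun_linear LF).
Qed.

Section Decomposition.
Variables (K : closedFieldType) (charK : [pchar K] =i pred0) (d : nat).
Local Notation n := d.+1.
Local Notation V := (rnc_quadrics K d).
Local Notation gram v := (gram_mx (quadric_poly v)).
Implicit Types (F G H D : {poly K}) (v : V) (M : 'M[K]_n).

Lemma gramP a v w : gram (a *: v + w) = a *: gram v + gram w.
Proof. by rewrite (linearP (@quadric_poly K d)) (linearP (@gram_mx K d)). Qed.

Lemma polyfun_gram i j : polyfun (fun v => gram v i j).
Proof. by apply: polyfun_scalar => a v w; rewrite gramP [LHS]mxE [X in X + _]mxE. Qed.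

Lemma biformP a M N p : biform (a *: M + N) p = a *: biform M p + biform N p.
Proof. by rewrite biformD biformZ. Qed.

Lemma polyfun_shift_rev p r j :
  polyfun (fun v => (shift_rev d r (biform (gram v) p))`_j).
Proof.
apply: polyfun_scalar => a v w; rewrite gramP biformP /shift_rev.
rewrite comp_polyD comp_polyZ !coef_rev_poly; case: ifP => _; last by rewrite mulr0 addr0.
by rewrite coefD coefZ.
Qed.

Definition minor_conditions : set (V -> K) :=
  [set f | exists B C, f = fun v => \det ((B : 'M_(4, n)) *m gram v *m (C : 'M_(n, 4)))].

Lemma minor_conditionsP v :
  (forall f, minor_conditions f -> f v = 0) <-> (\rank (gram v) <= 3)%N.
Proof.
rewrite rank_le_det; split=> [h B C | h _ [B [C ->]]]; last exact: h.
by apply: (h (fun v => \det (B *m gram v *m C))); exists B, C.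
Qed.

Lemma polyfun_minor_conditions f : minor_conditions f -> polyfun f.
Proof.
move=> [B [C ->]]; apply: polyfun_det; apply: polyfun_mulmx; last first.
  by move=> *; exact: polyfun_const.
by apply: polyfun_mulmx => i j; [exact: polyfun_const | exact: polyfun_gram].
Qed.

Definition mulpoly_mx l (F : {poly K}) : 'M[K]_((2 * l).+1, (d + 2 * l).+1) :=
  \matrix_(i, j) ('X^i * F)`_j.

Lemma mulpoly_mxE l F (u : 'rV_(2 * l).+1) : u *m mulpoly_mx l F = poly_rV (rVpoly u * F).
Proof.
apply/rowP => j; rewrite !mxE.
have -> : rVpoly u = \sum_(i < (2 * l).+1) u 0 i *: 'X^i.
  by rewrite /rVpoly poly_def; apply: eq_bigr => i _; rewrite valK.
rewrite mulr_suml coef_sum; apply: eq_bigr => i _.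
by rewrite mxE -scalerAl coefZ.
Qed.

(** Its left kernel consists of the relations u F + w G = 0 of bounded degree. *)
Definition sylvester_mx l F G := col_mx (mulpoly_mx l F) (mulpoly_mx l G).

Lemma sylvester_mxP l F G : (size F <= n)%N -> (size G <= n)%N ->
  (exists u w : {poly K},
  [/\ (size u <= (2 * l).+1)%N, (size w <= (2 * l).+1)%N, (u != 0) || (w != 0) &
      u * F + w * G = 0]) <->
  exists2 x : 'rV_((2 * l).+1 + (2 * l).+1), x != 0 & x *m sylvester_mx l F G = 0.
Proof.
move=> sF sG.
have szM (u P : {poly K}) : (size P <= n)%N -> (size u <= (2 * l).+1)%N ->
    (size (u * P)%R <= (d + 2 * l).+1)%N.
  move=> sP su; apply: leq_trans (size_polyMleq _ _) _.
  by move: (size u) (size P) su sP; clear; lia.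
split=> [[u [w [su sw uw0 uw]]]|[x x0 xS]].
  exists (row_mx (poly_rV u) (poly_rV w)).
    apply: contraTneq uw0 => /eqP; rewrite row_mx_eq0 => /andP [/eqP u0 /eqP w0].
    by rewrite -(poly_rV_K su) -(poly_rV_K sw) u0 w0 linear0 eqxx.
  by rewrite mul_row_col !mulpoly_mxE !poly_rV_K // -linearD /= uw linear0.
exists (rVpoly (lsubmx x)), (rVpoly (rsubmx x)).
split; rewrite ?size_poly //.
  rewrite -(hsubmxK x) row_mx_eq0 negb_and in x0.
  have nz (y : 'rV[K]_(2 * l).+1) : y != 0 -> rVpoly y != 0.
    by apply: contraNneq => /(congr1 (@poly_rV K (2 * l).+1)); rewrite rVpolyK linear0 => ->.
  by case/orP: x0 => /nz ->; rewrite ?orbT.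
move: xS; rewrite -{1}(hsubmxK x) mul_row_col !mulpoly_mxE -linearD /=.
move/(congr1 rVpoly); rewrite linear0 poly_rV_K //.
apply: leq_trans (size_polyD _ _) _; rewrite geq_max !szM ?size_poly //.
Qed.

Definition common_factor_conditions l : set (V -> K) :=
  [set f | exists p1 p2 C, f = fun v =>
     \det (sylvester_mx l (biform (gram v) p1) (biform (gram v) p2) *m C)].

Lemma common_factor_conditionsP l v :
  (forall f, common_factor_conditions l f -> f v = 0) <-> common_factor l (gram v).
Proof.
split=> [h p1 p2 | h _ [p1 [p2 [C ->]]]].
  apply/sylvester_mxP; try exact: size_biform.
  apply/ker_det => C; apply: (h (fun v =>
     \det (sylvester_mx l (biform (gram v) p1) (biform (gram v) p2) *m C))).
  by exists p1, p2, C.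
have := h p1 p2; move/sylvester_mxP => /(_ (size_biform _ _) (size_biform _ _)).
by move/ker_det.
Qed.

Lemma polyfun_common_factor_conditions l f : common_factor_conditions l f -> polyfun f.
Proof.
move=> [p1 [p2 [C ->]]]; apply: polyfun_det; apply: polyfun_mulmx; last first.
  by move=> *; exact: polyfun_const.
have h p i j : polyfun (fun v => mulpoly_mx l (biform (gram v) p) i j).
  apply: polyfun_scalar => a v w; rewrite !mxE gramP biformP mulrDr -scalerAr.
  by rewrite coefD coefZ.
move=> i j; case: (fintype.split_ordP i) => k ->.
  have [g gE] := h p1 k j; exists g => v; rewrite -gE.
  by rewrite /sylvester_mx col_mxEu.
have [g gE] := h p2 k j; exists g => v; rewrite -gE.
by rewrite /sylvester_mx col_mxEd.
Qed.

Lemma square_factor_conditions l : (2 * l <= d)%N -> exists S : set (V -> K),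
  (forall f, S f -> polyfun f) /\
  forall v, (forall f, S f -> f v = 0) <-> square_factor l (gram v).
Proof.
move=> ld; have [P PE] := square_divisor_closed charK ld.
pose f p r t v := (P t).@[fun i => (shift_rev d r (biform (gram v) p))`_i].
have top p r v : (shift_rev d r (biform (gram v) p))`_d = (biform (gram v) p).[r].
  by rewrite coef_rev_poly leqnn subnn -horner_coef0 horner_shift0.
exists [set g | exists p r t, g = f p r t]; split=> [_ [p [r [t ->]]] | v].
  by apply: polyfun_meval => i; exact: polyfun_shift_rev.
split=> [h p r | h _ [p [r [t ->]]]].
  rewrite -top; apply/PE => [|t]; first exact: size_rev_poly.
  by apply: (h (f p r t)); exists p, r, t.
have := h p r; rewrite -top; move/PE => h'; apply: h'; exact: size_rev_poly.
Qed.

Lemma Wvar_closed l : (1 <= l)%N -> (2 * l <= d)%N -> proj_closed (@Wvar K d l).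
Proof.
move=> l1 ld; have [S [Spol SP]] := square_factor_conditions ld.
apply: (proj_closed_of_cone charK
  (S := minor_conditions `|` common_factor_conditions l `|` S)) => [f [[]|]|v v0].
- exact: polyfun_minor_conditions.
- exact: polyfun_common_factor_conditions.
- exact: Spol.
rewrite (cone_Wvar_conditions charK l1 ld v0).
split=> [[/minor_conditionsP h1 /common_factor_conditionsP h2 /SP h3] f [[]|]|h].
- exact: h1.
- exact: h2.
- exact: h3.
split; first by apply/minor_conditionsP => f hf; apply: h; left; left.
  by apply/common_factor_conditionsP => f hf; apply: h; left; right.
by apply/SP => f hf; apply: h; right.
Qed.

(** A quadric is determined linearly by its symmetric matrix. *)
Lemma polycurve_quadrics (g : K -> V) :
  (forall i j, polyfun1 (fun t => gram (g t) i j)) -> polycurve g.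
Proof.
move=> hg; pose L := GRing.isLinear.Build K V 'M[K]_n *:%R (fun v => gram v) gramP.
pose LF : {linear V -> 'M[K]_n} := HB.pack (fun v => gram v) L.
apply: (@polycurve_inj _ _ _ (linfun LF)).
  apply/lker0P => v w; rewrite !lfunE /= => e.
  by apply/quadric_poly_inj/(gram_inj charK (quadric_poly_homog _) (quadric_poly_homog _)).
move=> T; have [P PE] : polyfun1 (fun t => \sum_i \sum_j gram (g t) i j * T (delta_mx i j)).
  by do 2!apply: polyfun1_sum => ?; apply: polyfun1M => //; exact: polyfun1_const.
exists P => t; rewrite -PE lfunE /= [X in T X]matrix_sum_delta linear_sum.
apply: eq_bigr => i _; rewrite linear_sum; apply: eq_bigr => j _.
by rewrite linearZ.
Qed.

Lemma coef_gram_rank3 F G H i j : (gram_mx (rank3_form d F G H)) i j =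
  2^-1 * ((F ^+ 2 * H)`_i * (G ^+ 2 * H)`_j + (G ^+ 2 * H)`_i * (F ^+ 2 * H)`_j)
  - (F * G * H)`_i * (F * G * H)`_j.
Proof.
have t0 := two_neq0 charK.
rewrite /rank3_form raddfB /= (expr2 (lin _ _)) !gram_linform_mul // !mxE !big_ord1 !mxE.
by field.
Qed.

Definition polycurve_poly (P : K -> {poly K}) := forall i, polyfun1 (fun t => (P t)`_i).

Lemma polycurve_polyM (P Q : K -> {poly K}) :
  polycurve_poly P -> polycurve_poly Q -> polycurve_poly (fun t => P t * Q t).
Proof.
move=> hP hQ i; have [p pE] : polyfun1 (fun t => \sum_(j < i.+1) (P t)`_j * (Q t)`_(i - j)).
  by apply: polyfun1_sum => j; apply: polyfun1M.
by exists p => t; rewrite coefM.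
Qed.

Lemma polycurve_poly_line F G : polycurve_poly (fun t => F + t *: (G - F)).
Proof.
move=> i; have [p pE] := polyfun1_affine F`_i (G - F)`_i.
by exists p => t; rewrite coefD coefZ.
Qed.

Lemma polyfun1_gram_rank3 (F G H : K -> {poly K}) i j :
  polycurve_poly F -> polycurve_poly G -> polycurve_poly H ->
  polyfun1 (fun t => (gram_mx (rank3_form d (F t) (G t) (H t))) i j).
Proof.
move=> hF hG hH.
have hFF := polycurve_polyM (polycurve_polyM hF hF) hH.
have hGG := polycurve_polyM (polycurve_polyM hG hG) hH.
have hFG := polycurve_polyM (polycurve_polyM hF hG) hH.
have [p pE] := polyfun1D (polyfun1M (polyfun1_const 2^-1)
   (polyfun1D (polyfun1M (hFF i) (hGG j)) (polyfun1M (hGG i) (hFF j))))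
   (polyfun1M (polyfun1_const (-1)) (polyfun1M (hFG i) (hFG j))).
by exists p => t; rewrite -pE coef_gram_rank3 !expr2 mulN1r.
Qed.

(** At a point p with H(p) not 0, B(p, .) is a nonzero multiple of H D^2. *)
Lemma rank3_form_neq0 l F G H v : (2 * l <= d)%N -> degree_bounds d l F G H ->
  quadric_poly v = rank3_form d F G H -> coprimep F G -> H != 0 ->
  (1 < maxn (size F) (size G))%N -> v != 0.
Proof.
move=> ld b3 vE cop H0 mx.
have tn p : pencil_at F G p != 0 by apply: pencil_at_neq0.
have [p] := poly_neq0_ex charK H0; apply: contraNneq => v0.
have := biform_pencil_at charK p ld b3; rewrite -vE v0 !linear0 /biform mulmx0 linear0.
move/esym/eqP; rewrite mulf_eq0 expf_eq0 (negPf (tn p)) scaler_eq0 (negPf H0) !orbF.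
by rewrite mulf_eq0 invr_eq0 (negPf (two_neq0 charK)).
Qed.

(** The parameters f, g, h form an affine space, whose lines map to rational curves
    in the stratum. *)
Lemma Wvar_irreducible l : (1 <= l)%N -> (2 * l <= d)%N -> irreducible_closed (@Wvar K d l).
Proof.
move=> l1 ld; apply: (irreducible_of_curves charK); first exact: Wvar_closed.
  have b3 : degree_bounds d l (1 : {poly K}) 'X^l 1 by split; rewrite ?size_polyXn ?size_poly1.
  have [v [vE _]] := rank3_form_ex ld b3.
  have v0 : v != 0.
    apply: (rank3_form_neq0 ld b3 vE); rewrite ?coprime1p ?oner_eq0 //.
    by rewrite size_polyXn leq_max ltnS l1 orbT.
  have [p vp] := represents_ex v0; exists p; apply/(coneP _ vp)/cone_WvarP => //.
  by split=> //; exists 1, 'X^l, 1.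
move=> v w /cone_WvarP-/(_ ld) [_ [F [G [H [[sF sG sH] vE]]]]].
move=> /cone_WvarP-/(_ ld) [_ [F' [G' [H' [[sF' sG' sH'] wE]]]]].
pose line (A B : {poly K}) t := A + t *: (B - A).
have sline m (A B : {poly K}) t : (size A <= m)%N -> (size B <= m)%N ->
    (size (line A B t)%R <= m)%N.
  move=> sA sB; apply: leq_trans (size_polyD _ _) _; rewrite geq_max sA.
  apply: leq_trans (size_scale_leq _ _) _.
  by apply: leq_trans (size_polyD _ _) _; rewrite geq_max size_polyN sB.
have b3 t : degree_bounds d l (line F F' t) (line G G' t) (line H H' t).
  by split; apply: sline.
have /choice [g gE] : forall t, exists x : V,
    quadric_poly x = rank3_form d (line F F' t) (line G G' t) (line H H' t).
  by move=> t; have [x [xE _]] := rank3_form_ex ld (b3 t); exists x.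
have line0 A B : line A B 0 = A by rewrite /line scale0r addr0.
have line1 A B : line A B 1 = B by rewrite /line scale1r addrC subrK.
exists g; split.
- apply: polycurve_quadrics => i j.
  have [p pE] := polyfun1_gram_rank3 i j (polycurve_poly_line F F')
    (polycurve_poly_line G G') (polycurve_poly_line H H').
  by exists p => t; rewrite -pE gE.
- by apply: quadric_poly_inj; rewrite gE !line0.
- by apply: quadric_poly_inj; rewrite gE !line1.
move=> t gt0; apply/cone_WvarP => //; split=> //.
by exists (line F F' t), (line G G' t), (line H H' t).
Qed.

Lemma Phi3_eq : @Phi3 K d =
  \bigcup_(l in [set l | (1 <= l)%N /\ (2 * l <= d)%N]) @Wvar K d l.
Proof.
apply: cone_eq => v; split.
  case/(cone_Phi3P charK) => v0 rv.
  have [l [F [G [H [[l1 ld] b3 _ _ vE]]]]] := rank3_parametrized charK v0 rv.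
  have [p Wp vp] : cone (@Wvar K d l) v.
    by apply/cone_WvarP => //; split=> //; exists F, G, H.
  by exists p => //; exists l.
move=> [p [l [l1 ld] Wp] vp]; apply/(cone_Phi3P charK).
have /cone_WvarP : cone (@Wvar K d l) v by exists p.
by move=> /(_ ld) [v0 [F [G [H [_ ->]]]]]; split=> //; exact: rank_gram_rank3.
Qed.

(** The point f = 1, g = x^i, with h square-free of degree exactly d - 2 i, so that
    its zeros on the projective line are simple, infinity included. Lying in W_j
    forces i <= j by the degree of the pencil, and a square factor of h if i < j. *)
Lemma Wvar_not_sub i j : (1 <= i)%N -> (2 * i <= d)%N -> (1 <= j)%N -> (2 * j <= d)%N ->
  i <> j -> ~ @Wvar K d i `<=` @Wvar K d j.
Proof.
move=> i1 id j1 jd ij sub.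
pose H : {poly K} := \prod_(k <- iota 0 (d - 2 * i)) ('X - k%:R%:P).
have sH : size H = (d - 2 * i).+1 by rewrite size_prod_XsubC size_iota.
have b3 : degree_bounds d i (1 : {poly K}) 'X^i H by split; rewrite ?size_polyXn ?size_poly1 ?sH.
have H0 : H != 0 by rewrite -size_poly_gt0 sH.
have cop : coprimep (1 : {poly K}) 'X^i by rewrite coprime1p.
have mx : maxn (size (1 : {poly K})) (size ('X^i : {poly K})) = i.+1.
  by rewrite size_poly1 size_polyXn; apply/maxn_idPr.
have [v [vE _]] := rank3_form_ex id b3.
have v0 : v != 0 by apply: (rank3_form_neq0 id b3 vE); rewrite ?mx.
have : cone (@Wvar K d j) v.
  move/cone_sub: sub; apply; apply/cone_WvarP => //.
  by split=> //; exists 1, 'X^i, H.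
case/(cone_Wvar_conditions charK j1 jd v0) => _; rewrite vE => cf sqf.
have le := common_factor_degree charK id b3 cop H0 mx cf.
have [u [k [su sk HE]]] := square_factor_divisor charK id jd b3 cop H0 mx i1 le sqf.
have u0 : u != 0 by apply: contraNneq H0 => u0; rewrite HE u0 expr0n mul0r.
have k0 : k != 0 by apply: contraNneq H0 => k0; rewrite HE k0 mulr0.
have szu : (1 < size u)%N.
  move: sH; rewrite HE expr2 !size_mul ?mulf_neq0 //.
  have := k0; rewrite -size_poly_gt0; have := u0; rewrite -size_poly_gt0.
  by move: (size u) (size k) su sk; move/eqP: ij le jd id; clear; lia.
have /closed_rootP [x ux] : size u != 1%N by rewrite neq_ltn szu orbT.
have : ('X - x%:P) ^+ 2 %| H by rewrite HE dvdp_mulr // dvdp_pexp2r // dvdp_XsubCl.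
rewrite -mup_geq // /H -(big_map (fun k : nat => k%:R) xpredT (fun x : K => 'X - x%:P)).
rewrite mu_prod_XsubC count_uniq_mem; first by case: (_ \in _).
by rewrite map_inj_uniq ?iota_uniq //; exact: natr_inj.
Qed.

Lemma Phi3_decomposition : minimal_irreducible_decomposition (@Phi3 K d)
  [set l | (1 <= l)%N /\ (2 * l <= d)%N] (@Wvar K d).
Proof.
split.
- apply: (sub_finite_set _ (finite_II d.+1)) => l [_ ld] /=.
  by move: ld; clear; lia.
- by move=> l [l1 ld]; exact: Wvar_irreducible.
- exact: Phi3_eq.
- by move=> i j [i1 id] [j1 jd]; exact: Wvar_not_sub.
Qed.

End Decomposition.

(** * Linear span of a stratum and the ideal of the curve *)

Section Spanning.
Variables (K : closedFieldType) (charK : [pchar K] =i pred0) (d : nat).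
Local Notation n := d.+1.
Local Notation V := (rnc_quadrics K d).
Local Notation lin := (@lin K d).
Implicit Types (f g h F G H : {poly K}).

Lemma rank3_form_polar_h f g h1 h2 :
  rank3_form d f g (h1 + h2) - rank3_form d f g h1 - rank3_form d f g h2 =
  lin (f ^+ 2 * h1) * lin (g ^+ 2 * h2) + lin (f ^+ 2 * h2) * lin (g ^+ 2 * h1)
  - 2 * (lin (f * g * h1) * lin (f * g * h2)).
Proof. by rewrite /rank3_form !mulrDr !linD; ring. Qed.

Lemma rank3_form_polar_fg f1 f2 g1 g2 h :
  let Q f g := rank3_form d f g h in
  Q (f1 + f2) (g1 + g2) - Q (f1 + f2) g1 - Q (f1 + f2) g2
  - (Q f1 (g1 + g2) - Q f1 g1 - Q f1 g2)
  - (Q f2 (g1 + g2) - Q f2 g1 - Q f2 g2) =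
  2 * (2 * (lin (f1 * f2 * h) * lin (g1 * g2 * h))
       - lin (f1 * g1 * h) * lin (f2 * g2 * h) - lin (f1 * g2 * h) * lin (f2 * g1 * h)).
Proof.
have sq (a b : {poly K}) :
    (a + b) ^+ 2 * h = a ^+ 2 * h + b ^+ 2 * h + (a * b * h + a * b * h).
  by ring.
by rewrite /= /rank3_form !sq !mulrDl !mulrDr !mulrDl !linD; ring.
Qed.

Section Subspace.
Variable P : {mpoly K[n]} -> Prop.
Hypothesis P0 : P 0.
Hypothesis PL : forall (a : K) u v, P u -> P v -> P (a *: u + v).

Lemma subspaceD u v : P u -> P v -> P (u + v).
Proof. by move=> Pu Pv; rewrite -[u]scale1r; apply: PL. Qed.

Lemma subspaceZ a u : P u -> P (a *: u).
Proof. by move=> Pu; rewrite -[_ *: _]addr0; apply: PL. Qed.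

Lemma subspaceN u : P u -> P (- u).
Proof. by rewrite -scaleN1r; apply: subspaceZ. Qed.

Lemma subspaceB u v : P u -> P v -> P (u - v).
Proof. by move=> Pu /subspaceN; apply: subspaceD. Qed.

Lemma subspaceB3 u v w : P u -> P v -> P w -> P (u - v - w).
Proof. by move=> Pu Pv Pw; apply: subspaceB Pw; apply: subspaceB. Qed.

Lemma subspace_sum (I : eqType) (r : seq I) (F : I -> {mpoly K[n]}) :
  (forall i, i \in r -> P (F i)) -> P (\sum_(i <- r) F i).
Proof.
elim: r => [|i r IH] h; first by rewrite big_nil.
rewrite big_cons; apply: subspaceD; first by apply: h; rewrite mem_head.
by apply: IH => j jr; apply: h; rewrite inE jr orbT.
Qed.

Section Pencils.
Variable l : nat.
Hypothesis l1 : (1 <= l)%N.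
Hypothesis PQ : forall F G H, degree_bounds d l F G H -> P (rank3_form d F G H).

Local Notation z i := (lin 'X^i).

Lemma span_polar_h i k : (i <= d - 2 * l)%N -> (k <= d - 2 * l)%N ->
  P (z i * z (k + 2 * l) + z k * z (i + 2 * l) - 2 * (z (i + l) * z (k + l))).
Proof.
move=> id kd.
have := rank3_form_polar_h 1 'X^l 'X^i 'X^k.
rewrite !expr1n !mul1r -!exprM -!exprD => e.
rewrite (addnC k) (addnC i (2 * l)%N) (addnC i) (addnC k) (mulnC 2) -e.
have b (H : {poly K}) : (size H <= (d - 2 * l).+1)%N -> degree_bounds d l (1 : {poly K}) 'X^l H.
  by split; rewrite ?size_poly1 ?size_polyXn.
apply: subspaceB3; apply: PQ; apply: b; rewrite ?size_polyXn //.
by apply: leq_trans (size_polyD _ _) _; rewrite geq_max !size_polyXn !ltnS id.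
Qed.

Lemma span_polar_fg a1 a2 b1 b2 c :
  (a1 <= l)%N -> (a2 <= l)%N -> (b1 <= l)%N -> (b2 <= l)%N -> (c <= d - 2 * l)%N ->
  P (2 * (z (a1 + a2 + c) * z (b1 + b2 + c))
     - z (a1 + b1 + c) * z (a2 + b2 + c) - z (a1 + b2 + c) * z (a2 + b1 + c)).
Proof.
move=> ha1 ha2 hb1 hb2 hc.
set q := (X in P X).
have -> : q = 2^-1 *: (2 * q).
  by rewrite mulr_natl -scaler_nat scalerA mulVf ?two_neq0 // scale1r.
apply: subspaceZ.
have := rank3_form_polar_fg 'X^a1 'X^a2 'X^b1 'X^b2 'X^c.
rewrite /= -!exprD -/q => <-.
have sX m k : (m <= k)%N -> (size ('X^m : {poly K}) <= k.+1)%N by rewrite size_polyXn.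
have sD m1 m2 : (m1 <= l)%N -> (m2 <= l)%N -> (size ('X^m1 + 'X^m2 : {poly K})%R <= l.+1)%N.
  by move=> h1 h2; apply: leq_trans (size_polyD _ _) _; rewrite geq_max !sX.
by apply: subspaceB3; apply: subspaceB3; apply: PQ; split; rewrite ?sX ?sD.
Qed.

Definition center w := z (w %/ 2) * z (w - w %/ 2).

Lemma center_balanced i j : (i <= j <= i.+1)%N -> center (i + j) = z i * z j.
Proof.
by move=> ij; congr (lin 'X^_ * lin 'X^_); move: ij; clear; lia.
Qed.

(** Induction on the gap between i and j. When it exceeds 2 l, polarising in h with
    f = 1 and g = x^l writes z_i z_j through products of smaller gap. Otherwise,
    split i and j, up to a common shift c, into halves and polarise in f and g:
    z_i z_j becomes the mean of two more balanced products, one of which may be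
    z_i z_j itself when the gap is 2. *)
Lemma span_center m i j : (i <= d)%N -> (j <= d)%N -> (i <= j + m)%N -> (j <= i + m)%N ->
  P (z i * z j - center (i + j)).
Proof.
elim: m i j => [|m IH] i j id jd ijm jim.
  have -> : i = j by move: ijm jim; clear; lia.
  by rewrite center_balanced ?subrr // leqnSn andbT.
wlog ij : i j id jd ijm jim / (i <= j)%N.
  move=> W; case: (leqP i j) => [|/ltnW] le; first exact: W.
  by rewrite mulrC addnC; apply: W.
have [jm|jm] := leqP j (i + m)%N.
  by apply: IH => //; move: ij; clear; lia.
have jE : j = (i + m).+1 by move: jm jim; clear; lia.
have [m0|m0] := posnP m.
  by rewrite center_balanced ?subrr // jE m0 addn0 leqnSn leqnn.
have [gap|gap] := ltnP (2 * l) (j - i).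
  have := @span_polar_h i (j - 2 * l) _ _.
  rewrite subnK; last by move: gap; clear; lia.
  move=> /(_ _ _)-T.
  pose t2 := z (j - 2 * l) * z (i + 2 * l); pose t3 := z (i + l) * z (j - 2 * l + l).
  have P2 : P (t2 - center (i + j)).
    have -> : (i + j = j - 2 * l + (i + 2 * l))%N by move: gap; clear; lia.
    apply: IH; move: gap l1 jE id jd; clear; lia.
  have P3 : P (t3 - center (i + j)).
    have -> : (i + j = i + l + (j - 2 * l + l))%N by move: gap; clear; lia.
    apply: IH; move: gap l1 jE id jd; clear; lia.
  have {T}/subspaceB/(_ P2)/subspaceD/(_ (subspaceZ 2 P3)) : P (z i * z j + t2 - 2 * t3).
    by apply: T; move: gap id jd; clear; lia.
  by congr P; rewrite scaler_nat mulr_natl; ring.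
(* The shift c is the least one bringing j down to 2 l, so that all four halves
   are at most l. *)
pose c := (j - 2 * l)%N; pose a1 := ((i - c) %/ 2)%N; pose a2 := (i - c - a1)%N.
pose b1 := ((j - c) %/ 2)%N; pose b2 := (j - c - b1)%N.
have T : P (2 * (z i * z j) - z (a1 + b1 + c) * z (a2 + b2 + c)
            - z (a1 + b2 + c) * z (a2 + b1 + c)).
  have eqi : (i = a1 + a2 + c)%N by rewrite /a2 /a1 /c; move: gap; clear; lia.
  have eqj : (j = b1 + b2 + c)%N by rewrite /b2 /b1 /c; clear; lia.
  rewrite {1}eqi {1}eqj; apply: span_polar_fg; rewrite /a2 /b2 /a1 /b1 /c;
    move: ij jd; clear; lia.
have P3 : P (z (a1 + b2 + c) * z (a2 + b1 + c) - center (i + j)).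
  have -> : (i + j = a1 + b2 + c + (a2 + b1 + c))%N.
    by rewrite /a2 /b2 /a1 /b1 /c; move: gap; clear; lia.
  apply: IH; rewrite /a2 /b2 /a1 /b1 /c; move: gap ij m0 jd id; clear; lia.
have half (x : {mpoly K[n]}) : P (2 * x) -> P x.
  move=> /(subspaceZ 2^-1); rewrite mulr_natl -scaler_nat scalerA mulVf ?two_neq0 //.
  by rewrite scale1r.
have [d2|d2] := leqP (a2 + b2) (a1 + b1 + m)%N.
  have P2 : P (z (a1 + b1 + c) * z (a2 + b2 + c) - center (i + j)).
    have -> : (i + j = a1 + b1 + c + (a2 + b2 + c))%N.
      by rewrite /a2 /b2 /a1 /b1 /c; move: gap; clear; lia.
    apply: IH; move: d2; rewrite /a2 /b2 /a1 /b1 /c; move: gap ij m0 jE jd id; clear; lia.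
  by apply: half; move: (subspaceD (subspaceD T P2) P3); congr P; ring.
(* Gap 2 with i - c and j - c odd: the first product is z_i z_j itself. *)
have e1 : (a1 + b1 + c = i)%N.
  by move: d2 m0 jE gap; rewrite /a2 /b2 /a1 /b1 /c; clear; lia.
have e2 : (a2 + b2 + c = j)%N.
  by move: d2 m0 jE gap; rewrite /a2 /b2 /a1 /b1 /c; clear; lia.
by rewrite e1 e2 in T; move: (subspaceD T P3); congr P; ring.
Qed.

Lemma linXn i (id : (i < n)%N) : lin 'X^i = 'X_(Ordinal id).
Proof.
rewrite linE (bigD1 (Ordinal id)) //= coefXn eqxx scale1r.
rewrite big1 ?addr0 // => k ki; rewrite coefXn.
by rewrite (_ : _ == _ = false) ?scale0r //; apply: negbTE.
Qed.

Lemma span_binomials (i j i' j' : 'I_n) : (i + j = i' + j')%N ->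
  P ('X_i * 'X_j - 'X_i' * 'X_j').
Proof.
have zX (k : 'I_n) : 'X_k = z k.
  by rewrite (linXn (ltn_ord k)); congr 'X_ _; apply: val_inj.
have c (a b : 'I_n) : P (z a * z b - center (a + b)).
  by apply: (span_center (m := d)); have := ltn_ord a; have := ltn_ord b; clear; lia.
move=> e; rewrite !zX; have := c i j; rewrite e => h.
by move: (subspaceB h (c i' j')); congr P; ring.
Qed.

End Pencils.

(** The exponent of p in the restriction of a monomial to the curve at (1 : p). *)
Definition weight (m : 'X_{1..n}) := (\sum_(i < n) i * m i)%N.

Lemma weightD m1 m2 : weight (m1 + m2)%MM = (weight m1 + weight m2)%N.
Proof.
by rewrite /weight -big_split; apply: eq_bigr => i _; rewrite mnmDE mulnDr.
Qed.

Lemma weight1 i : weight U_(i)%MM = i.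
Proof.
rewrite /weight (bigD1 i) //= mnm1E eqxx muln1 big1 ?addn0 // => j ij.
by rewrite mnm1E eq_sym (negPf ij) muln0.
Qed.

Lemma mevalX_curve m p : ('X_[m] : {mpoly K[n]}).@[rnc_vec d 1 p 0] = p ^+ weight m.
Proof.
rewrite mevalX /weight -prodrXr; apply: eq_bigr => i _.
by rewrite mxE expr1n mul1r exprM.
Qed.

(** Replace each monomial by a fixed representative of its weight. The form becomes
    a combination of representatives whose coefficients are those of its
    restriction to the curve, all zero. *)
Lemma vanishing_span k :
  (forall m m', mdeg m = k -> mdeg m' = k -> weight m = weight m' ->
     P ('X_[m] - 'X_[m'])) ->
  forall q : {mpoly K[n]}, q \is k.-homog ->
  (forall p, q.@[rnc_vec d 1 p 0] = 0) -> P q.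
Proof.
move=> hP q hq qC; have hm m : m \in msupp q -> mdeg m = k by exact: (dhomog_mf hq).
pose r w := xget 0%MM [set m : 'X_{1..n} | mdeg m = k /\ weight m = w].
have rP m : mdeg m = k -> P ('X_[m] - 'X_[r (weight m)]).
  move=> dm; rewrite /r; case: xgetP => [m' _ [dm' wm']|no]; first by apply: hP.
  by case: (no m).
pose N := (\max_(m <- msupp q) weight m).+1.
have wN m : m \in msupp q -> (weight m < N)%N.
  by move=> mq; rewrite ltnS; apply: (leq_bigmax_seq (F := weight)).
pose T (a : {poly K}) : {mpoly K[n]} := \sum_(w < N) a`_w *: 'X_[r w].
have q0 : \sum_(m <- msupp q) q@_m *: 'X^(weight m) = 0 :> {poly K}.
  apply: (poly_eq_horner charK) => p; rewrite horner0 -(qC p) mevalE horner_sum.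
  rewrite [RHS](eq_bigr (fun m => q@_m * ('X_[m] : {mpoly K[n]}).@[rnc_vec d 1 p 0])).
    by apply: eq_bigr => m _; rewrite mevalX_curve hornerZ hornerXn.
  by move=> m _; rewrite mevalX.
have -> : q = \sum_(m <- msupp q) q@_m *: ('X_[m] - 'X_[r (weight m)]).
  rewrite (eq_bigr _ (fun m _ => scalerBr _ _ _)) sumrB -mpolyE.
  rewrite (_ : \sum_(m <- msupp q) q@_m *: 'X_[r (weight m)] = T 0) ?subr0.
    by rewrite /T big1 ?subr0 // => w _; rewrite coef0 scale0r.
  rewrite -q0 /T; under [RHS]eq_bigr => w _.
    rewrite coef_sum scaler_suml; over.
  rewrite exchange_big big_seq [RHS]big_seq; apply: eq_bigr => m /wN mN.
  rewrite (bigD1 (Ordinal mN)) //= coefZ coefXn eqxx mulr1 big1 ?addr0 // => w wm.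
  rewrite coefZ coefXn (_ : _ == _ = false) ?mulr0 ?scale0r //.
  by apply: contraNF wm => /eqP e; apply/eqP/val_inj.
by apply: subspace_sum => m /hm dm; apply: subspaceZ; apply: rP.
Qed.

Section Ideal.
Hypothesis d_gt0 : (0 < d)%N.
Hypothesis PM : forall g u : {mpoly K[n]}, P u -> P (g * u).
Hypothesis Pbin : forall i j i' j' : 'I_n, (i + j = i' + j')%N ->
  P ('X_i * 'X_j - 'X_i' * 'X_j').

Local Notation std a r b := (('X_ord0 : {mpoly K[n]}) ^+ a * 'X_r * 'X_ord_max ^+ b).

(** Multiply a reduced monomial z_0^a z_r z_d^b by z_i and replace z_i z_r by
    z_0 z_(i+r) or by z_(i+r-d) z_d, whichever makes sense. *)
Lemma std_monomial k m : mdeg m = k.+1 -> exists a (r : 'I_n) b,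
  [/\ (a + b = k)%N, (r + d * b = weight m)%N & P ('X_[m] - std a r b)].
Proof.
elim: k m => [|k IH] m dm.
  have /eqP/mdeg1P [i /eqP ->] := dm.
  exists 0%N, i, 0%N; split=> //; first by rewrite weight1 muln0 addn0.
  by rewrite !expr0 mul1r mulr1 subrr.
have [i mi] : exists i, m i != 0%N.
  apply: contrapT => no; move: dm; rewrite mdegE big1 // => i _.
  by apply/eqP/negPn/negP => mi; apply: no; exists i.
have im : (U_(i) <= m)%MM by rewrite lep1mP.
have dm' : mdeg (m - U_(i)) = k.+1.
  by move: dm; rewrite -{1}(submK im) mdegD mdeg1 addn1 => -[].
have [a [r [b [ab rb Pm]]]] := IH _ dm'.
have wm : weight m = (weight (m - U_(i))%MM + i)%N by rewrite -{1}(submK im) weightD weight1.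
have P1 : P ('X_[m] - 'X_i * std a r b).
  rewrite -{1}(submK im) mpolyXD; move: (PM 'X_i Pm).
  by congr P; ring.
have [ird|dir] := leqP (i + r) d.
  have ird' : (i + r < n)%N by [].
  exists a.+1, (Ordinal ird'), b; split; first by rewrite addSn ab.
    by rewrite wm -rb /=; clear; lia.
  have /(PM ('X_ord0 ^+ a * 'X_ord_max ^+ b)) : P ('X_i * 'X_r - 'X_ord0 * 'X_(Ordinal ird')).
    by apply: Pbin.
  by move/(subspaceD P1); congr P; rewrite exprS; ring.
have ird' : (i + r - d < n)%N by have := ltn_ord i; have := ltn_ord r; clear; lia.
exists a, (Ordinal ird'), b.+1; split; first by rewrite addnS ab.
  by rewrite wm -rb /= mulnS; move: dir; clear; lia.
have /(PM ('X_ord0 ^+ a * 'X_ord_max ^+ b)) : P ('X_i * 'X_r - 'X_(Ordinal ird') * 'X_ord_max).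
  by apply: Pbin; rewrite /= subnK // ltnW.
by move/(subspaceD P1); congr P; rewrite exprS; ring.
Qed.

(** The only ambiguity is r = d with exponent b against r = 0 with exponent b + 1,
    and these name the same monomial. *)
Lemma std_monomial_unique a (r : 'I_n) b a' (r' : 'I_n) b' :
  (a + b = a' + b')%N -> (r + d * b = r' + d * b')%N -> std a r b = std a' r' b'.
Proof.
wlog bb : a r b a' r' b' / (b <= b')%N => [W|].
  case: (leqP b b') => [|/ltnW] le e1 e2; first exact: W.
  by apply/esym; apply: W.
move: bb; rewrite leq_eqVlt => /predU1P [<-|lt] e1 e2.
  have -> : a = a' by move: e1; clear; lia.
  have rr : val r = val r' by move: e2; rewrite /=; clear; lia.
  by rewrite (val_inj rr).
have [e bE] : exists e, b' = (b + e.+1)%N by exists (b' - b).-1; move: lt; clear; lia.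
have rd := ltn_ord r; have [e0 r0 rm] : [/\ e = 0%N, r' = ord0 & r = ord_max].
  move: e2; rewrite bE mulnDr mulnS => e2.
  have de : (d * e = 0)%N by move: e2 rd; clear; lia.
  have r'0 : val r' = 0%N by move: e2 rd; rewrite /=; clear; lia.
  have rd' : val r = d by move: e2 rd; rewrite de /=; clear; lia.
  split; [|exact: val_inj | exact: val_inj].
  by move/eqP: de; rewrite muln_eq0 eqn0Ngt d_gt0 => /eqP.
have -> : a = a'.+1 by move: e1; rewrite bE e0; clear; lia.
by rewrite r0 rm bE e0 addn1 !exprS; ring.
Qed.

Lemma ideal_monomials k m m' : mdeg m = k -> mdeg m' = k -> weight m = weight m' ->
  P ('X_[m] - 'X_[m']).
Proof.
case: k => [|k] dm dm' w.
  move/eqP: dm; rewrite mdeg_eq0 => /eqP ->; move/eqP: dm'; rewrite mdeg_eq0 => /eqP ->.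
  by rewrite subrr.
have [a [r [b [ab rb Pm]]]] := std_monomial dm.
have [a' [r' [b' [ab' rb' Pm']]]] := std_monomial dm'.
have e : std a r b = std a' r' b' by apply: std_monomial_unique; rewrite ?ab ?ab' ?rb ?rb'.
rewrite e in Pm; move: (subspaceB Pm Pm').
by congr P; ring.
Qed.

End Ideal.

End Subspace.

Lemma rnc_ideal_vanish (f : {mpoly K[n]}) : rnc_ideal f <->
  forall z, cone (@rnc K d) z -> f.@[z 0] = 0.
Proof.
split=> [If z Cz | h k z Cz].
  by rewrite meval_pihomog_sum big1 // => k _; apply: If.
apply: (pihomog_vanish charK) => c c0; rewrite -(h _ (coneZ c0 Cz)).
by apply: meval_eq => i; rewrite mxE.
Qed.

Lemma rnc_ideal_curve (f : {mpoly K[n]}) p k : rnc_ideal f ->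
  (pihomog mdeg k f).@[rnc_vec d 1 p 0] = 0.
Proof.
by move=> If; apply: If; exact: rnc_vec_cone.
Qed.

Section Stratum.
Variable l : nat.
Hypotheses (l1 : (1 <= l)%N) (ld : (2 * l <= d)%N).

(** P plays the role of a linear subspace; this form serves both the span of the
    stratum and the ideal it generates. *)
Lemma quadrics_span (P : {mpoly K[n]} -> Prop) : P 0 ->
  (forall (a : K) u v, P u -> P v -> P (a *: u + v)) ->
  (forall v, cone (@Wvar K d l) v -> P (quadric_poly v)) ->
  forall v : V, P (quadric_poly v).
Proof.
move=> P0 PL PW v.
have PQ F G H : degree_bounds d l F G H -> P (rank3_form d F G H).
  move=> b3; have [w [wE _]] := rank3_form_ex ld b3.
  have [w0|w0] := eqVneq w 0; first by rewrite -wE w0 linear0.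
  by rewrite -wE; apply: PW; apply/cone_WvarP => //; split=> //; exists F, G, H.
apply: (vanishing_span P0 PL (k := 2)) (quadric_poly_homog v) _; last first.
  by move=> p; exact: quadric_curve.
move=> m m' /mdeg2P [i [j ->]] /mdeg2P [i' [j' ->]].
rewrite !weightD !weight1 !mpolyXD => e.
exact: (span_binomials P0 PL l1 PQ e).
Qed.

Lemma Wvar_span (U : {vspace V}) :
  (forall v, cone (@Wvar K d l) v -> v \in U) -> U = fullv.
Proof.
move=> WU; apply/vspaceP => v; rewrite memvf; apply: (introT idP).
have [w wU /quadric_poly_inj <- //] : exists2 w, w \in U & quadric_poly w = quadric_poly v.
apply: (quadrics_span (P := fun q => exists2 w, w \in U & quadric_poly w = q)).
- by exists 0; rewrite ?mem0v ?linear0.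
- move=> a _ _ [u uU <-] [w wU <-]; exists (a *: u + w); last by rewrite linearP.
  by rewrite memvD ?memvZ.
by move=> w Cw; exists w => //; exact: WU.
Qed.

Lemma Wvar_non_degenerate : non_degenerate (@Wvar K d l).
Proof.
move=> H dH WH.
suff HV : H = fullv by move: dH; rewrite HV; move: (\dim _) => k; clear; lia.
apply: Wvar_span => v [p Wp vp].
by apply: (subvP (WH p Wp)); rewrite (vp : val p = _) memv_line.
Qed.

Lemma binomial_ideal (i j i' j' : 'I_n) : (i + j = i' + j')%N ->
  rnc_ideal ('X_i * 'X_j - 'X_i' * 'X_j' : {mpoly K[n]}).
Proof.
move=> e; apply/rnc_ideal_vanish => z [p [a [b [_ rp]]] zp].
have [c _ ->] := represents_line rp zp.
rewrite mevalB !mevalM !mevalXU !mxE.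
have := ltn_ord i; have := ltn_ord j; have := ltn_ord i'; have := ltn_ord j'.
rewrite !ltnS => hj' hi' hj hi.
have e' : (d - i + (d - j) = d - i' + (d - j'))%N by move: e hj' hi' hj hi; clear; lia.
apply/eqP; rewrite subr_eq0; apply/eqP.
transitivity (c ^+ 2 * a ^+ (d - i + (d - j)) * b ^+ (i + j)).
  by rewrite !exprD; ring.
by rewrite e e' !exprD; ring.
Qed.

Lemma Wvar_generates : (0 < d)%N ->
  ideal_generated_by (quadrics_in (@Wvar K d l)) = @rnc_ideal K d.
Proof.
move=> d0; apply/seteqP; split=> f.
  move=> [s sA ->]; apply/rnc_ideal_vanish => z Cz.
  rewrite raddf_sum big_seq big1 // => t /sA [Q _ ->] /=.
  rewrite mevalM; have /rnc_ideal_vanish -> // := quadric_poly_ideal Q.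
  by rewrite mulr0.
pose P := ideal_generated_by (quadrics_in (@Wvar K d l)).
have P0 : P 0 by exists [::]; rewrite ?big_nil.
have PL (a : K) u v : P u -> P v -> P (a *: u + v).
  move=> [s sA ->] [s' sA' ->].
  exists ([seq (a *: t.1, t.2) | t <- s] ++ s').
    move=> t; rewrite mem_cat => /orP [/mapP [t' /sA At ->] //|/sA' //].
  rewrite big_cat big_map /= scaler_sumr; congr (_ + _).
  by apply: eq_bigr => t _; rewrite scalerAl.
have PM (g u : {mpoly K[n]}) : P u -> P (g * u).
  move=> [s sA ->]; exists [seq (g * t.1, t.2) | t <- s].
    by move=> t /mapP [t' /sA At ->].
  by rewrite big_map mulr_sumr; apply: eq_bigr => t _; rewrite mulrA.
have PV v : P (quadric_poly v).
  apply: quadrics_span => // w Cw; exists [:: (1, quadric_poly w)].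
    by move=> t; rewrite inE => /eqP -> /=; exists w.
  by rewrite big_seq1 mul1r.
have Pbin (i j i' j' : 'I_n) : (i + j = i' + j')%N -> P ('X_i * 'X_j - 'X_i' * 'X_j').
  move=> e.
  have h2 a b : ('X_a * 'X_b : {mpoly K[n]}) \is 2.-homog.
    by rewrite -mpolyXD dhomogX /= mdegD !mdeg1.
  have [||v <-] := @quadric_poly_ex K d ('X_i * 'X_j - 'X_i' * 'X_j').
  - exact: rpredB.
  - exact: binomial_ideal.
  exact: PV.
move=> If; rewrite [f](pihomog_partitionE (leqnn (msize f))).
apply: (subspace_sum P0 PL) => k _.
apply: (vanishing_span P0 PL (k := k)); last 2 first.
- exact: pihomogP.
- by move=> p; exact: rnc_ideal_curve.
exact: ideal_monomials.
Qed.

End Stratum.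
End Spanning.

(** * Hilbert functions and chains of irreducible cones *)

Lemma rV_neq0 (R : fieldType) n (x : 'rV[R]_n) : x != 0 -> exists a, x 0 a != 0.
Proof.
move=> x0; apply: contrapT => no; case/eqP: x0; apply/rowP => a; rewrite mxE.
by apply/eqP/negPn/negP => xa; apply: no; exists a.
Qed.

(** Bounds the number of monomials of degree a in r + 1 variables. *)
Lemma bin_le_expn a r : ('C(a + r, r) <= a.+1 ^ r)%N.
Proof.
elim: r => [|r IH]; first by rewrite bin0 expn0.
rewrite -(leq_pmul2l (ltn0Sn r)) addnS -mul_bin_diag expnS mulnA.
by apply: leq_mul IH; clear; nia.
Qed.

Section HilbertFunction.
Variables (K : closedFieldType) (charK : [pchar K] =i pred0).

Lemma comp_homog n k e m (f : {mpoly K[n]}) (lq : n.-tuple {mpoly K[k]}) :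
  (forall i, tnth lq i \is e.-homog) -> f \is m.-homog -> f \mPo lq \is (e * m).-homog.
Proof.
move=> hl hf; rewrite comp_mpolyEX big_seq; apply: rpred_sum => p /(dhomog_mf hf) dp.
apply: rpredZ; rewrite comp_mpolyX -(dp : mdeg p = m) mdegE big_distrr /=.
elim/big_ind2: _ => [|a x b y ha hb|i _]; first exact: dhomog1.
  by apply: dhomogM.
exact: dhomogMn.
Qed.

Section Ambient.
Variable N : nat.
Implicit Types (Z : set 'rV[K]_N.+1).
Local Notation forms m := (dhomog N.+1 K m).

Lemma form_homog m (f : forms m) : (f : {mpoly K[N.+1]}) \is m.-homog.
Proof. by case: f. Qed.

Definition vanishing_forms Z m : {vspace forms m} :=
  vspace_of_set [set f : forms m | forall z, Z z -> (f : {mpoly K[N.+1]}).@[z 0] = 0].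

Lemma vanishing_formsP Z m (f : forms m) : f \in vanishing_forms Z m <->
  forall z, Z z -> (f : {mpoly K[N.+1]}).@[z 0] = 0.
Proof.
apply: (vspace_of_setP
  (P := [set f : forms m | forall z, Z z -> (f : {mpoly K[N.+1]}).@[z 0] = 0])).
  by move=> z _; rewrite /= meval0.
by move=> a u v /= hu hv z Zz; rewrite mevalD mevalZ hu // hv // mulr0 addr0.
Qed.

(** The Hilbert function of the cone Z: the dimension of the space of functions
    on Z induced by forms of degree m. *)
Definition hilbert Z m := (\dim {:forms m} - \dim (vanishing_forms Z m))%N.

Definition prime_cone Z := forall k l (f g : {mpoly K[N.+1]}),
  f \is k.-homog -> g \is l.-homog -> (forall z, Z z -> f.@[z 0] * g.@[z 0] = 0) ->
  (forall z, Z z -> f.@[z 0] = 0) \/ (forall z, Z z -> g.@[z 0] = 0).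

(** Multiplication by f is injective on functions on Z', as Z' is irreducible, and
    its image vanishes on Z. *)
Lemma hilbert_mul Z Z' m e (f : forms e) : Z `<=` Z' -> prime_cone Z' ->
  (forall z, Z z -> (f : {mpoly K[N.+1]}).@[z 0] = 0) ->
  ~ (forall z, Z' z -> (f : {mpoly K[N.+1]}).@[z 0] = 0) ->
  (hilbert Z (m + e) + hilbert Z' m <= hilbert Z' (m + e))%N.
Proof.
move=> ZZ' pZ' fZ fZ'.
have hM (g : forms m) : (g : {mpoly K[N.+1]}) * f \is (m + e).-homog.
  by apply: dhomogM; exact: form_homog.
have lM : linear (fun g : forms m => DHomog (hM g)).
  by move=> a g h; apply: val_inj; rewrite /= mulrDl scalerAl.
pose L0 := GRing.isLinear.Build K (forms m) (forms (m + e)) *:%R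
  (fun g => DHomog (hM g)) lM.
pose L1 : {linear forms m -> forms (m + e)} :=
  HB.pack (fun g : forms m => DHomog (hM g)) L0.
pose L := linfun L1.
have LE g : (L g : {mpoly K[N.+1]}) = (g : {mpoly K[N.+1]}) * f by rewrite lfunE.
have f0 : (f : {mpoly K[N.+1]}) != 0.
  by apply/eqP => f0; apply: fZ' => z _; rewrite f0 meval0.
have kL : lker L = 0%VS.
  apply/eqP/lker0P => g h /(congr1 (fun x : forms (m + e) => (x : {mpoly K[N.+1]}))).
  by rewrite !LE => /(mulIf f0) /val_inj.
have dimL (U : {vspace forms m}) : \dim (L @: U) = \dim U.
  by apply: limg_dim_eq; rewrite kL capv0.
pose I := (L @: fullv)%VS.
have IZ : (I <= vanishing_forms Z (m + e))%VS.
  apply/subvP => _ /memv_imgP [g _ ->]; apply/vanishing_formsP => z Zz.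
  by rewrite LE mevalM fZ // mulr0.
have Z'Z : (vanishing_forms Z' (m + e) <= vanishing_forms Z (m + e))%VS.
  by apply/subvP => g /vanishing_formsP h; apply/vanishing_formsP => z /ZZ'; exact: h.
have cap : (I :&: vanishing_forms Z' (m + e) <= L @: vanishing_forms Z' m)%VS.
  apply/subvP => _ /memv_capP [/memv_imgP [g _ ->] /vanishing_formsP h].
  apply: memv_img; apply/vanishing_formsP.
  have gf z : Z' z -> (g : {mpoly K[N.+1]}).@[z 0] * (f : {mpoly K[N.+1]}).@[z 0] = 0.
    by move=> Z'z; rewrite -mevalM -LE h.
  by case: (pZ' m e g f (form_homog g) (form_homog f) gf).
have := dimv_sum_cap I (vanishing_forms Z' (m + e)).
have := dimvS cap; rewrite !dimL => d1.
have d2 : (\dim (I + vanishing_forms Z' (m + e)) <= \dim (vanishing_forms Z (m + e)))%N.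
  by apply: dimvS; rewrite subv_add IZ.
have d3 := dimvS (subvf (vanishing_forms Z (m + e))).
have d4 := dimvS (subvf (vanishing_forms Z' m)).
have d5 := dimvS (subvf (vanishing_forms Z' (m + e))).
rewrite /hilbert; move: d1 d2 d3 d4 d5.
move: (\dim _) (\dim _) (\dim _) (\dim _) (\dim _) (\dim _) (\dim _).
clear; lia.
Qed.

Lemma hilbert_gt0 Z m z : Z z -> z != 0 -> (0 < hilbert Z m)%N.
Proof.
move=> Zz /rV_neq0 [j zj].
rewrite subn_gt0 ltnNge; apply/negP => le.
have hX : ('X_j : {mpoly K[N.+1]}) ^+ m \is m.-homog.
  by rewrite -{2}(mul1n m); apply: dhomogMn; rewrite dhomogX /= mdeg1.
have : DHomog hX \in vanishing_forms Z m.
  have -> : vanishing_forms Z m = fullv by apply/eqP; rewrite eqEdim subvf.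
  exact: memvf.
move/vanishing_formsP => /(_ z Zz) /=.
by rewrite rmorphXn /= mevalXU => /eqP; rewrite expf_eq0 (negPf zj) andbF.
Qed.

(** Some coordinate does not vanish on Z: apply [hilbert_mul] to it, with the empty
    set as the smaller cone. *)
Lemma hilbert_mono Z m k z : prime_cone Z -> Z z -> z != 0 ->
  (hilbert Z m <= hilbert Z (m + k))%N.
Proof.
move=> pZ Zz /rV_neq0 [j zj].
elim: k => [|k /leq_trans IH]; first by rewrite addn0.
rewrite addnS -addn1; apply: IH.
have hX : ('X_j : {mpoly K[N.+1]}) \is 1.-homog by rewrite dhomogX /= mdeg1.
apply: leq_trans (leq_addl (hilbert set0 (m + k + 1)) _) _.
apply: (@hilbert_mul _ _ _ _ (DHomog hX)) => //= h.
by move: (h z Zz); rewrite mevalXU => /eqP; rewrite (negPf zj).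
Qed.

(** Iterating [hilbert_mul] m times along degrees m, m + e, m + 2 e, up to (e + 1) m,
    each step contributes at least the value of the Hilbert function of Z at m. *)
Lemma hilbert_sub Z Z' m e (f : {mpoly K[N.+1]}) z :
  Z `<=` Z' -> prime_cone Z -> prime_cone Z' ->
  Z z -> z != 0 -> f \is e.-homog ->
  (forall z, Z z -> f.@[z 0] = 0) -> ~ (forall z, Z' z -> f.@[z 0] = 0) ->
  (m * hilbert Z m <= hilbert Z' (e.+1 * m))%N.
Proof.
move=> ZZ' pZ pZ' Zz z0 hf fZ fZ'.
have step k : (k * hilbert Z m <= hilbert Z' (m + k * e))%N.
  elim: k => [|k IH]; first by rewrite mul0n.
  rewrite !mulSn (_ : m + (e + k * e) = m + k * e + e)%N; last by rewrite addnA addnAC.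
  apply: leq_trans (@hilbert_mul _ _ _ _ (DHomog hf) ZZ' pZ' fZ fZ').
  apply: leq_add; last exact: IH.
  by rewrite -addnA; apply: (hilbert_mono _ _ pZ Zz z0).
by have := step m; rewrite mulSn (mulnC e).
Qed.

(** Pulling forms back along a parametrisation of degree e embeds functions of
    degree m on Z in forms of degree e m in r + 1 variables. *)
Lemma hilbert_param r e (lq : N.+1.-tuple {mpoly K[r.+1]}) Z m :
  (forall i, tnth lq i \is e.-homog) ->
  (forall z, Z z -> exists x : 'I_r.+1 -> K, forall i, z 0 i = (tnth lq i).@[x]) ->
  (hilbert Z m <= (e * m).+1 ^ r)%N.
Proof.
move=> hlq Zlq.
have hC (g : forms m) : (g : {mpoly K[N.+1]}) \mPo lq \is (e * m).-homog.
  by apply: comp_homog => //; case: g.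
have lC : linear (fun g : forms m => DHomog (hC g)).
  by move=> a g h; apply: val_inj; rewrite /= comp_mpolyD comp_mpolyZ.
pose L0 := GRing.isLinear.Build K (forms m) (dhomog r.+1 K (e * m)) *:%R
  (fun g => DHomog (hC g)) lC.
pose L1 : {linear forms m -> dhomog r.+1 K (e * m)} :=
  HB.pack (fun g : forms m => DHomog (hC g)) L0.
pose L := linfun L1.
have kL : (lker L <= vanishing_forms Z m)%VS.
  apply/subvP => g; rewrite memv_ker lfunE => /eqP /(congr1 val) /= g0.
  apply/vanishing_formsP => z /Zlq [x zx].
  transitivity ((0 : {mpoly K[r.+1]}).@[x]); last by rewrite meval0.
  by rewrite -g0 comp_mpoly_meval; apply: meval_eq.
have := limg_ker_dim L fullv; rewrite capfv => dE.
have dI : (\dim (limg L) <= 'C(e * m + r, r))%N.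
  apply: leq_trans (dimvS (subvf _)) _; rewrite dimvf /=.
  by rewrite -(bin_sub (leq_addl _ _)) addnK.
apply: leq_trans (bin_le_expn _ _); apply: leq_trans dI.
rewrite /hilbert -dE leq_subLR leq_add2r; exact: dimvS.
Qed.

End Ambient.

(** By [hilbert_sub] each step down the chain lowers the order of growth of the
    Hilbert function by at least one. It starts at most at r, and cannot become
    negative because the values are positive. *)
Lemma chain_length n r s e (lq : n.-tuple {mpoly K[r.+1]}) (Z : nat -> set 'rV[K]_n) :
  (forall i, tnth lq i \is e.-homog) ->
  (forall z, Z s z -> exists x : 'I_r.+1 -> K, forall i, z 0 i = (tnth lq i).@[x]) ->
  (forall i, (i <= s)%N -> exists2 z, Z i z & z != 0) ->
  (forall i, (i <= s)%N -> forall k l (f g : {mpoly K[n]}),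
    f \is k.-homog -> g \is l.-homog -> (forall z, Z i z -> f.@[z 0] * g.@[z 0] = 0) ->
    (forall z, Z i z -> f.@[z 0] = 0) \/ (forall z, Z i z -> g.@[z 0] = 0)) ->
  (forall i, (i < s)%N -> Z i `<=` Z i.+1) ->
  (forall i, (i < s)%N -> exists k (f : {mpoly K[n]}), [/\ f \is k.-homog,
     forall z, Z i z -> f.@[z 0] = 0 & ~ (forall z, Z i.+1 z -> f.@[z 0] = 0)]) ->
  (s <= r)%N.
Proof.
case: n lq Z => [|N] lq Z hlq Zlq Znz Zp Zsub Zf.
  have [z _] := Znz 0%N (leq0n _).
  by move/eqP; case; apply/rowP => - [].
have exp_le a b : (a <= b)%N -> (a ^ r <= b ^ r)%N.
  by move=> ab; case: (r) => // r'; rewrite leq_exp2r.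
have grow j : (j <= s)%N -> exists C, forall m,
    (m ^ j * hilbert (Z (s - j)%N) m <= C * m.+1 ^ r)%N.
  elim: j => [|j IH] js.
    exists (e.+1 ^ r)%N => m; rewrite subn0 mul1n -expnMn.
    apply: leq_trans (hilbert_param m hlq Zlq) _.
    by apply: exp_le; clear; nia.
  have [C HC] := IH (ltnW js).
  have iE : (s - j = (s - j.+1).+1)%N by move: js; clear; lia.
  have is_ : (s - j.+1 < s)%N by move: js; clear; lia.
  have [k [f [hf fZ fZ']]] := Zf _ is_; have [z Zz z0] := Znz _ (ltnW is_).
  exists (C * k.+1 ^ r)%N => m.
  have := hilbert_sub m (Zsub _ is_) (Zp _ (ltnW is_)) (Zp _ is_) Zz z0 hf fZ fZ'.
  rewrite -iE => le; rewrite expnSr -mulnA.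
  apply: leq_trans (leq_mul (leqnn _) le) _.
  apply: (@leq_trans ((k.+1 * m) ^ j * hilbert (Z (s - j)%N) (k.+1 * m))%N).
    by rewrite leq_mul // expnMn leq_pmull // expn_gt0.
  apply: leq_trans (HC _) _; rewrite -mulnA -expnMn leq_mul //.
  by apply: exp_le; clear; nia.
have [C HC] := grow s (leqnn s); rewrite leqNgt; apply/negP => rs.
have [z Zz z0] := Znz 0%N (leq0n _).
(* At this M the two bounds on the growth contradict each other if r < s. *)
pose M := (C * 2 ^ r).+1.
have := HC M; rewrite subnn => le.
have : (M ^ s <= C * M.+1 ^ r)%N.
  by apply: leq_trans le; rewrite leq_pmulr // (hilbert_gt0 _ Zz z0).
apply/negP; rewrite -ltnNge.
apply: (@leq_trans (M ^ r.+1)); last by rewrite leq_pexp2l.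
apply: (@leq_ltn_trans (C * (2 * M) ^ r)%N).
  by rewrite leq_mul // exp_le // /M; clear; lia.
by rewrite expnMn mulnA expnS ltn_pmul2r ?expn_gt0 // ltnS.
Qed.

End HilbertFunction.

(** * Smoothness of the second Veronese variety *)

Section Tangents.
Variables (K : closedFieldType) (charK : [pchar K] =i pred0).

Lemma mpoly_ring_ind N (Q : {mpoly K[N]} -> Prop) :
  (forall a, Q a%:MP) -> (forall i, Q 'X_i) ->
  (forall f g, Q f -> Q g -> Q (f + g)) -> (forall f g, Q f -> Q g -> Q (f * g)) ->
  forall f, Q f.
Proof.
move=> QC QX QD QM f; have Q1 : Q 1 by rewrite -mpolyC1; apply: QC.
rewrite (mpolyE f); apply: (big_ind Q) => [||m _].
- by rewrite -mpolyC0; apply: QC.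
- exact: QD.
rewrite -mul_mpolyC; apply: (QM) => //.
rewrite mpolyXE_id; apply: (big_ind Q) => [||i _]; [exact: Q1 | exact: QM |].
by elim: (m i) => [|k IH]; rewrite ?expr0 // exprS; apply: QM.
Qed.

Definition diff N (f : {mpoly K[N]}) (v w : 'I_N -> K) := \sum_i (f^`M(i)).@[v] * w i.

Lemma diffD N (f g : {mpoly K[N]}) v w : diff (f + g) v w = diff f v w + diff g v w.
Proof.
by rewrite /diff -big_split; apply: eq_bigr => i _; rewrite mderivD mevalD mulrDl.
Qed.

Lemma diffN N (f : {mpoly K[N]}) v w : diff (- f) v w = - diff f v w.
Proof.
by rewrite /diff -sumrN; apply: eq_bigr => i _; rewrite mderivN mevalN mulNr.
Qed.

Lemma diffM N (f g : {mpoly K[N]}) v w :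
  diff (f * g) v w = diff f v w * g.@[v] + f.@[v] * diff g v w.
Proof.
rewrite /diff mulr_suml mulr_sumr -big_split; apply: eq_bigr => i _ /=.
by rewrite mderivM mevalD !mevalM; ring.
Qed.

Lemma diffC N a v w : diff (a%:MP : {mpoly K[N]}) v w = 0.
Proof. by rewrite /diff big1 // => i _; rewrite mderivC meval0 mul0r. Qed.

Lemma diffX N (i : 'I_N) v w : diff 'X_i v w = w i.
Proof.
rewrite /diff (bigD1 i) //= big1 => [|j ji].
  rewrite mderivX mnm1E eqxx scale1r (_ : (_ - _)%MM = 0%MM) ?mpolyX0 ?meval1 ?mul1r ?addr0 //.
  by apply/mnmP => k; rewrite mnmBE mnm0E subnn.
by rewrite mderivX mnm1E eq_sym (negPf ji) scale0r meval0 mul0r.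
Qed.

(** Both sides obey the Leibniz rule in f. *)
Lemma diff_curve N (f : {mpoly K[N]}) (c : 'I_N -> {poly K}) (v w : 'I_N -> K) :
  (forall i, (c i).[0] = v i) -> (forall i, ((c i)^`()).[0] = w i) ->
  ((mmap polyC c f)^`()).[0] = diff f v w.
Proof.
move=> cv cw; have ev g : (mmap polyC c g).[0] = g.@[v].
  rewrite /mmap mevalE horner_sum; apply: eq_bigr => m _.
  rewrite hornerCM /mmap1 horner_prod; congr (_ * _); apply: eq_bigr => i _.
  by rewrite horner_exp cv.
elim/mpoly_ring_ind: f => [a|i|f g hf hg|f g hf hg].
- by rewrite mmapC derivC horner0 diffC.
- by rewrite mmapX mmap1U cw diffX.
- by rewrite mmapD derivD hornerD hf hg diffD.
by rewrite rmorphM /= derivM hornerD !hornerM hf hg !ev diffM.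
Qed.

Section Vector.
Variable V : vectType K.
Implicit Types v w : V.

Lemma homogeneous_ideal_vanish (X : set (proj V)) f :
  homogeneous_ideal (@coords K V @` cone X) f <->
  forall v, cone X v -> f.@[coords v 0] = 0.
Proof.
split=> [If v Cv | h k _ [v Cv <-]].
  by rewrite meval_pihomog_sum big1 // => k _; apply: If; exists v.
apply: (pihomog_vanish charK) => c c0; rewrite -(h _ (coneZ c0 Cv)).
by apply: meval_eq => i; rewrite coordsZ.
Qed.

(** The linear form on coordinates of which F is the value. *)
Definition functional_poly (F : V -> K) : {mpoly K[\dim {:V}]} :=
  \sum_(i < \dim {:V}) F (vbasis {:V})`_i *: 'X_i.

Lemma coordsE v : v = \sum_(i < \dim {:V}) coords v 0 i *: (vbasis {:V})`_i.
Proof.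
by rewrite {1}(coord_vbasis (memvf v)); apply: eq_bigr => i _; rewrite mxE.
Qed.

Lemma coords_inj v : coords v = 0 -> v = 0.
Proof. by move=> v0; rewrite (coordsE v) big1 // => i _; rewrite v0 mxE scale0r. Qed.

Lemma coordsD v w i : coords (v + w) 0 i = coords v 0 i + coords w 0 i.
Proof. by rewrite !mxE linearD. Qed.

Lemma functional_polyE (F : V -> K) (F0 : F 0 = 0) v :
  (forall a v w, F (a *: v + w) = a * F v + F w) ->
  (functional_poly F).@[coords v 0] = F v.
Proof.
move=> lF; rewrite raddf_sum {2}(coordsE v).
rewrite (big_morph F (id1 := 0) (op1 := +%R)) //; last first.
  by move=> x y; rewrite -[x]scale1r lF mul1r scale1r.
apply: eq_bigr => i _ /=; rewrite mevalZ mevalXU -[in RHS](addr0 (_ *: _)) lF F0 addr0.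
by rewrite mulrC.
Qed.

Lemma diff_functional (F : V -> K) (F0 : F 0 = 0) v w :
  (forall a v w, F (a *: v + w) = a * F v + F w) ->
  diff (functional_poly F) (coords v 0) (coords w 0) = F w.
Proof.
move=> lF; rewrite -(functional_polyE F0 w lF) /functional_poly raddf_sum /=.
rewrite (big_morph (fun f => diff f (coords v 0) (coords w 0)) (id1 := 0) (op1 := +%R)).
- apply: eq_bigr => i _; rewrite -mul_mpolyC diffM diffC mul0r add0r mevalC diffX.
  by rewrite mul_mpolyC mevalZ mevalXU.
- by move=> x y; exact: diffD.
- by rewrite -mpolyC0 diffC.
Qed.

Lemma proj_closedI (X Y : set (proj V)) :
  proj_closed X -> proj_closed Y -> proj_closed (X `&` Y).
Proof.
move=> [F hF ->] [G hG ->]; exists (F `|` G); first by move=> f [/hF|/hG].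
apply/seteqP; split=> [p [pF pG] f v [Ff|Gf]|p pFG]; [exact: pF | exact: pG |].
by split=> f v hf; apply: pFG; [left | right].
Qed.

End Vector.
End Tangents.

Section Veronese.
Variables (K : closedFieldType) (charK : [pchar K] =i pred0) (n : nat).
Local Notation Ver := (veronese2_space K n).
Local Notation nu := (@veronese2_vec K n).
Implicit Types (x h k : 'rV[K]_n.+1) (y : Ver).

Lemma sort_pair_proof (a b : 'I_n.+1) :
  let ij := if (a <= b)%N then (a, b) else (b, a) in (ij.1 <= ij.2)%N.
Proof. by case: leqP => //= /ltnW. Qed.

Definition sort_pair (a b : 'I_n.+1) : veronese2_idx n :=
  exist (fun ij : 'I_n.+1 * 'I_n.+1 => is_true (ij.1 <= ij.2)%N) _ (sort_pair_proof a b).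

Lemma sort_pairC a b : sort_pair a b = sort_pair b a.
Proof.
apply: val_inj => /=; case: (ltngtP a b) => // e.
by rewrite (val_inj e).
Qed.

Lemma sort_pairK (u : veronese2_idx n) : sort_pair (val u).1 (val u).2 = u.
Proof. by apply: val_inj => /=; rewrite (valP u); case: (val u). Qed.

(** The coordinates of the target of the Veronese map, arranged as a symmetric
    matrix, so that the variety becomes that of squares of vectors. *)
Definition sym_mx y : 'M[K]_n.+1 := \matrix_(a, b) y (sort_pair a b).

Lemma sym_mxE y a b : sym_mx y a b = y (sort_pair a b).
Proof. by rewrite mxE. Qed.

Lemma sym_mx_inj : injective sym_mx.
Proof.
move=> y z e; apply/ffunP => u; rewrite -(sort_pairK u).
by move/matrixP: e => /(_ (val u).1 (val u).2); rewrite !mxE.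
Qed.

Lemma sym_mxP a y z : sym_mx (a *: y + z) = a *: sym_mx y + sym_mx z.
Proof. by apply/matrixP => i j; rewrite !mxE !ffunE. Qed.

Lemma sym_mx_nu x a b : sym_mx (nu x) a b = x 0 a * x 0 b.
Proof. by rewrite !mxE ffunE /=; case: leqP => //= _; rewrite mulrC. Qed.

(** The polarisation of the Veronese map. *)
Definition mix h k : Ver := [ffun ij =>
  h 0 (val ij).1 * k 0 (val ij).2 + h 0 (val ij).2 * k 0 (val ij).1].

Lemma sym_mx_mix h k a b : sym_mx (mix h k) a b = h 0 a * k 0 b + h 0 b * k 0 a.
Proof. by rewrite !mxE ffunE /=; case: leqP => //= _; rewrite addrC. Qed.

Lemma nu_line h k t : nu (h + t *: k) = nu h + t *: mix h k + t ^+ 2 *: nu k.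
Proof.
apply/ffunP => u; rewrite !ffunE !mxE; rewrite -!/(t * _).
by rewrite /GRing.scale /=; ring.
Qed.

Lemma nu0 : nu 0 = 0.
Proof. by apply/ffunP => u; rewrite !ffunE !mxE mul0r. Qed.

Lemma nu_neq0 x : x != 0 -> nu x != 0.
Proof.
move=> /rV_neq0 [a xa]; apply/eqP => e; have := sym_mx_nu x a a.
by rewrite e mxE ffunE => /esym/eqP; rewrite mulf_eq0 (negPf xa).
Qed.

Lemma ver_basis y : y = \sum_u y u *: ([ffun j => (j == u)%:R] : Ver).
Proof.
apply/ffunP => u; rewrite sum_ffunE (bigD1 u) //= ffunE ffunE eqxx big1.
  by rewrite addr0 /GRing.scale /= mulr1.
by move=> j ju; rewrite !ffunE eq_sym (negPf ju) scaler0.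
Qed.

Section Embedding.
Variables (V : vectType K) (L : 'Hom(veronese2_space K n, V)).
Hypotheses (kerL : lker L == 0%VS) (imgL : limg L = fullv).
Variable X : set (proj V).
Hypothesis XP : forall v, cone X v <-> exists2 x, x != 0 & v = L (nu x).
Hypothesis irrX : irreducible_closed X.

(** Matrix entries as functionals on V, through the identification by L. *)
Definition entry a b (v : V) : K := sym_mx ((L^-1)%VF v) a b.

Lemma entryP a b (c : K) v w : entry a b (c *: v + w) = c * entry a b v + entry a b w.
Proof. by rewrite /entry linearP sym_mxP !mxE. Qed.

Lemma entry0 a b : entry a b 0 = 0.
Proof. by rewrite /entry linear0 mxE ffunE. Qed.

Lemma entry_img a b y : entry a b (L y) = sym_mx y a b.
Proof. by rewrite /entry lker0_lfunK. Qed.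

Lemma entry_inj v w : (forall a b, entry a b v = entry a b w) -> v = w.
Proof.
move=> e; rewrite -(limg_lfunVK (f := L) (x := v)) ?imgL ?memvf //.
rewrite -(limg_lfunVK (f := L) (x := w)) ?imgL ?memvf //.
by congr (L _); apply: sym_mx_inj; apply/matrixP => a b; exact: e.
Qed.

Lemma img_nu_neq0 x : x != 0 -> L (nu x) != 0.
Proof.
move=> x0; apply: contraNneq (nu_neq0 x0) => e.
by apply/eqP/(lker0P kerL); rewrite e linear0.
Qed.

Lemma polycurve_img_nu h k : polycurve (fun t => L (nu (h + t *: k))).
Proof.
move=> T; have [P PE] : polyfun1 (fun t =>
    T (L (nu h)) + t * T (L (mix h k)) + t * (t * T (L (nu k)))).
  have id1 : polyfun1 (fun t : K => t) by exists 'X => t; rewrite hornerX.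
  apply: polyfun1D; first exact: polyfun1_affine.
  by do 2!apply: polyfun1M => //; exact: polyfun1_const.
exists P => t; rewrite -PE nu_line !linearD !linearZ /= expr2 -/(t * _).
by rewrite /GRing.scale /= mulrA.
Qed.

(** The image of a coordinate subspace of dimension i: the vanishing of the last
    coordinates of x is that of the corresponding diagonal entries of the square
    of x. *)
Definition subveronese i : set (proj V) :=
  X `&` [set p | forall v, represents v p ->
    forall k : 'I_n.+1, (i < k)%N -> entry k k v = 0].

Lemma cone_subveronese i v : cone (subveronese i) v <->
  exists x, [/\ x != 0, v = L (nu x) & forall k : 'I_n.+1, (i < k)%N -> x 0 k = 0].
Proof.
split=> [[p [Xp h] vp]|[x [x0 vE xi]]].
  have /XP [x x0 vE] : cone X v by exists p.
  exists x; split=> // k ik; have := h v vp k ik.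
  by rewrite vE entry_img sym_mx_nu => /eqP; rewrite mulf_eq0 orbb => /eqP.
have [p Xp vp] : cone X v by apply/XP; exists x.
exists p => //; split=> // w wp k ik; have [c _ ->] := represents_line vp wp.
by rewrite -[_ *: _]addr0 entryP entry0 addr0 vE entry_img sym_mx_nu xi // mul0r mulr0.
Qed.

Lemma subveronese_closed i : proj_closed (subveronese i).
Proof.
apply: proj_closedI; first by case: irrX.
apply: (proj_closed_of_cone charK
  (S := [set F | exists2 k : 'I_n.+1, (i < k)%N & F = entry k k])).
  by move=> _ [k _ ->]; apply: polyfun_scalar => a v w; exact: entryP.
move=> v v0; split=> [[p h vp] _ [k ik ->]|h]; first exact: h.
have [p vp] := represents_ex v0; exists p => // w wp k ik.
have [c _ ->] := represents_line vp wp.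
by rewrite -[_ *: _]addr0 entryP entry0 addr0 (h (entry k k)) ?mulr0 //; exists k.
Qed.

Lemma subveronese_irreducible i : irreducible_closed (subveronese i).
Proof.
apply: (irreducible_of_curves charK); first exact: subveronese_closed.
  pose x : 'rV[K]_n.+1 := delta_mx 0 ord0.
  have x0 : x != 0.
    by apply/eqP => /rowP /(_ ord0) /eqP; rewrite !mxE !eqxx oner_eq0.
  have [p vp] := represents_ex (img_nu_neq0 x0); exists p.
  apply/(coneP _ vp)/cone_subveronese; exists x; split=> // k ik.
  rewrite mxE eqxx /= (_ : k == ord0 = false) //.
  by apply/negP => /eqP k0; rewrite k0 in ik.
move=> v w /cone_subveronese [x [x0 -> xi]] /cone_subveronese [y [y0 -> yi]].
exists (fun t => L (nu (x + t *: (y - x)))); split.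
- exact: polycurve_img_nu.
- by rewrite scale0r addr0.
- by rewrite scale1r addrC subrK.
move=> t nz; apply/cone_subveronese; exists (x + t *: (y - x)); split=> // [|k ik].
  by apply: contraNneq nz => ->; rewrite nu0 linear0.
by rewrite !mxE xi ?yi // !(oppr0, addr0, mulr0).
Qed.

Lemma subveronese_lt i : (i < n)%N -> subveronese i `<` subveronese i.+1.
Proof.
move=> lt_in; split.
  apply/cone_sub => v /cone_subveronese [x [x0 vE xi]]; apply/cone_subveronese.
  by exists x; split=> // k /ltnW; exact: xi.
pose k0 : 'I_n.+1 := Ordinal (lt_in : (i.+1 < n.+1)%N).
pose x : 'rV[K]_n.+1 := delta_mx 0 k0.
have xk : x 0 k0 = 1 by rewrite mxE !eqxx.
have x0 : x != 0 by apply/eqP => z; move: xk; rewrite z mxE => /esym/eqP; rewrite oner_eq0.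
move=> /cone_sub sub.
have /sub/cone_subveronese [z [_ e zi]] : cone (subveronese i.+1) (L (nu x)).
  apply/cone_subveronese; exists x; split=> // k ik; rewrite mxE eqxx /=.
  by case: eqP => // kk; move: ik; rewrite kk ltnn.
have := entry_img k0 k0 (nu x); rewrite e entry_img !sym_mx_nu zi // xk mul0r mul1r => /eqP.
by rewrite eq_sym oner_eq0.
Qed.

Lemma veronese_has_chain : has_chain X n.
Proof.
exists subveronese; split=> [i _|i]; last exact: subveronese_lt.
by split; [exact: subveronese_irreducible | move=> p []].
Qed.

(** The parametrisation is by quadrics in n + 1 variables, so the Hilbert function
    of the variety grows at most like the n-th power. *)
Lemma veronese_chain_le s : has_chain X s -> (s <= n)%N.
Proof.
move=> [c [cP clt]].
pose lq : (\dim {:V}).-tuple {mpoly K[n.+1]} :=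
  [tuple \sum_(u : veronese2_idx n) coords (L [ffun j => (j == u)%:R]) 0 i *:
     ('X_(val u).1 * 'X_(val u).2) | i < \dim {:V}].
have lqE x i : (tnth lq i).@[x 0] = coords (L (nu x)) 0 i.
  rewrite tnth_mktuple raddf_sum (ver_basis (nu x)) linear_sum mxE linear_sum.
  apply: eq_bigr => u _ /=; rewrite mevalZ mevalM !mevalXU !linearZ /= mxE ffunE.
  by rewrite mulrC.
apply: (@chain_length K _ n s 2 lq (fun i => @coords K V @` cone (c i))).
- move=> i; rewrite tnth_mktuple; apply: rpred_sum => u _; apply: rpredZ.
  by rewrite -mpolyXD dhomogX /= mdegD !mdeg1.
- move=> _ [v /(cone_sub (c s) X).2 Cv <-].
  have [|x x0 ->] := (XP v).1; first by apply: Cv; case: (cP s (leqnn s)).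
  by exists (x 0) => i; rewrite lqE.
- move=> i si; have [[_ [p cp] _] _] := cP i si; have [v vp] := proj_rep p.
  exists (coords v); first by exists v => //; exists p.
  by apply: contraNneq (represents_neq0 vp) => /coords_inj ->.
- move=> i si k l f g hf hg fg; have [[_ _ irr] _] := cP i si.
  have cl m (a : {mpoly K[\dim {:V}]}) :
      a \is m.-homog -> proj_closed (@proj_zeros K V [set a]).
    by move=> ha; exists [set a] => // _ ->; exists m.
  have back (a : {mpoly K[\dim {:V}]}) : c i `<=` proj_zeros [set a] ->
      forall z, (@coords K V @` cone (c i)) z -> a.@[z 0] = 0.
    by move=> h _ [v [p cp vp] <-]; apply: (h p cp a v).
  have cov : c i `<=` proj_zeros [set f] `|` proj_zeros [set g].
    move=> p cp; apply: contrapT => /not_orP [nf ng].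
    have [v vp] := proj_rep p.
    have Cv : (@coords K V @` cone (c i)) (coords v) by exists v => //; exists p.
    have forw m (a : {mpoly K[\dim {:V}]}) : a \is m.-homog -> a.@[coords v 0] = 0 ->
        proj_zeros [set a] p.
      move=> ha av _ w -> wp; have [e _ ->] := represents_line vp wp.
      by rewrite (meval_homog_scale ha (coordsZ e v)) av mulr0.
    have /eqP := fg _ Cv; rewrite mulf_eq0 => /orP [] /eqP z.
      by apply: nf; exact: forw hf z.
    by apply: ng; exact: forw hg z.
  by case: (irr _ _ (cl _ _ hf) (cl _ _ hg) cov) => /back; [left | right].
- move=> i si; have [sub _] := clt i si; move=> _ [v Cv <-]; exists v => //.
  by move: v Cv; apply/cone_sub.
move=> i si; have [_ /existsNP [p /not_implyP [cp ncp]]] := clt i si.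
have [[clo _ _] _] := cP i (ltnW si).
have [f [k [hf fc fp]]] := proj_closed_sep clo ncp.
have [v vp] := proj_rep p; exists k, f; split=> // [_ [w Cw <-]|h]; first exact: fc.
by case/eqP: (fp v vp); apply: h; exists v => //; exists p.
Qed.

(** The 2 x 2 minors through a fixed diagonal entry suffice: they determine a
    matrix near a square x^T x with x_a nonzero from its row a. *)
Definition diagonal_minor (a i j : 'I_n.+1) : {mpoly K[\dim {:V}]} :=
  functional_poly (entry a a) * functional_poly (entry i j)
  - functional_poly (entry a j) * functional_poly (entry i a).

Lemma functional_entryE a b v : (functional_poly (entry a b)).@[coords v 0] = entry a b v.
Proof. by apply: functional_polyE; [exact: entry0 | exact: entryP]. Qed.

Lemma diff_entry a b v w :
  diff (functional_poly (entry a b)) (coords v 0) (coords w 0) = entry a b w.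
Proof. by apply: diff_functional; [exact: entry0 | exact: entryP]. Qed.

Lemma diagonal_minor_ideal a i j :
  homogeneous_ideal (@coords K V @` cone X) (diagonal_minor a i j).
Proof.
apply/(homogeneous_ideal_vanish charK) => v /XP [x _ ->].
rewrite mevalB !mevalM !functional_entryE !entry_img !sym_mx_nu; ring.
Qed.

(** The lines h + t k give tangent vectors. Conversely the differentials of the
    minors through the entry (a, a), where h_a is not 0, express all entries of a
    tangent vector by those in row a, from which k is read off. *)
Lemma tangent_spaceP h w : h != 0 ->
  tangent_cone_space X (L (nu h)) w <-> exists k, w = L (mix h k).
Proof.
move=> h0; have [a ha] := rV_neq0 h0; split=> [tw|[k ->]].
  exists (\row_l (entry a l w / h 0 a - h 0 l * entry a a w / (2 * h 0 a ^+ 2))).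
  have sw i j : entry i j w = entry j i w by rewrite /entry !sym_mxE sort_pairC.
  apply: entry_inj => i j; rewrite entry_img sym_mx_mix !mxE.
  have := tw _ (diagonal_minor_ideal a i j); rewrite -/(diff _ _ _).
  rewrite /diagonal_minor diffD diffN !diffM !diff_entry !functional_entryE.
  rewrite !entry_img !sym_mx_nu.
  rewrite (sw i a) => e.
  have t0 := two_neq0 charK.
  have E : h 0 a ^+ 2 * entry i j w =
      h 0 a * h 0 j * entry a i w + h 0 i * h 0 a * entry a j w
     - h 0 i * h 0 j * entry a a w.
    by apply/eqP; rewrite -subr_eq0 -[X in _ == X]e; apply/eqP; ring.
  have -> : entry i j w = (h 0 a * h 0 j * entry a i w + h 0 i * h 0 a * entry a j w
     - h 0 i * h 0 j * entry a a w) / h 0 a ^+ 2.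
    by rewrite -E mulrC mulKf // expf_neq0.
  by field; rewrite t0 ha.
move=> f /(homogeneous_ideal_vanish charK) fX; rewrite -/(diff _ _ _).
pose v := L (nu h); pose u := L (mix h k); pose u2 := L (nu k).
pose c i : {poly K} := (coords v 0 i)%:P + coords u 0 i *: 'X + coords u2 0 i *: 'X^2.
have c0 i : (c i).[0] = coords v 0 i.
  by rewrite /c !(hornerD, hornerZ, hornerC, hornerX, hornerXn) expr0n !mulr0 !addr0.
have c1 i : ((c i)^`()).[0] = coords u 0 i.
  rewrite /c !(derivD, derivC, derivZ, derivX, derivXn) add0r.
  by rewrite !(hornerD, hornerZ, hornerC, hornerMn, hornerXn) mulr1 expr1 addr0 mulr0 addr0.
rewrite -(diff_curve f c0 c1).
suff -> : mmap polyC c f = 0 by rewrite derivC horner0.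
have hP : (h 0 a)%:P + k 0 a *: 'X != 0 :> {poly K}.
  apply: contraNneq ha => /(congr1 (fun p : {poly K} => p.[0])).
  by rewrite !hornerE => ->.
(* Multiplying by the a-th coordinate of h + t k discards the t, if any, at
   which the curve passes through the origin. *)
apply: (mulfI hP); rewrite mulr0; apply: (poly_eq_horner charK) => t.
rewrite horner0 hornerM.
have [z|nz] := eqVneq (h + t *: k) 0.
  have : (h + t *: k) 0 a = 0 by rewrite z mxE.
  by rewrite !mxE !hornerE [k 0 a * t]mulrC => ->; rewrite mul0r.
have -> : (mmap polyC c f).[t] = f.@[coords (L (nu (h + t *: k))) 0].
  rewrite /mmap mevalE horner_sum; apply: eq_bigr => m _.
  rewrite hornerCM /mmap1 horner_prod; congr (_ * _); apply: eq_bigr => i _.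
  rewrite horner_exp; congr (_ ^+ _).
  rewrite nu_line !linearD !linearZ /= !coordsD !coordsZ.
  by rewrite /c !(hornerD, hornerZ, hornerC, hornerX, hornerXn) !(mulrC t) (mulrC (t ^+ 2)).
by rewrite fX ?mulr0 //; apply/XP; exists (h + t *: k).
Qed.

Lemma veronese_smooth : smooth_variety X.
Proof.
split=> //; exists n.
  by split; [exact: veronese_has_chain | exact: veronese_chain_le].
move=> v /XP [h h0 ->].
have lt : linear (fun k => L (mix h k)).
  move=> a k k'; rewrite -linearP; congr (L _); apply/ffunP => u.
  by rewrite !ffunE !mxE /GRing.scale /=; ring.
pose T0 := GRing.isLinear.Build K 'rV[K]_n.+1 V *:%R (fun k => L (mix h k)) lt.
pose T1 : {linear 'rV[K]_n.+1 -> V} := HB.pack (fun k => L (mix h k)) T0.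
pose T := linfun T1.
have -> : vspace_of_set (tangent_cone_space X (L (nu h))) = limg T.
  apply/vspaceP => w; apply/idP/idP.
    move/(vspace_of_setP (@tangent_cone_space0 _ _ _ _) (@tangent_cone_spaceL _ _ _ _)).
    move/(tangent_spaceP _ h0) => [k ->].
    by apply/memv_imgP; exists k; rewrite ?memvf // lfunE.
  move=> /memv_imgP [k _ ->]; rewrite lfunE /=.
  apply/(vspace_of_setP (@tangent_cone_space0 _ _ _ _) (@tangent_cone_spaceL _ _ _ _)).
  by apply/(tangent_spaceP _ h0); exists k.
have [a ha] := rV_neq0 h0.
have kT : lker T = 0%VS.
  apply/eqP/lker0P => k k'; rewrite !lfunE /= => /(lker0P kerL) e.
  have E i j := congr1 (fun y => sym_mx y i j) e.
  have ka : k 0 a = k' 0 a.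
    have dbl (b : K) : b + b = 2 * b by ring.
    have := E a a; rewrite /= !sym_mx_mix !dbl.
    by move/(mulfI (two_neq0 charK))/(mulfI ha).
  apply/rowP => j; have := E a j; rewrite /= !sym_mx_mix ka => /addIr.
  exact: mulfI.
by rewrite limg_dim_eq ?kT ?capv0 // dimvf /dim /= mul1n.
Qed.

End Embedding.

End Veronese.

(** * The first stratum *)

Section FirstStratum.
Variables (K : closedFieldType) (charK : [pchar K] =i pred0) (d : nat).
Hypothesis d_ge2 : (2 <= d)%N.
Local Notation n := (d - 2)%N.
Local Notation V := (rnc_quadrics K d).
Local Notation Ver := (veronese2_space K n).
Local Notation nu := (@veronese2_vec K n).
Implicit Types (v w : V) (H : {poly K}) (y : Ver) (x : 'rV[K]_n.+1).

Definition quadric_biform (p : K) v : {poly K} := biform (gram_mx (quadric_poly v)) p.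

Lemma quadric_biform_is_linear p : linear (quadric_biform p).
Proof. by move=> a v w; rewrite /quadric_biform gramP biformP. Qed.

HB.instance Definition _ p :=
  GRing.isLinear.Build K V {poly K} *:%R (quadric_biform p) (quadric_biform_is_linear p).

Lemma quadric_biform_inj v w : (forall p, quadric_biform p v = quadric_biform p w) -> v = w.
Proof.
move=> e; apply/quadric_poly_inj.
apply: (gram_inj charK (quadric_poly_homog _) (quadric_poly_homog _)).
apply/eqP; rewrite -subr_eq0; apply/eqP/(biform_inj charK) => p.
by rewrite biformD biformN; apply/eqP; rewrite subr_eq0; apply/eqP; exact: e.
Qed.

Lemma bounded_line H : (size H <= n.+1)%N -> degree_bounds d 1 (1 : {poly K}) 'X H.
Proof. by move=> sH; split; rewrite ?size_poly1 ?size_polyX. Qed.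

Lemma line_stratum_bound : (2 * 1 <= d)%N.
Proof. exact: d_ge2. Qed.

(** The quadric Q_1(x, y, h). *)
Definition line_quadric H : V :=
  @Qmap K d 1 (DHomog (homogenize_homog 1 1)) (DHomog (homogenize_homog 1 'X))
    (DHomog (homogenize_homog (d - 2 * 1) H)).

Lemma line_quadricE H : (size H <= n.+1)%N ->
  quadric_poly (line_quadric H) = rank3_form d 1 'X H.
Proof.
move=> sH; rewrite Qmap_dehom ?line_stratum_bound //= !dehom_homogenize //.
  by rewrite size_polyX.
by rewrite size_poly1.
Qed.

Lemma biform_line_quadric H p : (size H <= n.+1)%N ->
  quadric_biform p (line_quadric H) = 2^-1 *: (('X - p%:P) ^+ 2 * (H.[p] *: H)).
Proof.
move=> sH; rewrite /quadric_biform line_quadricE //.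
rewrite (biform_pencil_at charK p line_stratum_bound (bounded_line sH)).
rewrite /pencil_at hornerX hornerC scale1r.
by rewrite alg_polyC -!mul_polyC polyCM; ring.
Qed.

(** The polarisation of h |-> Q_1(x, y, h) at the monomials x^a and x^b. *)
Definition polar_quadric (a b : nat) : V :=
  2^-1 *: (line_quadric ('X^a + 'X^b) - line_quadric 'X^a - line_quadric 'X^b).

Lemma biform_polar_quadric (a b : 'I_n.+1) p : quadric_biform p (polar_quadric a b) =
  2^-1 *: (('X - p%:P) ^+ 2 * (2^-1 *: (p ^+ a *: 'X^b + p ^+ b *: 'X^a))).
Proof.
have sa : (size ('X^a : {poly K}) <= n.+1)%N by rewrite size_polyXn.
have sb : (size ('X^b : {poly K}) <= n.+1)%N by rewrite size_polyXn.
have sab : (size ('X^a + 'X^b : {poly K})%R <= n.+1)%N.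
  by apply: leq_trans (size_polyD _ _) _; rewrite geq_max sa.
rewrite linearZ !linearB /= !biform_line_quadric // hornerD !hornerXn.
rewrite -!mul_polyC !polyCD; ring.
Qed.

Definition veronese_quadric y : V :=
  \sum_(a < n.+1) \sum_(b < n.+1) sym_mx y a b *: polar_quadric a b.

Lemma veronese_quadric_is_linear : linear veronese_quadric.
Proof.
move=> c y z; rewrite /veronese_quadric scaler_sumr -big_split; apply: eq_bigr => a _.
rewrite scaler_sumr -big_split; apply: eq_bigr => b _ /=.
by rewrite sym_mxP !mxE scalerDl -scalerA.
Qed.

HB.instance Definition _ :=
  GRing.isLinear.Build K Ver V *:%R veronese_quadric veronese_quadric_is_linear.

Lemma biform_coef m (M : 'M[K]_m.+1) p :
  biform M p = \sum_a \sum_b M a b *: (p ^+ a *: 'X^b).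
Proof.
rewrite /biform /rVpoly poly_def exchange_big; apply: eq_bigr => b _ /=.
rewrite valK mxE scaler_suml; apply: eq_bigr => a _.
by rewrite mxE expr1n mul1r scalerA mulrC.
Qed.

(** Both sides are linear in y; since sym_mx y is symmetric, p^a x^b may be replaced
    by its symmetrisation in the sum over a and b. *)
Lemma biform_veronese_quadric y p : quadric_biform p (veronese_quadric y) =
  2^-1 *: (('X - p%:P) ^+ 2 * biform (sym_mx y) p).
Proof.
rewrite /veronese_quadric linear_sum /=.
have half : biform (sym_mx y) p =
    \sum_a \sum_b sym_mx y a b *: (2^-1 *: (p ^+ a *: 'X^b + p ^+ b *: 'X^a)).
  have sw : biform (sym_mx y) p = \sum_a \sum_b sym_mx y a b *: (p ^+ b *: 'X^a).
    rewrite biform_coef exchange_big; apply: eq_bigr => b _; apply: eq_bigr => a _ /=.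
    by rewrite !sym_mxE sort_pairC.
  have dbl (P Q R : {poly K}) : P = Q -> P = R -> P = 2^-1 *: (Q + R).
    move=> <- <-; rewrite -mulr2n -scaler_nat scalerA mulVf ?two_neq0 //.
    by rewrite scale1r.
  rewrite (dbl _ _ _ (biform_coef _ _) sw) -big_split scaler_sumr; apply: eq_bigr => a _.
  rewrite -big_split scaler_sumr; apply: eq_bigr => b _ /=.
  by rewrite -[in LHS]scalerDr [LHS]scalerA [RHS]scalerA mulrC.
rewrite half mulr_sumr scaler_sumr; apply: eq_bigr => a _.
rewrite linear_sum mulr_sumr scaler_sumr; apply: eq_bigr => b _ /=.
rewrite linearZ /= biform_polar_quadric -[in RHS]scalerAr.
by rewrite [LHS]scalerA [RHS]scalerA mulrC.
Qed.

Lemma biform_sym_mx_nu x p : biform (sym_mx (nu x)) p = (rVpoly x).[p] *: rVpoly x.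
Proof.
have -> : sym_mx (nu x) = x^T *m x.
  by apply/matrixP => a b; rewrite sym_mx_nu !mxE big_ord1 mxE.
by rewrite /biform mulmxA rnc_vec_mul mul_scalar_mx linearZ.
Qed.

Lemma veronese_quadric_nu x : veronese_quadric (nu x) = line_quadric (rVpoly x).
Proof.
apply: quadric_biform_inj => p.
by rewrite biform_veronese_quadric biform_sym_mx_nu biform_line_quadric ?size_poly.
Qed.

Definition veronese_map : 'Hom(Ver, V) := linfun veronese_quadric.

Lemma veronese_mapE y : veronese_map y = veronese_quadric y.
Proof. exact: lfunE. Qed.

(** Polynomials form a domain, so (x - p)^2 can be cancelled. *)
Lemma veronese_map_ker : lker veronese_map == 0%VS.
Proof.
apply/lker0P => y z; rewrite !veronese_mapE => e; apply: sym_mx_inj.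
apply/eqP; rewrite -subr_eq0; apply/eqP/(biform_inj charK) => p.
rewrite biformD biformN; apply/eqP; rewrite subr_eq0; apply/eqP.
have := biform_veronese_quadric y p; rewrite e biform_veronese_quadric.
have h0 : 2^-1 != 0 :> K by rewrite invr_eq0 two_neq0.
move/(scalerI h0)/(mulfI _) => ->//.
by rewrite expf_neq0 ?polyXsubC_eq0.
Qed.

(** For f and g of degree 1, f(p) g(x) - g(p) f(x) is the determinant of the
    coefficients of f and g times x - p, and the determinant can be moved into h. *)
Lemma cone_W1 v : cone (@Wvar K d 1) v <-> exists2 x, x != 0 & v = veronese_map (nu x).
Proof.
rewrite (cone_WvarP v line_stratum_bound); split=> [[v0 [F [G [H [b3 vE]]]]]|[x x0 ->]].
  have [sF sG sH] := b3.
  pose e := F`_0 * G`_1 - F`_1 * G`_0.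
  have tE p : pencil_at F G p = e *: ('X - p%:P).
    have lin2 (P : {poly K}) : (size P <= 2)%N -> P = (P`_0)%:P + P`_1 *: 'X.
      move=> sP; apply/polyP => i; rewrite coefD coefC coefZ coefX.
      case: i => [|[|i]]; rewrite ?mulr0 ?mulr1 ?addr0 ?add0r //.
      by rewrite nth_default // (leq_trans sP).
    rewrite /pencil_at (lin2 F sF) (lin2 G sG) !hornerE /e.
    by rewrite -!mul_polyC !(polyCD, polyCN, polyCM); ring.
  have seH : (size (e *: H) <= n.+1)%N by apply: leq_trans (size_scale_leq _ _) sH.
  have vE' : v = veronese_map (nu (poly_rV (e *: H))).
    rewrite veronese_mapE veronese_quadric_nu poly_rV_K //.
    apply: quadric_biform_inj => p; rewrite biform_line_quadric // /quadric_biform vE.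
    rewrite (biform_pencil_at charK p line_stratum_bound b3) tE hornerZ.
    rewrite -!mul_polyC !polyCM; ring.
  exists (poly_rV (e *: H)) => //; apply: contraNneq v0 => x0.
  by rewrite vE' x0 nu0 linear0.
rewrite veronese_mapE veronese_quadric_nu.
have sx : (size (rVpoly x) <= n.+1)%N by exact: size_poly.
have h0 : rVpoly x != 0.
  by apply: contraNneq x0 => /(congr1 (@poly_rV K n.+1)); rewrite rVpolyK linear0 => ->.
split; last by exists 1, 'X, (rVpoly x); split; [exact: bounded_line | exact: line_quadricE].
apply: (rank3_form_neq0 charK line_stratum_bound (bounded_line sx) (line_quadricE sx)) => //.
  by rewrite coprime1p.
by rewrite size_poly1 size_polyX.
Qed.

(** The image contains W_1, which spans. *)
Lemma veronese_map_img : limg veronese_map = fullv.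
Proof.
apply: (Wvar_span charK (leqnn 1) line_stratum_bound) => v /cone_W1 [x _ ->].
exact: memv_img (memvf _).
Qed.

Lemma W1_veronese : proj_equivalent (@Wvar K d 1) (@veronese2 K n).
Proof.
exists (veronese_map^-1)%VF.
  exists veronese_map => v; first by rewrite limg_lfunVK // veronese_map_img memvf.
  by rewrite lker0_lfunK // veronese_map_ker.
have img (v : V) : ((veronese_map^-1)%VF @: <[v]> = <[(veronese_map^-1)%VF v]>)%VS.
  exact: limg_line.
have nuE x : (veronese_map^-1)%VF (veronese_map (nu x)) = nu x.
  by rewrite lker0_lfunK // veronese_map_ker.
apply/seteqP; split=> q.
  move=> [x x0 xq].
  have [p Wp vp] : cone (@Wvar K d 1) (veronese_map (nu x)) by apply/cone_W1; exists x.
  exists p => //; rewrite (vp : val p = _) img nuE; exact: xq.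
move=> [p Wp qE]; have [v vp] := proj_rep p.
have /cone_W1 [x x0 vE] : cone (@Wvar K d 1) v by exists p.
exists x => //; rewrite /represents qE (vp : val p = _) img vE nuE //.
Qed.

Lemma W1_smooth : smooth_variety (@Wvar K d 1).
Proof.
apply: (veronese_smooth charK veronese_map_ker veronese_map_img cone_W1).
exact: Wvar_irreducible line_stratum_bound.
Qed.

End FirstStratum.

Theorem theorem1p1 (K : closedFieldType) (charK : [pchar K] =i pred0)
    (d : nat) (d_ge2 : (2 <= d)%N) :
  [/\ minimal_irreducible_decomposition (@Phi3 K d)
        [set l | (1 <= l)%N /\ (2 * l <= d)%N] (@Wvar K d),
      forall l : nat, (1 <= l)%N -> (2 * l <= d)%N ->
        non_degenerate (@Wvar K d l) /\
        ideal_generated_by (quadrics_in (@Wvar K d l)) = @rnc_ideal K d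
    & proj_equivalent (@Wvar K d 1) (@veronese2 K (d - 2)) /\
      smooth_variety (@Wvar K d 1)].
Proof.
split; first exact: Phi3_decomposition.
  move=> l l1 ld; split; first exact: Wvar_non_degenerate.
  by apply: Wvar_generates => //; apply: ltnW.
by split; [exact: W1_veronese | exact: W1_smooth].
Qed.
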